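(* For every integer $m\ge1$, $$\sum_{n=0}^\infty\frac{(2n+1)^{2m-1}}{e^{(2n+1)y}+1}=\frac{1}{8m}\Big((-1)^mq_{2m}(x)z^{2m}+2(2^{2m-1}-1)B_{2m}\Big)\in\mathbb{Q}[x,z].$$
   Context: For $0<k<1$ let $x=k^2$, $K=\int_0^{\pi/2}\frac{d\varphi}{\sqrt{1-k^2\sin^2\varphi}}$, $K'=\int_0^{\pi/2}\frac{d\varphi}{\sqrt{1-(1-k^2)\sin^2\varphi}}$, $y=\pi K'/K$, $z=\frac{2}{\pi}K$. The Jacobi amplitude $\varphi=\mathrm{am}(u,k)$ inverts $u=\int_0^\varphi\frac{dt}{\sqrt{1-k^2\sin^2t}}$, $\mathrm{sn}(u)=\sin\varphi$, $\mathrm{dn}(u)=\sqrt{1-k^2\mathrm{sn}^2u}$, $\mathrm{ds}(u)=\mathrm{dn}(u)/\mathrm{sn}(u)$. The polynomials $q_m\in\mathbb{Q}[x]$ are defined by the Maclaurin expansion $u\,\mathrm{ds}(u)=\sum_{m\ge0}\frac{q_m(x)}{m!}u^m$. $B_j$ are the Bernoulli numbers ($\frac{t}{e^t-1}=\sum_j B_jt^j/j!$). Membership in $\mathbb{Q}[x,z]$ means being a polynomial in $x,z$ with rational coefficients. *)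

(* Defs.v *)
From Stdlib Require Import Reals Factorial ClassicalEpsilon.
From mathcomp Require Import ssralg poly polyXY rat.
From mathcomp Require Import Rstruct.
From Coquelicot Require Import Coquelicot.
Local Open Scope R_scope.

(* Throughout, [M] is the parameter of the integral (the square of the
   modulus), and [k] is the modulus. *)
Definition ellF (M phi : R) : R :=
  RInt (fun t => 1 / sqrt (1 - M * (sin t) ^ 2)) 0 phi.

Definition ellK (k : R) : R := ellF (k ^ 2) (PI / 2).
Definition ellK' (k : R) : R := ellF (1 - k ^ 2) (PI / 2).

Definition par_x (k : R) : R := k ^ 2.
Definition par_y (k : R) : R := PI * ellK' k / ellK k.
Definition par_z (k : R) : R := 2 / PI * ellK k.

(* For 0 < k < 1 the map [ellF (k ^ 2)] is an increasing bijection of R, so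
   the angle selected here exists and is unique. *)
Definition am (u k : R) : R :=
  epsilon (inhabits 0) (fun phi => ellF (k ^ 2) phi = u).

Definition sn (u k : R) : R := sin (am u k).
Definition dn (u k : R) : R := sqrt (1 - k ^ 2 * (sn u k) ^ 2).
Definition ds (u k : R) : R := dn u k / sn u k.

Definition Qeval (p : {poly rat}) (x : R) : R := (map_poly ratr p).[x]%R.

(* An element of Q[x, z] is encoded in {poly {poly rat}}, with outer variable
   z and coefficients in Q[x]. *)
Definition Qeval2 (P : {poly {poly rat}}) (x z : R) : R :=
  (map_poly (map_poly ratr) P).[z, x]%R.

(* The expansion is required on a punctured neighbourhood of 0, because
   [u * ds u k] has a removable singularity at u = 0. *)
Definition ds_maclaurin (q : nat -> {poly rat}) : Prop :=
  forall k : R, 0 < k < 1 ->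
    locally' 0 (fun u : R =>
      is_pseries (fun m => Qeval (q m) (k ^ 2) / INR (fact m)) u (u * ds u k)).

Definition q_ : nat -> {poly rat} :=
  epsilon (inhabits (fun _ => 0%R)) ds_maclaurin.

(* The singularity of t / (e^t - 1) at t = 0 is removable as well. *)
Definition bernoulli_egf (B : nat -> R) : Prop :=
  locally' 0 (fun t : R =>
    is_pseries (fun j => B j / INR (fact j)) t (t / (exp t - 1))).

Definition bernoulli : nat -> R :=
  epsilon (inhabits (fun _ => 0)) bernoulli_egf.

(* Main.v *)
(* The idea.  For y > 0 put a_j = 1 / cosh (j y / 2), j odd.  The Fourier
   series C(t) = sum_j a_j cos (j t) and its imaginary-argument version
   H(s) = sum_j a_j exp (j s), |s| < y / 2, have the same convolution cube:
   partial fractions for products of hyperbolic functions turn the coefficient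
   sums into telescoping sums, and a * a * a = a (kappa + j^2 / 2).  Hence
   C'' = - 2 C^3 + 2 kappa C and H'' = 2 H^3 - 2 kappa H; with al = C(0) = H(0)
   and b = al^2 - 2 kappa the first integrals are
   (C')^2 = (al^2 - C^2) (C^2 + b) and (H')^2 = (H^2 - al^2) (H^2 + b).  With
   z^2 = al^2 + b and k = al / z, uniqueness for these equations gives
   C(t) = z k cn(z t, k) and H(y/2 - v) = z ds(z v, k').  The values of C at pi
   and at the point where cn = -1, and the pole of H at y / 2, force
   z pi = 2 K and z y = 2 K', so that y = pi K'/K; as K'/K is injective in k,
   every modulus arises in this way.  On the other hand
   H(y/2 - v) = 1 / sinh v + 4 sum_{j > 0} sinh (j v) / (e^{j y} + 1), and
   comparing Taylor coefficients in v expresses the sums through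
   q_{2m}(1 - x) and Bernoulli numbers.  The differential equation
   (ds')^2 = (ds^2 + x) (ds^2 - (1 - x)) yields a recursion for the q_{2m},
   which gives their rationality and q_{2m}(1 - x) = (-1)^m q_{2m}(x). *)

(* The first integrals alone do not determine their solutions, because the square roots fail to be
   Lipschitz at the turning points; the comparison with Jacobi functions therefore uses second-order
   equations, whose right sides are cubic polynomials. A Gronwall argument for these needs bounded
   solutions. This is why [/ Hs] is compared with [sd]: both stay bounded up to the pole, where [Hs]
   and [ds] blow up.

   The functions and sequences [am], [q_] and [bernoulli] are epsilon choices and carry no
   information until a witness is exhibited. For [q_] this is the delicate point, since one sequence
   of rational polynomials must serve all moduli. Analyticity of [u * ds u k] is not derived from
   the elliptic integral: it is read off the Lambert expansion at the complementary modulus. The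
   resulting coefficients [dsc k m] look transcendental, and only the recursion shows that they are
   polynomials in [k ^ 2], from which the witness is built. The Lambert expansion thus serves twice,
   as the source of the Maclaurin expansion and as the identity from which the sums are
   extracted. *)
Require Import Defs.
From Stdlib Require Import Reals ZArith Lra Lia.
From mathcomp Require Import ssralg ssrnum poly polyXY rat Rstruct.
From Coquelicot Require Import Coquelicot.
Local Open Scope R_scope.

(* Coquelicot's generic lemmas leave equations at a structure's carrier, which
   [ring] does not recognise as [R]. *)
Ltac req := match goal with |- @eq _ ?a ?b => change (@eq R a b) end.

(** * Double series and two-sided sums *)

Lemma sum_n_le_is_series (a : nat -> R) (l : R) (N : nat) :
  (forall n, 0 <= a n) -> is_series a l -> sum_n a N <= l.
Proof.
  intros Ha Hl.
  apply (is_lim_seq_incr_compare (sum_n a)); [exact Hl|].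
  intros n; rewrite sum_Sn; unfold plus; simpl; specialize (Ha (S n)); lra.
Qed.

Lemma term_le_is_series (a : nat -> R) (l : R) (N : nat) :
  (forall n, 0 <= a n) -> is_series a l -> a N <= l.
Proof.
  intros Ha Hl. apply Rle_trans with (2 := sum_n_le_is_series a l N Ha Hl).
  destruct N as [|N]; [rewrite sum_O; lra|].
  rewrite sum_Sn; unfold plus; simpl.
  assert (0 <= sum_n a N); [|lra].
  rewrite sum_n_Reals; apply cond_pos_sum; exact Ha.
Qed.

Lemma is_series_le (a b : nat -> R) (la lb : R) :
  (forall n, a n <= b n) -> is_series a la -> is_series b lb -> la <= lb.
Proof.
  intros H Ha Hb.
  apply (is_lim_seq_le (sum_n a) (sum_n b) la lb); [|exact Ha|exact Hb].
  intros n; apply sum_n_m_le; exact H.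
Qed.

Lemma ex_series_sum_n (a : nat -> nat -> R) (M : nat) :
  (forall m, ex_series (fun j => a j m)) ->
  ex_series (fun j => sum_n (a j) M).
Proof.
  intros H; induction M as [|M IH].
  - apply ex_series_ext with (2 := H O); intros j; rewrite sum_O; reflexivity.
  - apply ex_series_ext with (fun j => plus (sum_n (a j) M) (a j (S M))).
    + intros j; rewrite sum_Sn; reflexivity.
    + apply (ex_series_plus (V := R_NormedModule)); [exact IH|apply H].
Qed.

Lemma Series_sum_n (a : nat -> nat -> R) (M : nat) :
  (forall m, ex_series (fun j => a j m)) ->
  Series (fun j => sum_n (a j) M) = sum_n (fun m => Series (fun j => a j m)) M.
Proof.
  intros H; induction M as [|M IH].
  - rewrite sum_O; apply Series_ext; intros j; rewrite sum_O; reflexivity.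
  - rewrite sum_Sn, <- IH.
    rewrite (Series_ext _ (fun j => sum_n (a j) M + a j (S M)));
      [|intros j; rewrite sum_Sn; reflexivity].
    apply Series_plus; [apply ex_series_sum_n; exact H|apply H].
Qed.

(** Finite sums commute with series, so every partial sum over columns is at most [l], which gives a
    limit [L <= l]. Every partial sum over rows is in turn at most [L], which gives [l <= L]. *)
Lemma is_series_tonelli (a : nat -> nat -> R) (A : nat -> R) (l : R) :
  (forall j m, 0 <= a j m) -> (forall j, is_series (a j) (A j)) ->
  is_series A l ->
  (forall m, ex_series (fun j => a j m)) /\
  is_series (fun m => Series (fun j => a j m)) l.
Proof.
  intros H0 HA Hl.
  assert (Hex : forall m, ex_series (fun j => a j m)).
  { intros m; apply (ex_series_le (K := R_AbsRing) (V := R_CompleteNormedModule) _ A); [|exists l; exact Hl].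
    intros j; change (Rabs (a j m) <= A j).
    rewrite Rabs_pos_eq by apply H0.
    apply term_le_is_series; [apply H0|apply HA]. }
  split; [exact Hex|].
  set (C := fun m => Series (fun j => a j m)).
  assert (HCs : forall M, is_series (fun j => sum_n (a j) M) (sum_n C M)).
  { intros M; unfold C; rewrite <- Series_sum_n by exact Hex.
    apply Series_correct, ex_series_sum_n, Hex. }
  assert (HC0 : forall m, 0 <= C m).
  { intros m; apply (is_series_le (fun _ => 0) (fun j => a j m));
      [intros; apply H0| |apply Series_correct, Hex].
    apply (filterlim_ext (fun _ => 0));
      [intros n; rewrite sum_n_const; ring|apply filterlim_const]. }
  assert (Hb : forall M, sum_n C M <= l).
  { intros M; apply (is_series_le _ _ _ _ (fun j => sum_n_le_is_series (a j) (A j) M (H0 j) (HA j)) (HCs M) Hl). }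
  assert (Hinc : forall n, sum_n C n <= sum_n C (S n)).
  { intros n; rewrite sum_Sn; unfold plus; simpl; specialize (HC0 (S n)); lra. }
  destruct (ex_finite_lim_seq_incr (sum_n C) l Hinc Hb) as [L HL].
  assert (HLl : L <= l).
  { apply (is_lim_seq_le (sum_n C) (fun _ => l) L l Hb HL), is_lim_seq_const. }
  assert (HlL : l <= L).
  { assert (HJ : forall J, sum_n A J <= L).
    { intros J.
      assert (HS : is_series (fun m => sum_n (fun j => a j m) J) (sum_n A J)).
      { induction J as [|J IH].
        - rewrite sum_O; apply is_series_ext with (2 := HA O); intros; rewrite sum_O; reflexivity.
        - rewrite sum_Sn. apply is_series_ext with (fun m => plus (sum_n (fun j => a j m) J) (a (S J) m)).
          + intros m; rewrite sum_Sn; reflexivity.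
          + apply (is_series_plus (V := R_NormedModule)); [exact IH|apply HA]. }
      apply (is_series_le _ C _ L) with (2 := HS); [|exact HL].
      intros m; apply sum_n_le_is_series; [intros; apply H0|apply Series_correct, Hex]. }
    apply (is_lim_seq_le (sum_n A) (fun _ => L) l L HJ Hl), is_lim_seq_const. }
  replace l with L by lra. exact HL.
Qed.

(** Write [a] as [(a + |a|) - |a|] and apply the nonnegative case to both parts. *)
Lemma Series_fubini (a : nat -> nat -> R) :
  (forall j, ex_series (fun m => Rabs (a j m))) ->
  ex_series (fun j => Series (fun m => Rabs (a j m))) ->
  (forall m, ex_series (fun j => Rabs (a j m))) /\
  ex_series (fun m => Series (fun j => Rabs (a j m))) /\
  Series (fun j => Series (a j)) = Series (fun m => Series (fun j => a j m)).
Proof.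
  intros H1 H2.
  destruct (is_series_tonelli (fun j m => Rabs (a j m)) _ _ (fun j m => Rabs_pos _)
    (fun j => Series_correct _ (H1 j)) (Series_correct _ H2)) as [H3 H4].
  split; [exact H3|]. split; [eexists; exact H4|].
  assert (Hj : forall j, ex_series (a j)) by (intros j; apply ex_series_Rabs, H1).
  assert (Hm : forall m, ex_series (fun j => a j m)) by (intros m; apply ex_series_Rabs, H3).
  assert (Ha : ex_series (fun j => Series (a j))).
  { apply (ex_series_le (K := R_AbsRing) (V := R_CompleteNormedModule) _ _) with (2 := H2).
    intros j; apply Series_Rabs, H1. }
  assert (Hb : forall j, is_series (fun m => a j m + Rabs (a j m)) (Series (a j) + Series (fun m => Rabs (a j m)))).
  { intros j; apply (is_series_plus (V := R_NormedModule)); apply Series_correct; [apply Hj|apply H1]. }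
  assert (Hc : is_series (fun j => Series (a j) + Series (fun m => Rabs (a j m)))
    (Series (fun j => Series (a j)) + Series (fun j => Series (fun m => Rabs (a j m))))).
  { apply (is_series_plus (V := R_NormedModule)); apply Series_correct; assumption. }
  destruct (is_series_tonelli (fun j m => a j m + Rabs (a j m)) _ _
    (fun j m => ltac:(pose proof (Rle_abs (- a j m)) as E; rewrite Rabs_Ropp in E; lra)) Hb Hc) as [_ H5].
  assert (H6 : is_series (fun m => Series (fun j => a j m + Rabs (a j m)) + - Series (fun j => Rabs (a j m)))
    (Series (fun j => Series (a j)))).
  { replace (Series (fun j => Series (a j))) with
      (Series (fun j => Series (a j)) + Series (fun j => Series (fun m => Rabs (a j m)))
       + - Series (fun j => Series (fun m => Rabs (a j m)))) by ring.
    apply (is_series_plus (V := R_NormedModule)); [exact H5|].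
    apply (is_series_opp (V := R_NormedModule)); exact H4. }
  symmetry; apply is_series_unique.
  apply is_series_ext with (2 := H6). intros m.
  rewrite Series_plus; [req; ring|apply Hm|apply H3].
Qed.

(** The index [n] stands for the odd frequency [2 n + 1], so that [n] and [-1 - n] carry opposite
    frequencies. Folding the integers along this reflection turns a two-sided sum into a series over
    [nat] and puts each frequency next to its negative. *)
Definition zpair (f : Z -> R) (n : nat) : R := f (Z.of_nat n) + f (- Z.of_nat n - 1)%Z.
Definition zsum (f : Z -> R) : R := Series (zpair f).
Definition zsummable (f : Z -> R) : Prop := ex_series (zpair (fun n => Rabs (f n))).

Lemma zpair_Rabs (f : Z -> R) n : Rabs (zpair f n) <= zpair (fun i => Rabs (f i)) n.
Proof. apply Rabs_triang. Qed.

Lemma zpair_Rabs_ge0 (f : Z -> R) n : 0 <= zpair (fun i => Rabs (f i)) n.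
Proof.
  unfold zpair; pose proof (Rabs_pos (f (Z.of_nat n)));
  pose proof (Rabs_pos (f (- Z.of_nat n - 1)%Z)); lra.
Qed.

Lemma ex_series_dom (a b : nat -> R) :
  (forall n, Rabs (a n) <= b n) -> ex_series b -> ex_series a.
Proof. apply (ex_series_le (K := R_AbsRing) (V := R_CompleteNormedModule)). Qed.

Lemma zsummable_ex (f : Z -> R) : zsummable f -> ex_series (zpair f).
Proof. apply ex_series_dom; intros; apply zpair_Rabs. Qed.

Lemma zsummable_halves (f : Z -> R) :
  zsummable f <-> ex_series (fun n => Rabs (f (Z.of_nat n))) /\
                  ex_series (fun n => Rabs (f (- Z.of_nat n - 1)%Z)).
Proof.
  split.
  - intros H; split; apply (ex_series_dom _ _) with (2 := H); intros n; rewrite Rabs_Rabsolu; unfold zpair;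
    pose proof (Rabs_pos (f (Z.of_nat n))); pose proof (Rabs_pos (f (- Z.of_nat n - 1)%Z)); lra.
  - intros [H1 H2]; apply (ex_series_plus (V := R_NormedModule) _ _ H1 H2).
Qed.

Lemma zsum_halves (f : Z -> R) : zsummable f ->
  zsum f = Series (fun n => f (Z.of_nat n)) + Series (fun n => f (- Z.of_nat n - 1)%Z).
Proof.
  intros H; apply zsummable_halves in H as [H1 H2].
  apply Series_plus; apply ex_series_Rabs; assumption.
Qed.

Lemma zsum_ext (f g : Z -> R) : (forall n, f n = g n) -> zsum f = zsum g.
Proof. intros H; apply Series_ext; intros n; unfold zpair; rewrite !H; reflexivity. Qed.

Lemma zsummable_le (f g : Z -> R) :
  (forall n, Rabs (f n) <= g n) -> zsummable g -> zsummable f.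
Proof.
  intros H; apply (ex_series_dom _ _). intros n.
  rewrite Rabs_pos_eq by apply zpair_Rabs_ge0.
  unfold zpair; apply Rplus_le_compat; (eapply Rle_trans; [apply H|apply Rle_abs]).
Qed.

Lemma zsummable_ext (f g : Z -> R) : (forall n, f n = g n) -> zsummable f -> zsummable g.
Proof.
  intros H; apply ex_series_ext; intros n; unfold zpair; rewrite !H; reflexivity.
Qed.

Lemma zsummable_abs (f : Z -> R) : zsummable f -> zsummable (fun n => Rabs (f n)).
Proof.
  apply ex_series_ext; intros n; unfold zpair; rewrite !Rabs_Rabsolu; reflexivity.
Qed.

Lemma zsummable_plus (f g : Z -> R) :
  zsummable f -> zsummable g -> zsummable (fun n => f n + g n).
Proof.
  intros Hf Hg. apply (ex_series_dom _ _) with (2 := ex_series_plus (V := R_NormedModule) _ _ Hf Hg).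
  intros n. rewrite Rabs_pos_eq by apply zpair_Rabs_ge0.
  unfold zpair, plus; simpl.
  pose proof (Rabs_triang (f (Z.of_nat n)) (g (Z.of_nat n))).
  pose proof (Rabs_triang (f (- Z.of_nat n - 1)%Z) (g (- Z.of_nat n - 1)%Z)). lra.
Qed.

Lemma zsum_plus (f g : Z -> R) : zsummable f -> zsummable g ->
  zsum (fun n => f n + g n) = zsum f + zsum g.
Proof.
  intros Hf Hg. unfold zsum. rewrite <- Series_plus by (apply zsummable_ex; assumption).
  apply Series_ext; intros n; unfold zpair; ring.
Qed.

Lemma zsummable_scal (c : R) (f : Z -> R) : zsummable f -> zsummable (fun n => c * f n).
Proof.
  intros Hf. apply ex_series_ext with (fun n => scal (Rabs c) (zpair (fun i => Rabs (f i)) n)).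
  - intros n; unfold zpair, scal; simpl; unfold mult; simpl; rewrite !Rabs_mult; ring.
  - apply (ex_series_scal (V := R_NormedModule)); exact Hf.
Qed.

Lemma zsum_scal (c : R) (f : Z -> R) : zsum (fun n => c * f n) = c * zsum f.
Proof.
  unfold zsum; rewrite <- Series_scal_l; apply Series_ext; intros n; unfold zpair; ring.
Qed.

Lemma zsummable_minus (f g : Z -> R) :
  zsummable f -> zsummable g -> zsummable (fun n => f n - g n).
Proof.
  intros Hf Hg; apply zsummable_ext with (fun n => f n + (-1) * g n); [intros; ring|].
  apply zsummable_plus; [|apply zsummable_scal]; assumption.
Qed.

Lemma zsum_minus (f g : Z -> R) : zsummable f -> zsummable g ->
  zsum (fun n => f n - g n) = zsum f - zsum g.
Proof.
  intros Hf Hg; rewrite (zsum_ext _ (fun n => f n + (-1) * g n)) by (intros; ring).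
  rewrite zsum_plus, zsum_scal; [ring|assumption|apply zsummable_scal; assumption].
Qed.

Lemma zsum_0 (f : Z -> R) : (forall n, f n = 0) -> zsum f = 0.
Proof.
  intros H; rewrite (zsum_ext _ (fun n => 0 * f n)) by (intros n; rewrite H; ring).
  rewrite zsum_scal; ring.
Qed.

Lemma zsum_le (f g : Z -> R) : zsummable f -> zsummable g ->
  (forall n, f n <= g n) -> zsum f <= zsum g.
Proof.
  intros Hf Hg H. apply (is_series_le (zpair f) (zpair g));
    [|apply Series_correct, zsummable_ex, Hf|apply Series_correct, zsummable_ex, Hg].
  intros n; unfold zpair; apply Rplus_le_compat; apply H.
Qed.

Lemma Rabs_zsum (f : Z -> R) : zsummable f -> Rabs (zsum f) <= zsum (fun n => Rabs (f n)).
Proof.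
  intros Hf; apply Rabs_le; split.
  - assert (H := zsum_le (fun n => (-1) * Rabs (f n)) f
      (zsummable_scal _ _ (zsummable_abs _ Hf)) Hf).
    rewrite zsum_scal in H.
    assert (-1 * zsum (fun n => Rabs (f n)) <= zsum f); [|lra].
    apply H; intros n; pose proof (Rle_abs (- f n)) as E; rewrite Rabs_Ropp in E; lra.
  - apply zsum_le; [assumption|apply zsummable_abs; assumption|intros; apply Rle_abs].
Qed.

Lemma zsummable_reflect (f : Z -> R) : zsummable f -> zsummable (fun n => f (- 1 - n)%Z).
Proof.
  apply ex_series_ext; intros n; unfold zpair.
  rewrite Rplus_comm; f_equal; f_equal; f_equal; lia.
Qed.

Lemma zsum_reflect (f : Z -> R) : zsum (fun n => f (- 1 - n)%Z) = zsum f.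
Proof.
  apply Series_ext; intros n; unfold zpair.
  rewrite Rplus_comm; f_equal; f_equal; lia.
Qed.

Lemma zsummable_succ (f : Z -> R) : zsummable f -> zsummable (fun n => f (n + 1)%Z).
Proof.
  intros H; apply zsummable_halves in H as [H1 H2]; apply zsummable_halves; split.
  - apply ex_series_incr_1 in H1; apply ex_series_ext with (2 := H1); intros n; do 2 f_equal; lia.
  - apply (ex_series_incr_1 (fun n => Rabs (f (- Z.of_nat n - 1 + 1)%Z))).
    apply ex_series_ext with (2 := H2); intros n; do 2 f_equal; lia.
Qed.

Lemma zsum_succ (f : Z -> R) : zsummable f -> zsum (fun n => f (n + 1)%Z) = zsum f.
Proof.
  intros H; rewrite (zsum_halves _ (zsummable_succ _ H)), (zsum_halves _ H).
  assert (H' := zsummable_succ _ H).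
  apply zsummable_halves in H as [H1 H2]; apply zsummable_halves in H' as [H3 H4].
  rewrite (Series_incr_1 (fun n => f (Z.of_nat n))) by (apply ex_series_Rabs; exact H1).
  rewrite (Series_incr_1 (fun n => f (- Z.of_nat n - 1 + 1)%Z)) by (apply ex_series_Rabs; exact H4).
  rewrite (Series_ext (fun n => f (Z.of_nat (S n))) (fun n => f (Z.of_nat n + 1)%Z))
    by (intros n; f_equal; lia).
  rewrite (Series_ext (fun n => f (- Z.of_nat (S n) - 1 + 1)%Z) (fun n => f (- Z.of_nat n - 1)%Z))
    by (intros n; f_equal; lia).
  simpl. ring.
Qed.

Lemma zsum_shift_nat (f : Z -> R) (k : nat) : zsummable f ->
  zsummable (fun n => f (n + Z.of_nat k)%Z) /\ zsum (fun n => f (n + Z.of_nat k)%Z) = zsum f.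
Proof.
  intros H; induction k as [|k [IH1 IH2]].
  - split; [apply zsummable_ext with (2 := H)|apply zsum_ext]; intros n; f_equal; lia.
  - split.
    + apply zsummable_ext with (2 := zsummable_succ _ IH1); intros n; f_equal; lia.
    + rewrite <- IH2, <- (zsum_succ _ IH1); apply zsum_ext; intros n; f_equal; lia.
Qed.

(** A negative shift is a positive one conjugated by the reflection [n -> -1 - n]. *)
Lemma zsummable_zsum_shift (f : Z -> R) (k : Z) : zsummable f ->
  zsummable (fun n => f (n + k)%Z) /\ zsum (fun n => f (n + k)%Z) = zsum f.
Proof.
  intros H; destruct (Z_le_gt_dec 0 k) as [Hk|Hk].
  - rewrite <- (Z2Nat.id k) by exact Hk; apply zsum_shift_nat, H.
  - destruct (zsum_shift_nat _ (Z.to_nat (- k)) (zsummable_reflect f H)) as [H1 H2].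
    split.
    + apply zsummable_ext with (2 := zsummable_reflect _ H1); intros n; f_equal; lia.
    + rewrite <- (zsum_reflect f), <- H2, <- zsum_reflect; apply zsum_ext; intros n; f_equal; lia.
Qed.

Lemma zsummable_shift (f : Z -> R) (k : Z) : zsummable f -> zsummable (fun n => f (n + k)%Z).
Proof. apply zsummable_zsum_shift. Qed.

Lemma zsum_shift (f : Z -> R) (k : Z) : zsummable f -> zsum (fun n => f (n + k)%Z) = zsum f.
Proof. apply zsummable_zsum_shift. Qed.

Lemma zsum_opp (f : Z -> R) (k : Z) : zsummable f -> zsum (fun n => f (k - n)%Z) = zsum f.
Proof.
  intros H; rewrite <- (zsum_shift f (k + 1) H), <- zsum_reflect.
  apply zsum_ext; intros n; f_equal; lia.
Qed.

(** Transported to a double series over [nat]: an index pair [(i, j)] collects the four lattice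
    points obtained by reflecting either coordinate. [b] is the sum of the four values, [c] the sum
    of their absolute values. *)
Lemma zsum_fubini (a : Z -> Z -> R) :
  (forall n, zsummable (a n)) ->
  zsummable (fun n => zsum (fun m => Rabs (a n m))) ->
  (forall m, zsummable (fun n => a n m)) /\
  zsummable (fun m => zsum (fun n => a n m)) /\
  zsum (fun n => zsum (a n)) = zsum (fun m => zsum (fun n => a n m)).
Proof.
  intros H1 H2.
  set (z1 := Z.of_nat). set (z2 := fun n : nat => (- Z.of_nat n - 1)%Z).
  set (b := fun i j : nat => a (z1 i) (z1 j) + a (z1 i) (z2 j) + (a (z2 i) (z1 j) + a (z2 i) (z2 j))).
  set (c := fun i j : nat => Rabs (a (z1 i) (z1 j)) + Rabs (a (z1 i) (z2 j))
     + (Rabs (a (z2 i) (z1 j)) + Rabs (a (z2 i) (z2 j)))).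
  assert (Hc0 : forall i j, 0 <= c i j).
  { intros i j; unfold c. pose proof (Rabs_pos (a (z1 i) (z1 j))). pose proof (Rabs_pos (a (z1 i) (z2 j))).
    pose proof (Rabs_pos (a (z2 i) (z1 j))). pose proof (Rabs_pos (a (z2 i) (z2 j))). lra. }
  assert (Hbc : forall i j, Rabs (b i j) <= c i j).
  { intros i j; unfold b, c. do 2 (eapply Rle_trans; [apply Rabs_triang|]; apply Rplus_le_compat);
    try apply Rabs_triang; apply Rle_refl. }
  assert (Hrow : forall i, is_series (c i)
    (zsum (fun m => Rabs (a (z1 i) m)) + zsum (fun m => Rabs (a (z2 i) m)))).
  { intros i. apply (is_series_plus (V := R_NormedModule)
     (zpair (fun m => Rabs (a (z1 i) m))) (zpair (fun m => Rabs (a (z2 i) m)))); apply Series_correct; apply H1. }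
  assert (Htot : ex_series (fun i => zsum (fun m => Rabs (a (z1 i) m)) + zsum (fun m => Rabs (a (z2 i) m)))).
  { apply (zsummable_ex _ H2). }
  destruct (is_series_tonelli c _ _ Hc0 Hrow (Series_correct _ Htot)) as [Hcol Hcs].
  assert (Hcolb : forall j, ex_series (fun i => Rabs (b i j))).
  { intros j; apply ex_series_dom with (2 := Hcol j); intros; rewrite Rabs_Rabsolu; apply Hbc. }
  assert (Hcz : forall m, zsummable (fun n => a n m)).
  { intros m. destruct (Z_le_gt_dec 0 m) as [Hm|Hm].
    - apply ex_series_dom with (2 := Hcol (Z.to_nat m)). intros i.
      rewrite Rabs_pos_eq by apply (zpair_Rabs_ge0 (fun n => a n m)). unfold zpair, c. fold z1 z2.
      replace (z1 (Z.to_nat m)) with m by (unfold z1; lia).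
      pose proof (Rabs_pos (a (z1 i) (z2 (Z.to_nat m)))). pose proof (Rabs_pos (a (z2 i) (z2 (Z.to_nat m)))).
      unfold z1, z2 in *; lra.
    - apply ex_series_dom with (2 := Hcol (Z.to_nat (- m - 1))). intros i.
      rewrite Rabs_pos_eq by apply (zpair_Rabs_ge0 (fun n => a n m)). unfold zpair, c.
      replace (z2 (Z.to_nat (- m - 1))) with m by (unfold z2; lia).
      pose proof (Rabs_pos (a (z1 i) (z1 (Z.to_nat (- m - 1))))). pose proof (Rabs_pos (a (z2 i) (z1 (Z.to_nat (-m - 1))))).
      unfold z1, z2 in *; lra. }
  split; [exact Hcz|]. split.
  - apply ex_series_dom with (2 := ex_intro _ _ Hcs). intros j.
    rewrite Rabs_pos_eq by apply (zpair_Rabs_ge0 (fun m => zsum (fun n => a n m))). unfold zpair.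
    eapply Rle_trans; [apply Rplus_le_compat; apply Rabs_zsum; apply Hcz|].
    unfold zsum; rewrite <- Series_plus by (apply Hcz).
    right; apply Series_ext; intros i; unfold zpair, c, z1, z2; ring.
  - transitivity (Series (fun i => Series (b i))).
    + apply Series_ext; intros i. unfold zpair at 1, zsum.
      rewrite <- Series_plus by (apply zsummable_ex, H1). apply Series_ext; intros j.
      unfold zpair, b, z1, z2; ring.
    + assert (Hb : forall i, ex_series (fun j => Rabs (b i j))).
      { intros i; apply ex_series_dom with (2 := ex_intro _ _ (Hrow i)); intros; rewrite Rabs_Rabsolu; apply Hbc. }
      destruct (Series_fubini b Hb) as [_ [_ E]].
      { apply ex_series_dom with (2 := Htot); intros i.
        rewrite Rabs_pos_eq; [|apply (is_series_le (fun _ => 0) (fun m => Rabs (b i m)));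
           [intros; apply Rabs_pos| |apply Series_correct, Hb];
           apply (filterlim_ext (fun _ => 0));
           [intros n; rewrite sum_n_const; ring|apply filterlim_const]].
        apply (is_series_le _ _ _ _ (Hbc i)); [apply Series_correct, Hb|apply Hrow]. }
      rewrite E. apply Series_ext; intros j. unfold zpair, zsum.
      rewrite <- Series_plus by (apply zsummable_ex, Hcz). apply Series_ext; intros i.
      unfold zpair, b, z1, z2; ring.
Qed.

(** Interchange of summation after the translation [m -> m - n]. This is what turns products of
    trigonometric or exponential series into convolutions of their coefficients. *)
Lemma zsum_cauchy (f g : Z -> R) : zsummable f -> zsummable g ->
  (forall m, zsummable (fun n => f n * g (m - n)%Z)) /\
  zsummable (fun m => zsum (fun n => f n * g (m - n)%Z)) /\
  zsum f * zsum g = zsum (fun m => zsum (fun n => f n * g (m - n)%Z)).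
Proof.
  intros Hf Hg.
  assert (Hs : forall n, zsummable (fun m => g (m - n)%Z)).
  { intros n; apply (zsummable_shift g (- n)), Hg. }
  destruct (zsum_fubini (fun n m => f n * g (m - n)%Z)) as [H1 [H2 H3]].
  - intros n; apply zsummable_scal, Hs.
  - apply zsummable_ext with (fun n => zsum (fun m => Rabs (g m)) * Rabs (f n)).
    + intros n. rewrite (zsum_ext (fun m => Rabs (f n * g (m - n)%Z)) (fun m => Rabs (f n) * Rabs (g (m + - n)%Z))).
      * rewrite zsum_scal, (zsum_shift (fun m => Rabs (g m)) (- n)) by (apply zsummable_abs, Hg). ring.
      * intros m; apply Rabs_mult.
    + apply zsummable_scal, zsummable_abs, Hf.
  - split; [exact H1|]. split; [exact H2|]. rewrite <- H3.
    rewrite (zsum_ext (fun n => zsum _) (fun n => zsum g * f n)).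
    + rewrite zsum_scal; ring.
    + intros n; rewrite zsum_scal, Rmult_comm; f_equal; exact (zsum_shift g (- n) Hg).
Qed.

(** * Convolutions of hyperbolic secants *)

Lemma cosh_pos (x : R) : 0 < cosh x.
Proof. unfold cosh; pose proof (exp_pos x); pose proof (exp_pos (- x)); lra. Qed.

Lemma cosh_opp (x : R) : cosh (- x) = cosh x.
Proof. unfold cosh; rewrite Ropp_involutive; field. Qed.

Lemma sinh_opp (x : R) : sinh (- x) = - sinh x.
Proof. unfold sinh; rewrite Ropp_involutive; field. Qed.

Lemma tanh_opp (x : R) : tanh (- x) = - tanh x.
Proof. unfold tanh; rewrite sinh_opp, cosh_opp; field; apply Rgt_not_eq, cosh_pos. Qed.

Lemma cosh_plus (x y : R) : cosh (x + y) = cosh x * cosh y + sinh x * sinh y.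
Proof. unfold cosh, sinh; rewrite Ropp_plus_distr, !exp_plus; field. Qed.

Lemma sinh_plus (x y : R) : sinh (x + y) = sinh x * cosh y + cosh x * sinh y.
Proof. unfold cosh, sinh; rewrite Ropp_plus_distr, !exp_plus; field. Qed.

Lemma sinh_pos (x : R) : 0 < x -> 0 < sinh x.
Proof. intros H; rewrite <- sinh_0; apply sinh_lt, H. Qed.

Lemma sinh_neq_0 (x : R) : x <> 0 -> sinh x <> 0.
Proof.
  intros H; destruct (Rlt_or_le 0 x) as [Hx|Hx].
  - apply Rgt_not_eq, sinh_pos, Hx.
  - assert (0 < sinh (- x)) by (apply sinh_pos; lra). rewrite sinh_opp in H0; lra.
Qed.

Lemma inv_cosh_le (x : R) : / cosh x <= 2 * exp (- Rabs x).
Proof.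
  rewrite exp_Ropp. apply Rle_trans with (/ (exp (Rabs x) / 2)).
  - apply Rinv_le_contravar; [pose proof (exp_pos (Rabs x)); lra|].
    unfold cosh, Rabs; destruct (Rcase_abs x);
    pose proof (exp_pos x); pose proof (exp_pos (- x)); lra.
  - right; field. apply Rgt_not_eq, exp_pos.
Qed.

(** From [t <= exp t] at [t = e x / (p + 1)], raised to the power [p]. Dividing by [p + 1] instead
    of [p] keeps the case [p = 0] meaningful. *)
Lemma pow_le_exp (p : nat) (e x : R) : 0 < e -> 0 <= x ->
  x ^ p <= ((INR p + 1) / e) ^ p * exp (e * x).
Proof.
  intros He Hx. assert (Hp : 0 < INR p + 1) by (pose proof (pos_INR p); lra).
  set (t := e * x / (INR p + 1)).
  assert (Ht : 0 <= t).
  { unfold t; apply Rmult_le_pos; [apply Rmult_le_pos; lra|left; apply Rinv_0_lt_compat, Hp]. }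
  assert (Hexp : t ^ p <= exp (e * x)).
  { apply Rle_trans with (exp t ^ p).
    - apply pow_incr; split; [exact Ht|]. pose proof (exp_ineq1_le t); lra.
    - assert (E : forall q, exp t ^ q = exp (INR q * t)).
      { induction q as [|q IH]; [simpl; rewrite Rmult_0_l, exp_0; reflexivity|].
        rewrite S_INR; simpl. rewrite IH, <- exp_plus; f_equal; ring. }
      rewrite E. replace (e * x) with (INR p * t + t) by (unfold t; field; lra).
      destruct Ht as [Ht|Ht]; [left; apply exp_increasing; lra|right; f_equal; lra]. }
  replace x with ((INR p + 1) / e * t) at 1 by (unfold t; field; lra).
  rewrite Rpow_mult_distr. apply Rmult_le_compat_l; [|exact Hexp].
  apply pow_le, Rlt_le, Rdiv_lt_0_compat; lra.
Qed.

Lemma ex_series_odd_pow_exp (p : nat) (d : R) : 0 < d ->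
  ex_series (fun n => (2 * INR n + 1) ^ p * exp (- d * (2 * INR n + 1))).
Proof.
  (* Half of the decay rate [d] absorbs the power; the other half leaves a geometric series of ratio
     [exp (- d)], because consecutive odd numbers differ by 2. *)
  intros Hd. set (C := ((INR p + 1) / (d / 2)) ^ p * exp (- d / 2)).
  apply ex_series_dom with (fun n => scal C (exp (- d) ^ n)).
  - intros n. assert (Hn := pos_INR n).
    rewrite Rabs_pos_eq by (apply Rmult_le_pos; [apply pow_le; lra|apply Rlt_le, exp_pos]).
    eapply Rle_trans; [apply Rmult_le_compat_r; [apply Rlt_le, exp_pos|apply (pow_le_exp p (d / 2)); lra]|].
    right. unfold scal, C; simpl; unfold mult; simpl.
    assert (E : forall t q, exp t ^ q = exp (INR q * t)).
    { intros t; induction q as [|q IH]; [simpl; rewrite Rmult_0_l, exp_0; reflexivity|].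
      rewrite S_INR; simpl. rewrite IH, <- exp_plus; f_equal; ring. }
    rewrite E, !Rmult_assoc, <- !exp_plus. do 2 f_equal; field.
  - apply (ex_series_scal (V := R_NormedModule)), ex_series_geom.
    rewrite Rabs_pos_eq by (apply Rlt_le, exp_pos). rewrite <- exp_0; apply exp_increasing; lra.
Qed.

Definition oddz (n : Z) : R := 2 * IZR n + 1.
Definition sechc (y : R) (n : Z) : R := / cosh (oddz n * (y / 2)).
Definition tanhc (y : R) (n : Z) : R := tanh (oddz n * (y / 2)).

Lemma oddz_reflect (n : Z) : oddz (- 1 - n) = - oddz n.
Proof. unfold oddz; rewrite minus_IZR; simpl; lra. Qed.

Lemma sechc_pos (y : R) (n : Z) : 0 < sechc y n.
Proof. apply Rinv_0_lt_compat, cosh_pos. Qed.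

Lemma sechc_reflect (y : R) (n : Z) : sechc y (- 1 - n) = sechc y n.
Proof.
  unfold sechc; rewrite oddz_reflect, <- (cosh_opp (oddz n * (y / 2))); do 2 f_equal; ring.
Qed.

Lemma tanhc_reflect (y : R) (n : Z) : tanhc y (- 1 - n) = - tanhc y n.
Proof. unfold tanhc; rewrite oddz_reflect, <- tanh_opp; f_equal; ring. Qed.

(** The coefficient decays like [exp (- |j| y / 2)], so any exponential growth of rate below [y / 2]
    is tolerated. This fixes the interval on which [Hs] below lives. *)
Lemma zsummable_sechc (y r : R) (p : nat) : 0 < y -> r < y / 2 ->
  zsummable (fun n => sechc y n * (Rabs (oddz n) ^ p * exp (r * Rabs (oddz n)))).
Proof.
  intros Hy Hr.
  apply zsummable_le with (fun n => 2 * (Rabs (oddz n) ^ p * exp (- (y / 2 - r) * Rabs (oddz n)))).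
  - intros n. assert (H0 : 0 <= Rabs (oddz n) ^ p) by (apply pow_le, Rabs_pos).
    rewrite Rabs_pos_eq.
    2:{ apply Rmult_le_pos; [apply Rlt_le, sechc_pos|]. apply Rmult_le_pos; [exact H0|apply Rlt_le, exp_pos]. }
    apply Rle_trans with (2 * exp (- Rabs (oddz n * (y / 2))) * (Rabs (oddz n) ^ p * exp (r * Rabs (oddz n)))).
    + apply Rmult_le_compat_r; [apply Rmult_le_pos; [exact H0|apply Rlt_le, exp_pos]|apply inv_cosh_le].
    + right. rewrite Rabs_mult, (Rabs_pos_eq (y / 2)) by lra.
      replace (- (y / 2 - r) * Rabs (oddz n)) with (- (Rabs (oddz n) * (y / 2)) + r * Rabs (oddz n)) by ring.
      rewrite exp_plus; ring.
  - apply zsummable_scal.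
    assert (E : forall n, Rabs (oddz (Z.of_nat n)) = 2 * INR n + 1).
    { intros n; unfold oddz; rewrite <- INR_IZR_INZ, Rabs_pos_eq; [reflexivity|pose proof (pos_INR n); lra]. }
    assert (E' : forall n, Rabs (oddz (- Z.of_nat n - 1)) = 2 * INR n + 1).
    { intros n; rewrite <- E, <- Rabs_Ropp, <- oddz_reflect; do 2 f_equal; lia. }
    apply zsummable_halves; split;
    (apply ex_series_ext with (2 := ex_series_odd_pow_exp p (y / 2 - r) ltac:(lra)); intros n;
     rewrite ?E, ?E', Rabs_pos_eq; [reflexivity|pose proof (pos_INR n);
     apply Rmult_le_pos; [apply pow_le; lra|apply Rlt_le, exp_pos]]).
Qed.

Lemma zsummable_sechc_bounded (y r : R) (p : nat) (E : R -> R) : 0 < y -> r < y / 2 ->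
  (forall u, Rabs (E u) <= exp (r * Rabs u)) ->
  zsummable (fun n => sechc y n * (oddz n ^ p * E (oddz n))).
Proof.
  intros Hy Hr HE. apply zsummable_le with (2 := zsummable_sechc y r p Hy Hr).
  intros n. rewrite !Rabs_mult, <- RPow_abs, (Rabs_pos_eq (sechc y n)) by (apply Rlt_le, sechc_pos).
  apply Rmult_le_compat_l; [apply Rlt_le, sechc_pos|].
  apply Rmult_le_compat_l; [apply pow_le, Rabs_pos|apply HE].
Qed.

Lemma zsummable_sechc_1 (y : R) : 0 < y -> zsummable (sechc y).
Proof.
  intros Hy. apply zsummable_ext with (2 := zsummable_sechc y 0 0 Hy ltac:(lra)).
  intros n; simpl; rewrite Rmult_0_l, exp_0; ring.
Qed.

Lemma tanh_minus (a b : R) : tanh a - tanh b = sinh (a - b) / (cosh a * cosh b).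
Proof.
  unfold Rminus; rewrite sinh_plus, sinh_opp, cosh_opp; unfold tanh.
  field; split; apply Rgt_not_eq, cosh_pos.
Qed.

Lemma oddz_pred (n : Z) : oddz (n - 1) = oddz n - 2.
Proof. unfold oddz; rewrite minus_IZR; lra. Qed.

Lemma tanhc_pred_le (y : R) (n : Z) : 0 < y -> tanhc y (n - 1) <= tanhc y n.
Proof.
  intros Hy. assert (H : 0 <= tanhc y n - tanhc y (n - 1)); [|lra].
  unfold tanhc; rewrite tanh_minus, oddz_pred. apply Rlt_le, Rdiv_lt_0_compat.
  - apply sinh_pos; lra.
  - apply Rmult_lt_0_compat; apply cosh_pos.
Qed.

Lemma tanhc_lim (y : R) : 0 < y -> is_lim_seq (fun n => tanhc y (Z.of_nat n)) 1.
Proof.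
  intros Hy.
  assert (HG : is_lim_seq (fun n => 1 - 2 * exp (- (2 * y)) ^ n) 1).
  { evar_last. apply (is_lim_seq_minus' (fun _ => 1) (fun n => 2 * exp (- (2 * y)) ^ n) 1 (2 * 0)).
    - apply is_lim_seq_const.
    - apply (is_lim_seq_scal_l (fun n => exp (- (2 * y)) ^ n) 2 0), is_lim_seq_geom.
      rewrite Rabs_pos_eq by (apply Rlt_le, exp_pos). rewrite <- exp_0; apply exp_increasing; lra.
    - f_equal; lra. }
  apply is_lim_seq_le_le_loc with (2 := HG) (3 := is_lim_seq_const 1).
  exists 0%nat; intros n _. set (x := oddz (Z.of_nat n) * (y / 2)).
  assert (Hn := pos_INR n).
  assert (Hx : x = INR n * y + y / 2) by (unfold x, oddz; rewrite <- INR_IZR_INZ; field).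
  unfold tanhc; fold x.
  assert (E : tanh x = 1 - 2 * exp (- x) / (exp x + exp (- x))).
  { unfold tanh, sinh, cosh; field; pose proof (exp_pos x); pose proof (exp_pos (- x)); lra. }
  assert (E1 : exp (- (2 * y)) ^ n = exp (- (2 * (INR n * y)))).
  { clear; induction n as [|n IH]; [simpl; rewrite Rmult_0_l, Rmult_0_r, Ropp_0, exp_0; reflexivity|].
    rewrite S_INR; simpl; rewrite IH, <- exp_plus; f_equal; ring. }
  assert (P1 := exp_pos x). assert (P2 := exp_pos (- x)).
  split.
  - rewrite E, E1.
    assert (exp (- x) / (exp x + exp (- x)) <= exp (- (2 * (INR n * y)))); [|lra].
    apply Rle_trans with (exp (- x) / exp x).
    + apply Rmult_le_compat_l; [lra|]. apply Rinv_le_contravar; lra.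
    + unfold Rdiv; rewrite <- exp_Ropp, <- exp_plus. left; apply exp_increasing; lra.
  - rewrite E. assert (0 <= exp (- x) / (exp x + exp (- x))); [|lra].
    apply Rlt_le, Rdiv_lt_0_compat; lra.
Qed.

(** By oddness of [tanhc], the folded partial sum up to [n] telescopes to
    [tanhc y n + tanhc y (n + 1)], which tends to [1 + 1]. The terms are nonnegative, so convergence
    is absolute. *)
Lemma tanhc_step (y : R) : 0 < y ->
  zsummable (fun n => tanhc y n - tanhc y (n - 1)) /\
  zsum (fun n => tanhc y n - tanhc y (n - 1)) = 2.
Proof.
  intros Hy.
  assert (HS : is_series (zpair (fun n => tanhc y n - tanhc y (n - 1))) 2).
  { change (is_lim_seq (sum_n (zpair (fun n => tanhc y n - tanhc y (n - 1)))) 2).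
    apply (is_lim_seq_ext (fun n => tanhc y (Z.of_nat n) + tanhc y (Z.of_nat (S n)))).
    - assert (E : forall n, zpair (fun n => tanhc y n - tanhc y (n - 1)) n =
        tanhc y (Z.of_nat n) - tanhc y (Z.of_nat n - 1) + (tanhc y (Z.of_nat (S n)) - tanhc y (Z.of_nat n))).
      { intros n; unfold zpair. f_equal.
        replace (- Z.of_nat n - 1)%Z with (- 1 - Z.of_nat n)%Z by lia.
        replace (- 1 - Z.of_nat n - 1)%Z with (- 1 - Z.of_nat (S n))%Z by lia.
        rewrite !tanhc_reflect; ring. }
      intros n; induction n as [|n IH].
      + rewrite sum_O, E. change (Z.of_nat 0 - 1)%Z with (-1 - Z.of_nat 0)%Z. rewrite tanhc_reflect; ring.
      + rewrite sum_Sn, E, <- IH. unfold plus; cbn -[Z.of_nat Z.sub].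
        replace (Z.of_nat (S n) - 1)%Z with (Z.of_nat n) by lia. lra.
    - change (is_lim_seq (fun n => tanhc y (Z.of_nat n) + tanhc y (Z.of_nat (S n))) 2).
      replace 2 with (1 + 1) by ring. apply is_lim_seq_plus'; [|apply (is_lim_seq_incr_1 (fun n => tanhc y (Z.of_nat n)))];
      apply tanhc_lim, Hy. }
  split; [|apply is_series_unique, HS].
  exists 2. apply is_series_ext with (2 := HS). intros n; unfold zpair.
  rewrite !Rabs_pos_eq; [reflexivity| |]; match goal with |- 0 <= tanhc _ ?k - _ =>
    pose proof (tanhc_pred_le y k Hy); lra end.
Qed.

(** Used to evaluate families of two-sided sums: only the change under a unit step of the parameter
    has to be computed. *)
Lemma Z_const_of_step (f : Z -> R) : (forall n, f n = f (n - 1)%Z) -> forall n, f n = f 0%Z.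
Proof.
  intros H n.
  assert (Hp : forall k, f (Z.of_nat k) = f 0%Z).
  { induction k as [|k IH]; [reflexivity|]. rewrite H, <- IH; f_equal; lia. }
  assert (Hm : forall k, f (- Z.of_nat k)%Z = f 0%Z).
  { induction k as [|k IH]; [reflexivity|]. rewrite <- IH, (H (- Z.of_nat k)%Z); f_equal; lia. }
  destruct (Z_le_gt_dec 0 n); [rewrite <- (Z2Nat.id n) by assumption; apply Hp|].
  replace n with (- Z.of_nat (Z.to_nat (- n)))%Z by lia. apply Hm.
Qed.

(** The convolution square at the even frequency [2 M]: the frequencies of [n] and [M - 1 - n] add
    up to [2 M]. *)
Definition sech2c (y : R) (M : Z) : R := zsum (fun n => sechc y n * sechc y (M - 1 - n)).

Lemma oddz_shift (n k : Z) : oddz (n - k) = oddz n - 2 * IZR k.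
Proof. unfold oddz; rewrite minus_IZR; lra. Qed.

(** The arguments of the two [tanhc] differ by [M y], independently of [n], so [tanh a - tanh b =
    sinh (a - b) / (cosh a cosh b)] is a partial fraction decomposition with a constant factor in
    front. *)
Lemma sechc_mul (y : R) (M n : Z) : 0 < y -> M <> 0%Z ->
  sechc y n * sechc y (M - 1 - n) = / sinh (IZR M * y) * (tanhc y n - tanhc y (n - M)).
Proof.
  intros Hy HM. unfold tanhc. rewrite tanh_minus.
  replace (M - 1 - n)%Z with (-1 - (n - M))%Z by lia. rewrite sechc_reflect. unfold sechc.
  replace (oddz n * (y / 2) - oddz (n - M) * (y / 2)) with (IZR M * y) by (rewrite oddz_shift; field).
  field. repeat split; try (apply Rgt_not_eq, cosh_pos).
  apply sinh_neq_0, Rmult_integral_contrapositive; split; [apply not_0_IZR, HM|lra].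
Qed.

Lemma zsummable_sechc_mul (y : R) (m : Z) : 0 < y -> zsummable (fun n => sechc y n * sechc y (m - n)).
Proof. intros Hy; apply zsum_cauchy; apply zsummable_sechc_1, Hy. Qed.

(** A difference over distance [M] splits into unit steps, each of total 2. Summability is obtained
    by reading [sechc_mul] backwards. *)
Lemma tanhc_shift_sum (y : R) (M : Z) : 0 < y -> 
  zsummable (fun n => tanhc y n - tanhc y (n - M)) /\
  zsum (fun n => tanhc y n - tanhc y (n - M)) = 2 * IZR M.
Proof.
  intros Hy. destruct (tanhc_step y Hy) as [S1 S2].
  assert (HS : forall M, zsummable (fun n => tanhc y n - tanhc y (n - M))).
  { intros K. destruct (Z.eq_dec K 0) as [->|HK].
    - apply zsummable_ext with (fun n => 0 * sechc y n); [|apply zsummable_scal, zsummable_sechc_1, Hy].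
      intros n; rewrite Z.sub_0_r; ring.
    - apply zsummable_ext with (2 := zsummable_scal (sinh (IZR K * y)) _ (zsummable_sechc_mul y (K - 1) Hy)).
      intros n; rewrite sechc_mul by assumption. field.
      apply sinh_neq_0, Rmult_integral_contrapositive; split; [apply not_0_IZR, HK|lra]. }
  split; [apply HS|].
  set (f := fun M => zsum (fun n => tanhc y n - tanhc y (n - M)) - 2 * IZR M).
  assert (Hf : f M = f 0%Z).
  { apply Z_const_of_step; intros K; unfold f.
    assert (Hk := zsummable_shift _ (- (K - 1)) S1).
    rewrite (zsum_ext (fun n => tanhc y n - tanhc y (n - K))
      (fun n => (tanhc y n - tanhc y (n - (K - 1))) + (tanhc y (n + - (K - 1)) - tanhc y (n + - (K - 1) - 1)))).
    - rewrite zsum_plus by (apply HS || apply Hk).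
      rewrite (zsum_shift _ (- (K - 1)) S1), S2, minus_IZR; ring.
    - intros n. replace (n + - (K - 1) - 1)%Z with (n - K)%Z by lia.
      replace (n + - (K - 1))%Z with (n - (K - 1))%Z by lia. ring. }
  unfold f in Hf. rewrite (zsum_0 (fun n => tanhc y n - tanhc y (n - 0))) in Hf; [lra|].
  intros n; rewrite Z.sub_0_r; ring.
Qed.

Lemma sech2c_formula (y : R) (M : Z) : 0 < y -> M <> 0%Z ->
  sech2c y M = 2 * IZR M / sinh (IZR M * y).
Proof.
  intros Hy HM; unfold sech2c.
  rewrite (zsum_ext _ _ (fun n => sechc_mul y M n Hy HM)), zsum_scal.
  destruct (tanhc_shift_sum y M Hy) as [_ ->]. unfold Rdiv; ring.
Qed.

(* At [M = 0] the junk value of the hyperbolic cotangent is multiplied by 0. *)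
Definition theta (y : R) (n M : Z) : R :=
  2 * IZR M * (cosh (IZR M * y) / sinh (IZR M * y) + tanhc y (n - M)).

Lemma zsum_delta (c : R) : zsummable (fun M => if Z.eq_dec M 0 then c else 0) /\
  zsum (fun M => if Z.eq_dec M 0 then c else 0) = c.
Proof.
  assert (H : forall c, is_series (zpair (fun M => if Z.eq_dec M 0 then c else 0)) c).
  { intros d. apply is_series_ext with (fun n => scal d (0 ^ n)).
    - intros [|n]; unfold zpair, scal; simpl; unfold mult; simpl.
      + ring.
      + ring.
    - evar_last; [apply (is_series_scal (V := R_NormedModule)), is_series_geom; rewrite Rabs_R0; lra|].
      unfold scal; simpl; unfold mult; simpl. field. }
  split; [|apply is_series_unique, H].
  exists (Rabs c). apply is_series_ext with (2 := H (Rabs c)).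
  intros n; unfold zpair.
  repeat match goal with |- context [Z.eq_dec ?a ?b] => destruct (Z.eq_dec a b) end;
    rewrite ?Rabs_R0; reflexivity.
Qed.

Lemma zsummable_sech2c (y : R) : 0 < y -> zsummable (sech2c y).
Proof.
  intros Hy. destruct (zsum_cauchy _ _ (zsummable_sechc_1 y Hy) (zsummable_sechc_1 y Hy)) as [_ [H _]].
  apply (zsummable_shift _ (-1) H).
Qed.

Lemma sech2c_mul_sechc (y : R) (n M : Z) : 0 < y ->
  sech2c y M * sechc y (n - M) =
  sechc y n * theta y n M + (if Z.eq_dec M 0 then sech2c y 0 * sechc y n else 0).
Proof.
  intros Hy. destruct (Z.eq_dec M 0) as [->|HM].
  - rewrite Z.sub_0_r; unfold theta; simpl; ring.
  - rewrite (sech2c_formula y M Hy HM). unfold theta, sechc, tanhc, tanh.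
    replace (oddz n * (y / 2)) with (IZR M * y + oddz (n - M) * (y / 2)) by (rewrite oddz_shift; field).
    assert (HA : sinh (IZR M * y) <> 0).
    { apply sinh_neq_0, Rmult_integral_contrapositive; split; [apply not_0_IZR, HM|lra]. }
    assert (HB := Rgt_not_eq _ _ (cosh_pos (oddz (n - M) * (y / 2)))).
    assert (HC := Rgt_not_eq _ _ (cosh_pos (IZR M * y + oddz (n - M) * (y / 2)))).
    rewrite cosh_plus in *. field. repeat split; assumption.
Qed.

Lemma zsummable_theta (y : R) (n : Z) : 0 < y -> zsummable (theta y n).
Proof.
  intros Hy.
  destruct (zsum_cauchy _ _ (zsummable_sech2c y Hy) (zsummable_sechc_1 y Hy)) as [H _].
  apply zsummable_ext with (2 := zsummable_scal (/ sechc y n) _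
    (zsummable_minus _ _ (H n) (proj1 (zsum_delta (sech2c y 0 * sechc y n))))).
  intros M. cbv beta. rewrite sech2c_mul_sechc by exact Hy. pose proof (sechc_pos y n). field. lra.
Qed.

(** The summands are too intricate to sum directly, but passing from [n - 1] to [n] changes them by
    [2 M d (n - M)]. As [d] is even with sum 2, its first moment vanishes and the sum changes by
    [4 n]. The value at [n = 0] stays unevaluated and ends up in [kap]. *)
Lemma zsum_theta (y : R) (n : Z) : 0 < y ->
  zsum (theta y n) = zsum (theta y 0) + 2 * IZR n * (IZR n + 1).
Proof.
  intros Hy. destruct (tanhc_step y Hy) as [S1 S2].
  set (d := fun p => tanhc y p - tanhc y (p - 1)) in S1, S2.
  assert (Hd : forall p, d (- p)%Z = d p).
  { intros p; unfold d. replace (- p - 1)%Z with (-1 - p)%Z by lia.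
    replace (- p)%Z with (-1 - (p - 1))%Z by lia. rewrite !tanhc_reflect; ring. }
  assert (Hdiff : forall n M, theta y n M - theta y (n - 1) M = 2 * IZR M * d (n - M)%Z).
  { intros k M; unfold theta, d. replace (k - 1 - M)%Z with (k - M - 1)%Z by lia. ring. }
  (* The first moment is half the difference of the summable families [theta y 0] and
     [theta y (-1)]. *)
  assert (Sp : zsummable (fun p => IZR p * d p)).
  { apply zsummable_ext with (2 := zsummable_scal (/ 2) _
      (zsummable_minus _ _ (zsummable_theta y 0 Hy) (zsummable_theta y (0 - 1) Hy))).
    intros p; cbv beta. rewrite Hdiff, Z.sub_0_l, Hd; field. }
  assert (Ep : zsum (fun p => IZR p * d p) = 0).
  { assert (E := zsum_opp _ 0 Sp).
    rewrite (zsum_ext _ (fun p => (-1) * (IZR p * d p))), zsum_scal in E; [lra|].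
    intros p; rewrite Z.sub_0_l, Hd, opp_IZR; ring. }
  assert (Hstep : forall n, zsum (theta y n) - zsum (theta y (n - 1)) = 4 * IZR n).
  { intros k. rewrite <- zsum_minus by (apply zsummable_theta, Hy).
    rewrite (zsum_ext _ (fun M => (fun p => 2 * IZR k * d p - 2 * (IZR p * d p)) (k - M)%Z)).
    - assert (Sh := zsummable_minus _ _ (zsummable_scal (2 * IZR k) _ S1) (zsummable_scal 2 _ Sp)).
      rewrite (zsum_opp _ k Sh).
      rewrite zsum_minus, !zsum_scal, S2, Ep by (apply zsummable_scal; assumption). ring.
    - intros M; rewrite Hdiff, minus_IZR; ring. }
  set (f := fun n => zsum (theta y n) - 2 * IZR n * (IZR n + 1)).
  assert (Hf : f n = f 0%Z).
  { apply Z_const_of_step; intros k; unfold f. specialize (Hstep k).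
    rewrite minus_IZR. lra. }
  unfold f in Hf. lra.
Qed.

(** The term [- / 2] comes from [2 n (n + 1) = (2 n + 1)^2 / 2 - 1 / 2]. No closed form of this
    constant is used later: it is eliminated in favour of [al] and [bb]. *)
Definition kap (y : R) : R := sech2c y 0 + zsum (theta y 0) - / 2.

Lemma sechc_cube (y : R) (n : Z) : 0 < y ->
  zsummable (fun M => sech2c y M * sechc y (n - M)) /\
  zsum (fun M => sech2c y M * sechc y (n - M)) = sechc y n * (kap y + oddz n ^ 2 / 2).
Proof.
  intros Hy.
  destruct (zsum_cauchy _ _ (zsummable_sech2c y Hy) (zsummable_sechc_1 y Hy)) as [H _].
  split; [apply H|].
  rewrite (zsum_ext _ _ (fun M => sech2c_mul_sechc y n M Hy)).
  destruct (zsum_delta (sech2c y 0 * sechc y n)) as [D1 D2].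
  rewrite zsum_plus by (try apply zsummable_scal, zsummable_theta; assumption).
  rewrite zsum_scal, D2, zsum_theta by exact Hy. unfold kap, oddz. field.
Qed.

(** A real substitute for multiplying by a complex character: [E] and [O] act as even and odd parts.
    The addition formula produces a product of two odd sums, which disappears because the odd sum of
    [b] is zero. *)
Lemma zsum_mul_characters (a b : Z -> R) (E1 O1 E2 O2 E3 : Z -> R) :
  (forall n k, E3 (n + k)%Z = E1 n * E2 k - O1 n * O2 k) ->
  zsummable (fun n => a n * E1 n) -> zsummable (fun n => a n * O1 n) ->
  zsummable (fun n => b n * E2 n) -> zsummable (fun n => b n * O2 n) ->
  zsum (fun n => b n * O2 n) = 0 ->
  zsummable (fun m => zsum (fun n => a n * b (m - n)%Z) * E3 m) /\
  zsum (fun n => a n * E1 n) * zsum (fun n => b n * E2 n) =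
  zsum (fun m => zsum (fun n => a n * b (m - n)%Z) * E3 m).
Proof.
  intros HE S1 S2 S3 S4 Z4.
  destruct (zsum_cauchy _ _ S1 S3) as [A1 [A2 A3]].
  destruct (zsum_cauchy _ _ S2 S4) as [B1 [B2 B3]].
  rewrite Z4, Rmult_0_r in B3.
  assert (Hm : forall m, zsum (fun n => a n * b (m - n)%Z) * E3 m =
    zsum (fun n => a n * E1 n * (b (m - n)%Z * E2 (m - n)%Z)) -
    zsum (fun n => a n * O1 n * (b (m - n)%Z * O2 (m - n)%Z))).
  { intros m. rewrite <- zsum_minus by (apply A1 || apply B1).
    rewrite Rmult_comm, <- zsum_scal; apply zsum_ext; intros n.
    replace (E3 m) with (E3 (n + (m - n))%Z) by (f_equal; lia). rewrite HE; ring. }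
  split.
  - apply zsummable_ext with (2 := zsummable_minus _ _ A2 B2); intros m; symmetry; apply Hm.
  - rewrite (zsum_ext _ _ Hm), zsum_minus, <- A3, <- B3 by assumption; ring.
Qed.

(* [E, O] stand for the pair [exp (s u), 0] or [cos (t u), sin (t u)], so that the
   same convolution gives the cubic identity on both axes. *)
Lemma sech_sum_cube (y r : R) (E O : R -> R) : 0 < y -> r < y / 2 ->
  (forall u, Rabs (E u) <= exp (r * Rabs u)) -> (forall u, Rabs (O u) <= exp (r * Rabs u)) ->
  (forall u v, E (u + v) = E u * E v - O u * O v) ->
  (forall u v, O (u + v) = O u * E v + E u * O v) ->
  (forall u, O (- u) = - O u) ->
  let X := fun p => zsum (fun n => sechc y n * (oddz n ^ p * E (oddz n))) in
  X 0%nat ^ 3 = kap y * X 0%nat + X 2%nat / 2.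
Proof.
  intros Hy Hr BE BO HE HO Hodd X.
  assert (SE : zsummable (fun n => sechc y n * E (oddz n))).
  { apply zsummable_ext with (2 := zsummable_sechc_bounded y r 0 E Hy Hr BE); intros; simpl; ring. }
  assert (SO : zsummable (fun n => sechc y n * O (oddz n))).
  { apply zsummable_ext with (2 := zsummable_sechc_bounded y r 0 O Hy Hr BO); intros; simpl; ring. }
  assert (ZO : zsum (fun n => sechc y n * O (oddz n)) = 0).
  { assert (Z := zsum_reflect (fun n => sechc y n * O (oddz n))).
    rewrite (zsum_ext _ (fun n => (-1) * (sechc y n * O (oddz n)))), zsum_scal in Z; [lra|].
    intros n; rewrite sechc_reflect, oddz_reflect, Hodd; ring. }
  assert (X0 : X 0%nat = zsum (fun n => sechc y n * E (oddz n))).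
  { apply zsum_ext; intros; simpl; ring. }
  assert (Hodd2 : forall n k, oddz n + oddz k = 2 * IZR (n + k + 1)).
  { intros n k; unfold oddz; rewrite !plus_IZR; ring. }
  destruct (zsum_mul_characters (sechc y) (sechc y) (fun n => E (oddz n)) (fun n => O (oddz n))
    (fun n => E (oddz n)) (fun n => O (oddz n)) (fun m => E (2 * IZR (m + 1)))) as [P1 P2]; try assumption.
  { intros n k; rewrite <- Hodd2; apply HE. }
  (* Only the summability of this product is kept: it is the odd-part hypothesis on [sech2c] in the
     product by the third factor. *)
  destruct (zsum_mul_characters (sechc y) (sechc y) (fun n => O (oddz n)) (fun n => - E (oddz n))
    (fun n => E (oddz n)) (fun n => O (oddz n)) (fun m => O (2 * IZR (m + 1)))) as [Q1 _]; try assumption.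
  { intros n k; rewrite <- Hodd2, HO; ring. }
  { apply zsummable_ext with (2 := zsummable_scal (-1) _ SE); intros; ring. }
  (* The convolution at index [m] carries frequency [2 (m + 1)], hence the reindexing
     [M = m + 1]. *)
  assert (shift : forall F : R -> R,
    zsummable (fun m => zsum (fun n => sechc y n * sechc y (m - n)) * F (2 * IZR (m + 1))) ->
    zsummable (fun M => sech2c y M * F (2 * IZR M)) /\
    zsum (fun m => zsum (fun n => sechc y n * sechc y (m - n)) * F (2 * IZR (m + 1))) =
    zsum (fun M => sech2c y M * F (2 * IZR M))).
  { intros F HF. split.
    - apply zsummable_ext with (2 := zsummable_shift _ (-1) HF).
      intros M; unfold sech2c. replace (M + -1 + 1)%Z with M by lia. reflexivity.
    - rewrite <- (zsum_shift _ (-1) HF). apply zsum_ext; intros M; unfold sech2c.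
      replace (M + -1 + 1)%Z with M by lia. reflexivity. }
  destruct (shift E P1) as [P3 P4]. destruct (shift O Q1) as [Q3 _].
  rewrite P4 in P2.
  destruct (zsum_mul_characters (sech2c y) (sechc y) (fun n => E (2 * IZR n)) (fun n => O (2 * IZR n))
    (fun n => E (oddz n)) (fun n => O (oddz n)) (fun m => E (oddz m))) as [R1 R2]; try assumption.
  { intros n k. replace (oddz (n + k)) with (2 * IZR n + oddz k) by (unfold oddz; rewrite plus_IZR; ring). apply HE. }
  replace (X 0%nat ^ 3) with (X 0%nat * X 0%nat * X 0%nat) by ring.
  rewrite X0, P2, R2.
  rewrite (zsum_ext _ (fun m => kap y * (sechc y m * E (oddz m)) + / 2 * (sechc y m * (oddz m ^ 2 * E (oddz m))))).
  - rewrite zsum_plus, !zsum_scal; [unfold X; field|apply zsummable_scal, SE|].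
    apply zsummable_scal, (zsummable_sechc_bounded y r); assumption.
  - intros m. destruct (sechc_cube y m Hy) as [_ ->]. field.
Qed.

(** * The differential equations of the two series *)

Lemma taylor1_le (f g h : R -> R) (x d M : R) :
  (forall t, Rabs (t - x) <= Rabs d -> is_derive f t (g t)) ->
  (forall t, Rabs (t - x) <= Rabs d -> is_derive g t (h t)) ->
  (forall t, Rabs (t - x) <= Rabs d -> Rabs (h t) <= M) ->
  Rabs (f (x + d) - f x - d * g x) <= M * d ^ 2.
Proof.
  intros Hf Hg Hh.
  assert (Hin : forall u t, Rabs (u - x) <= Rabs d -> Rmin x u <= t <= Rmax x u -> Rabs (t - x) <= Rabs (u - x)).
  { intros u t _ Ht. unfold Rmin, Rmax, Rabs in *.
    repeat destruct Rle_dec; repeat destruct Rcase_abs; lra. }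
  assert (cont : forall (F F' : R -> R) t, is_derive F t (F' t) -> continuity_pt F t).
  { intros F F' t HF. apply continuity_pt_filterlim, (ex_derive_continuous (V := R_NormedModule)). eexists; exact HF. }
  assert (Hd : Rabs (x + d - x) <= Rabs d) by (replace (x + d - x) with d by ring; lra).
  destruct (MVT_gen f x (x + d) g) as [c [Hc Ec]].
  { intros t Ht; apply Hf. eapply Rle_trans; [apply (Hin (x + d)); [exact Hd|lra]|exact Hd]. }
  { intros t Ht; apply cont with g, Hf. eapply Rle_trans; [apply (Hin (x + d)); [exact Hd|lra]|exact Hd]. }
  assert (Hcx : Rabs (c - x) <= Rabs d) by (eapply Rle_trans; [apply (Hin (x + d)); [exact Hd|lra]|exact Hd]).
  destruct (MVT_gen g x c h) as [e [He Ee]].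
  { intros t Ht; apply Hg. eapply Rle_trans; [apply (Hin c); [exact Hcx|lra]|exact Hcx]. }
  { intros t Ht; apply cont with h, Hg. eapply Rle_trans; [apply (Hin c); [exact Hcx|lra]|exact Hcx]. }
  assert (Hex : Rabs (e - x) <= Rabs d) by (eapply Rle_trans; [apply (Hin c); [exact Hcx|lra]|exact Hcx]).
  replace (f (x + d) - f x - d * g x) with (h e * ((c - x) * d)).
  2:{ rewrite Ec. replace (g c) with (g x + h e * (c - x)) by lra. ring. }
  rewrite <- (pow2_abs d), !Rabs_mult.
  apply Rmult_le_compat; [apply Rabs_pos|apply Rmult_le_pos; apply Rabs_pos|apply Hh, Hex|].
  replace (Rabs d ^ 2) with (Rabs d * Rabs d) by ring.
  apply Rmult_le_compat_r; [apply Rabs_pos|exact Hcx].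
Qed.

Lemma zsum_ge0 (f : Z -> R) : zsummable f -> (forall n, 0 <= f n) -> 0 <= zsum f.
Proof.
  intros Hf H. rewrite <- (zsum_0 (fun n => 0 * f n)) by (intros; ring).
  apply zsum_le; [apply zsummable_scal, Hf|exact Hf|intros n; specialize (H n); lra].
Qed.

(** A summable bound on the second derivatives makes the first-order remainder of the whole sum at
    most [d ^ 2] times a constant, by [taylor1_le] applied termwise. *)
Lemma is_derive_zsum (f g h : Z -> R -> R) (M : Z -> R) (x r : R) : 0 < r ->
  (forall n t, Rabs (t - x) <= r -> is_derive (f n) t (g n t)) ->
  (forall n t, Rabs (t - x) <= r -> is_derive (g n) t (h n t)) ->
  (forall n t, Rabs (t - x) <= r -> Rabs (h n t) <= M n) ->
  zsummable M ->
  (forall t, Rabs (t - x) <= r -> zsummable (fun n => f n t)) ->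
  zsummable (fun n => g n x) ->
  is_derive (fun t => zsum (fun n => f n t)) x (zsum (fun n => g n x)).
Proof.
  intros Hr Hf Hg Hh HM Sf Sg. set (S := zsum M).
  assert (HS : 0 <= S).
  { apply zsum_ge0; [exact HM|]. intros n; eapply Rle_trans; [apply Rabs_pos|apply (Hh n x)].
    rewrite Rminus_diag, Rabs_R0; lra. }
  assert (Hx : Rabs (x - x) <= r) by (rewrite Rminus_diag, Rabs_R0; lra).
  apply is_derive_Reals. intros eps Heps.
  assert (Hdl : 0 < Rmin r (eps / (S + 1))).
  { apply Rmin_pos; [exact Hr|apply Rdiv_lt_0_compat; lra]. }
  exists (mkposreal _ Hdl). intros d Hd0 Hd. simpl in Hd.
  assert (Hd1 : Rabs d <= r) by (pose proof (Rmin_l r (eps / (S + 1))); lra).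
  assert (Hd2 : Rabs d < eps / (S + 1)) by (pose proof (Rmin_r r (eps / (S + 1))); lra).
  assert (Hxd : Rabs (x + d - x) <= r) by (replace (x + d - x) with d by ring; exact Hd1).
  assert (Hmain : Rabs (zsum (fun n => f n (x + d)) - zsum (fun n => f n x) - d * zsum (fun n => g n x)) <= S * d ^ 2).
  { rewrite <- zsum_scal, <- !zsum_minus; try apply zsummable_minus; try apply zsummable_scal; auto.
    assert (Sd : zsummable (fun n => f n (x + d) - f n x - d * g n x)).
    { apply zsummable_minus; [apply zsummable_minus; auto|apply zsummable_scal, Sg]. }
    eapply Rle_trans; [apply Rabs_zsum, Sd|].
    unfold S; rewrite Rmult_comm, <- zsum_scal. apply zsum_le; [apply zsummable_abs, Sd|apply zsummable_scal, HM|].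
    intros n. rewrite (Rmult_comm (d ^ 2)).
    apply (taylor1_le (f n) (g n) (h n)); intros t Ht; [apply Hf|apply Hg|apply Hh]; lra. }
  set (F1 := zsum (fun n => f n (x + d))) in *. set (F0 := zsum (fun n => f n x)) in *.
  set (G := zsum (fun n => g n x)) in *.
  assert (Hdp : 0 < Rabs d) by (apply Rabs_pos_lt, Hd0).
  replace ((F1 - F0) / d - G) with ((F1 - F0 - d * G) / d) by (field; exact Hd0).
  unfold Rdiv; rewrite Rabs_mult, Rabs_inv.
  apply Rle_lt_trans with (S * d ^ 2 * / Rabs d).
  - apply Rmult_le_compat_r; [apply Rlt_le, Rinv_0_lt_compat, Hdp|exact Hmain].
  - rewrite <- (pow2_abs d). replace (S * Rabs d ^ 2 * / Rabs d) with (S * Rabs d) by (field; lra).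
    apply Rle_lt_trans with ((S + 1) * Rabs d); [nra|].
    apply (Rmult_lt_compat_l (S + 1)) in Hd2; [|lra].
    replace ((S + 1) * (eps / (S + 1))) with eps in Hd2 by (field; lra). exact Hd2.
Qed.

(** The exponent [p] counts differentiations: [Hs y (S p)] is the derivative of [Hs y p], and [Cs],
    [Ss] alternate up to sign. *)
Definition Hs (y : R) (p : nat) (s : R) : R :=
  zsum (fun n => sechc y n * (oddz n ^ p * exp (s * oddz n))).
Definition Cs (y : R) (p : nat) (t : R) : R :=
  zsum (fun n => sechc y n * (oddz n ^ p * cos (t * oddz n))).
Definition Ss (y : R) (p : nat) (t : R) : R :=
  zsum (fun n => sechc y n * (oddz n ^ p * sin (t * oddz n))).

Lemma exp_mul_le (s u : R) : Rabs (exp (s * u)) <= exp (Rabs s * Rabs u).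
Proof.
  rewrite Rabs_pos_eq by apply Rlt_le, exp_pos. rewrite <- Rabs_mult.
  destruct (Rle_abs (s * u)) as [H|H]; [left; apply exp_increasing, H|right; f_equal; exact H].
Qed.

Lemma cos_le_exp (t u : R) : Rabs (cos (t * u)) <= exp (0 * Rabs u).
Proof. rewrite Rmult_0_l, exp_0; apply Rabs_le, COS_bound. Qed.

Lemma sin_le_exp (t u : R) : Rabs (sin (t * u)) <= exp (0 * Rabs u).
Proof. rewrite Rmult_0_l, exp_0; apply Rabs_le, SIN_bound. Qed.

Lemma zsummable_Hs (y s : R) (p : nat) : 0 < y -> Rabs s < y / 2 ->
  zsummable (fun n => sechc y n * (oddz n ^ p * exp (s * oddz n))).
Proof.
  intros Hy Hs. apply (zsummable_sechc_bounded y (Rabs s) p (fun u => exp (s * u)) Hy Hs).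
  intros u; apply exp_mul_le.
Qed.

Lemma zsummable_Cs (y t : R) (p : nat) : 0 < y ->
  zsummable (fun n => sechc y n * (oddz n ^ p * cos (t * oddz n))).
Proof.
  intros Hy. apply (zsummable_sechc_bounded y 0 p (fun u => cos (t * u)) Hy ltac:(lra)).
  intros u; apply cos_le_exp.
Qed.

Lemma zsummable_Ss (y t : R) (p : nat) : 0 < y ->
  zsummable (fun n => sechc y n * (oddz n ^ p * sin (t * oddz n))).
Proof.
  intros Hy. apply (zsummable_sechc_bounded y 0 p (fun u => sin (t * u)) Hy ltac:(lra)).
  intros u; apply sin_le_exp.
Qed.

Lemma is_derive_Hs (y s : R) (p : nat) : 0 < y -> Rabs s < y / 2 ->
  is_derive (Hs y p) s (Hs y (S p) s).
Proof.
  (* Half the distance to the boundary, so that even the enlarged rate [Rabs s + r] stays below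
     [y / 2]. *)
  intros Hy Hs. set (r := (y / 2 - Rabs s) / 2).
  assert (Hr : 0 < r) by (unfold r; lra).
  assert (Hin : forall t, Rabs (t - s) <= r -> Rabs t <= Rabs s + r).
  { intros t Ht. replace t with (s + (t - s)) by ring. pose proof (Rabs_triang s (t - s)); lra. }
  apply (is_derive_zsum (fun n t => sechc y n * (oddz n ^ p * exp (t * oddz n)))
    (fun n t => sechc y n * (oddz n ^ S p * exp (t * oddz n)))
    (fun n t => sechc y n * (oddz n ^ S (S p) * exp (t * oddz n)))
    (fun n => sechc y n * (Rabs (oddz n) ^ S (S p) * exp ((Rabs s + r) * Rabs (oddz n)))) s r Hr).
  - intros n t _; auto_derive; [exact I|]. simpl; ring.
  - intros n t _; auto_derive; [exact I|]. simpl; ring.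
  - intros n t Ht. rewrite !Rabs_mult, <- RPow_abs, (Rabs_pos_eq (sechc y n)) by (apply Rlt_le, sechc_pos).
    apply Rmult_le_compat_l; [apply Rlt_le, sechc_pos|].
    apply Rmult_le_compat_l; [apply pow_le, Rabs_pos|].
    eapply Rle_trans; [apply exp_mul_le|].
    assert (H : Rabs t * Rabs (oddz n) <= (Rabs s + r) * Rabs (oddz n)).
    { apply Rmult_le_compat_r; [apply Rabs_pos|apply Hin, Ht]. }
    destruct H as [H|H]; [left; apply exp_increasing, H|right; f_equal; exact H].
  - apply zsummable_sechc; [exact Hy|unfold r; lra].
  - intros t Ht; apply zsummable_Hs; [exact Hy|]. specialize (Hin t Ht). unfold r in *; lra.
  - apply zsummable_Hs; assumption.
Qed.

Lemma sechc_odd_pow_summable (y : R) (p : nat) : 0 < y ->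
  zsummable (fun n => sechc y n * Rabs (oddz n) ^ p).
Proof.
  intros Hy; apply zsummable_ext with (2 := zsummable_sechc y 0 p Hy ltac:(lra)).
  intros n; rewrite Rmult_0_l, exp_0; ring.
Qed.

Lemma Rabs_sechc_mul_le (y : R) (n : Z) (p : nat) (c : R) : Rabs c <= 1 ->
  Rabs (sechc y n * (oddz n ^ p * c)) <= sechc y n * Rabs (oddz n) ^ p.
Proof.
  intros Hc. rewrite !Rabs_mult, <- RPow_abs, (Rabs_pos_eq (sechc y n)) by (apply Rlt_le, sechc_pos).
  apply Rmult_le_compat_l; [apply Rlt_le, sechc_pos|].
  rewrite <- (Rmult_1_r (Rabs (oddz n) ^ p)) at 2.
  apply Rmult_le_compat_l; [apply pow_le, Rabs_pos|exact Hc].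
Qed.

Lemma is_derive_Cs (y t : R) (p : nat) : 0 < y -> is_derive (Cs y p) t (- Ss y (S p) t).
Proof.
  intros Hy. replace (- Ss y (S p) t) with
    (zsum (fun n => (-1) * (sechc y n * (oddz n ^ S p * sin (t * oddz n))))) by (rewrite zsum_scal; unfold Ss; ring).
  apply (is_derive_zsum (fun n t => sechc y n * (oddz n ^ p * cos (t * oddz n)))
    (fun n t => (-1) * (sechc y n * (oddz n ^ S p * sin (t * oddz n))))
    (fun n t => sechc y n * (oddz n ^ S (S p) * - cos (t * oddz n)))
    (fun n => sechc y n * Rabs (oddz n) ^ S (S p)) t 1 Rlt_0_1).
  - intros n u _; auto_derive; [exact I|]. simpl; ring.
  - intros n u _; auto_derive; [exact I|]. simpl; ring.
  - intros n u _. apply Rabs_sechc_mul_le. rewrite Rabs_Ropp; apply Rabs_le, COS_bound.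
  - apply sechc_odd_pow_summable, Hy.
  - intros u _; apply zsummable_Cs, Hy.
  - apply zsummable_scal, zsummable_Ss, Hy.
Qed.

Lemma is_derive_Ss (y t : R) (p : nat) : 0 < y -> is_derive (Ss y p) t (Cs y (S p) t).
Proof.
  intros Hy.
  apply (is_derive_zsum (fun n t => sechc y n * (oddz n ^ p * sin (t * oddz n)))
    (fun n t => sechc y n * (oddz n ^ S p * cos (t * oddz n)))
    (fun n t => sechc y n * (oddz n ^ S (S p) * - sin (t * oddz n)))
    (fun n => sechc y n * Rabs (oddz n) ^ S (S p)) t 1 Rlt_0_1).
  - intros n u _; auto_derive; [exact I|]. simpl; ring.
  - intros n u _; auto_derive; [exact I|]. simpl; ring.
  - intros n u _. apply Rabs_sechc_mul_le. rewrite Rabs_Ropp; apply Rabs_le, SIN_bound.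
  - apply sechc_odd_pow_summable, Hy.
  - intros u _; apply zsummable_Ss, Hy.
  - apply zsummable_Cs, Hy.
Qed.

Lemma Hs_cube (y s : R) : 0 < y -> Rabs s < y / 2 ->
  Hs y 2 s = 2 * Hs y 0 s ^ 3 - 2 * kap y * Hs y 0 s.
Proof.
  intros Hy Hs'.
  assert (H := sech_sum_cube y (Rabs s) (fun u => exp (s * u)) (fun _ => 0) Hy Hs'). cbv beta zeta in H.
  fold (Hs y 0 s) (Hs y 2 s) in H. rewrite H; [field|..].
  - intros u; apply exp_mul_le.
  - intros u; rewrite Rabs_R0; apply Rlt_le, exp_pos.
  - intros u v; rewrite Rmult_plus_distr_l, exp_plus; ring.
  - intros; ring.
  - intros; ring.
Qed.

Lemma Cs_cube (y t : R) : 0 < y -> Cs y 2 t = 2 * Cs y 0 t ^ 3 - 2 * kap y * Cs y 0 t.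
Proof.
  intros Hy.
  assert (H := sech_sum_cube y 0 (fun u => cos (t * u)) (fun u => sin (t * u)) Hy ltac:(lra)). cbv beta zeta in H.
  fold (Cs y 0 t) (Cs y 2 t) in H. rewrite H; [field|..].
  - intros u; apply cos_le_exp.
  - intros u; apply sin_le_exp.
  - intros u v; rewrite Rmult_plus_distr_l; apply cos_plus.
  - intros u v; rewrite Rmult_plus_distr_l; apply sin_plus.
  - intros u. rewrite <- sin_neg; f_equal; ring.
Qed.

Lemma eq_of_derive_0 (f : R -> R) (a b : R) :
  (forall t, Rmin a b <= t <= Rmax a b -> is_derive f t 0) -> f a = f b.
Proof.
  intros H. destruct (MVT_gen f a b (fun _ => 0)) as [c [_ E]].
  - intros t Ht; apply H; lra.
  - intros t Ht. apply continuity_pt_filterlim, (ex_derive_continuous (V := R_NormedModule)). eexists; apply H, Ht.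
  - lra.
Qed.

Definition al (y : R) : R := zsum (sechc y).
Definition bb (y : R) : R := al y ^ 2 - 2 * kap y.

Lemma Hs_0 (y : R) : Hs y 0 0 = al y.
Proof. apply zsum_ext; intros n; rewrite Rmult_0_l, exp_0; simpl; ring. Qed.

Lemma Cs_0 (y : R) : Cs y 0 0 = al y.
Proof. apply zsum_ext; intros n; rewrite Rmult_0_l, cos_0; simpl; ring. Qed.

Lemma Ss_0 (y : R) (p : nat) : Ss y p 0 = 0.
Proof. apply zsum_0; intros n; rewrite Rmult_0_l, sin_0; ring. Qed.

Lemma Hs_opp (y s : R) : Hs y 0 (- s) = Hs y 0 s.
Proof.
  unfold Hs; rewrite <- zsum_reflect; apply zsum_ext; intros n.
  rewrite sechc_reflect, oddz_reflect. do 2 f_equal. f_equal. ring.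
Qed.

Lemma Hs_1_0 (y : R) : Hs y 1 0 = 0.
Proof.
  assert (E : Hs y 1 0 = zsum (fun n => (-1) * (sechc y n * (oddz n ^ 1 * exp (0 * oddz n))))).
  { unfold Hs at 1; rewrite <- zsum_reflect; apply zsum_ext; intros n.
    rewrite sechc_reflect, oddz_reflect, !Rmult_0_l; ring. }
  rewrite zsum_scal in E. fold (Hs y 1 0) in E. lra.
Qed.

Lemma zsum_ge_term (f : Z -> R) : zsummable f -> (forall n, 0 <= f n) -> f 0%Z + f (-1)%Z <= zsum f.
Proof.
  intros Sf H. apply (term_le_is_series (zpair f) (zsum f) 0).
  - intros n; unfold zpair; pose proof (H (Z.of_nat n)); pose proof (H (- Z.of_nat n - 1)%Z); lra.
  - apply Series_correct, zsummable_ex, Sf.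
Qed.

Lemma al_pos (y : R) : 0 < y -> 0 < al y.
Proof.
  intros Hy. eapply Rlt_le_trans; [|apply zsum_ge_term; [apply zsummable_sechc_1, Hy|intros; apply Rlt_le, sechc_pos]].
  pose proof (sechc_pos y 0); pose proof (sechc_pos y (-1)); lra.
Qed.

(** Averaging over [s] and [- s] replaces the exponential by a hyperbolic cosine, which is at least
    1. *)
Lemma Hs_ge (y s : R) : 0 < y -> Rabs s < y / 2 -> al y <= Hs y 0 s.
Proof.
  intros Hy Hs'. assert (E : Hs y 0 s + Hs y 0 (- s) = 2 * Hs y 0 s) by (rewrite Hs_opp; ring).
  assert (Hs'' : Rabs (- s) < y / 2) by (rewrite Rabs_Ropp; exact Hs').
  assert (2 * al y <= Hs y 0 s + Hs y 0 (- s)); [|lra].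
  unfold Hs, al; rewrite <- zsum_scal, <- zsum_plus by (apply zsummable_Hs; assumption).
  apply zsum_le; [apply zsummable_scal, zsummable_sechc_1, Hy|apply zsummable_plus; apply zsummable_Hs; assumption|].
  intros n. pose proof (sechc_pos y n). simpl.
  assert (2 <= exp (s * oddz n) + exp (- s * oddz n)); [|nra].
  replace (- s * oddz n) with (- (s * oddz n)) by ring. rewrite exp_Ropp.
  set (e := exp (s * oddz n)). assert (He : 0 < e) by apply exp_pos.
  assert (0 <= (e - 1) ^ 2 / e) by (apply Rmult_le_pos; [apply pow2_ge_0|apply Rlt_le, Rinv_0_lt_compat, He]).
  replace ((e - 1) ^ 2 / e) with (e + / e - 2) in H0 by (field; lra). lra.
Qed.

Lemma Hs_first_integral (y s : R) : 0 < y -> Rabs s < y / 2 ->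
  Hs y 1 s ^ 2 = (Hs y 0 s ^ 2 - al y ^ 2) * (Hs y 0 s ^ 2 + bb y).
Proof.
  intros Hy Hs'.
  set (f := fun u => Hs y 1 u ^ 2 - (Hs y 0 u ^ 2 - al y ^ 2) * (Hs y 0 u ^ 2 + bb y)).
  assert (E : f 0 = f s).
  { apply eq_of_derive_0; intros t Ht.
    assert (Ht' : Rabs t < y / 2).
    { unfold Rmin, Rmax, Rabs in *; repeat destruct Rle_dec; repeat destruct Rcase_abs; lra. }
    assert (D0 := is_derive_Hs y t 0 Hy Ht'). assert (D1 := is_derive_Hs y t 1 Hy Ht').
    unfold f. auto_derive.
    - repeat split; eexists; eassumption.
    - rewrite (is_derive_unique (fun x : R => Hs y 0 x) _ _ D0), (is_derive_unique (fun x : R => Hs y 1 x) _ _ D1), (Hs_cube y t Hy Ht').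
      unfold bb; ring. }
  unfold f in E. rewrite Hs_0, Hs_1_0 in E.
  assert (E' : (al y ^ 2 - al y ^ 2) * (al y ^ 2 + bb y) = 0) by ring. lra.
Qed.

Lemma Cs_first_integral (y t : R) : 0 < y ->
  Ss y 1 t ^ 2 = (al y ^ 2 - Cs y 0 t ^ 2) * (Cs y 0 t ^ 2 + bb y).
Proof.
  intros Hy.
  set (f := fun u => Ss y 1 u ^ 2 - (al y ^ 2 - Cs y 0 u ^ 2) * (Cs y 0 u ^ 2 + bb y)).
  assert (E : f 0 = f t).
  { apply eq_of_derive_0; intros u _.
    assert (D0 := is_derive_Cs y u 0 Hy). assert (D1 := is_derive_Ss y u 1 Hy).
    unfold f. auto_derive.
    - repeat split; eexists; eassumption.
    - rewrite (is_derive_unique (fun x : R => Cs y 0 x) _ _ D0), (is_derive_unique (fun x : R => Ss y 1 x) _ _ D1), (Cs_cube y u Hy).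
      unfold bb; ring. }
  unfold f in E. rewrite Cs_0, Ss_0 in E.
  assert (E' : (al y ^ 2 - al y ^ 2) * (al y ^ 2 + bb y) = 0) by ring. lra.
Qed.

(** Gronwall: [L] is a Lipschitz constant of the cubic on [[-B, B]], and the squared distance of the
    two phase points times [exp (- (1 + L) s)] does not increase. The extra 1 pays for the term
    [2 u v] coming from [w' = d]. *)
Lemma cubic_ode_unique (p1 p3 B T : R) (w1 d1 w2 d2 : R -> R) :
  (forall t, 0 <= t <= T -> is_derive w1 t (d1 t)) ->
  (forall t, 0 <= t <= T -> is_derive d1 t (p1 * w1 t + p3 * w1 t ^ 3)) ->
  (forall t, 0 <= t <= T -> is_derive w2 t (d2 t)) ->
  (forall t, 0 <= t <= T -> is_derive d2 t (p1 * w2 t + p3 * w2 t ^ 3)) ->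
  (forall t, 0 <= t <= T -> Rabs (w1 t) <= B) ->
  (forall t, 0 <= t <= T -> Rabs (w2 t) <= B) ->
  w1 0 = w2 0 -> d1 0 = d2 0 ->
  forall t, 0 <= t <= T -> w1 t = w2 t.
Proof.
  intros W1 D1 W2 D2 B1 B2 E0 E1 t Ht.
  set (L := Rabs p1 + 3 * (Rabs p3 * B ^ 2)).
  set (E := fun s => ((w1 s - w2 s) ^ 2 + (d1 s - d2 s) ^ 2) * exp (- (1 + L) * s)).
  set (E' := fun s => (2 * (w1 s - w2 s) * (d1 s - d2 s) +
    2 * (d1 s - d2 s) * (p1 * w1 s + p3 * w1 s ^ 3 - (p1 * w2 s + p3 * w2 s ^ 3))
    - (1 + L) * ((w1 s - w2 s) ^ 2 + (d1 s - d2 s) ^ 2)) * exp (- (1 + L) * s)).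
  assert (DE : forall s, 0 <= s <= T -> is_derive E s (E' s)).
  { intros s Hs. unfold E. auto_derive.
    - repeat split; eexists; [apply W1|apply W2|apply D1|apply D2]; exact Hs.
    - rewrite (is_derive_unique (fun x : R => w1 x) _ _ (W1 s Hs)), (is_derive_unique (fun x : R => w2 x) _ _ (W2 s Hs)),
        (is_derive_unique (fun x : R => d1 x) _ _ (D1 s Hs)), (is_derive_unique (fun x : R => d2 x) _ _ (D2 s Hs)).
      unfold E'; ring. }
  assert (LE : forall s, 0 <= s <= T -> E' s <= 0).
  { intros s Hs. unfold E'. set (a := w1 s) in *. set (b := w2 s).
    assert (Ha : Rabs a <= B) by apply B1, Hs. assert (Hb : Rabs b <= B) by apply B2, Hs.
    set (u := a - b). set (v := d1 s - d2 s).
    assert (HP : Rabs (p1 * a + p3 * a ^ 3 - (p1 * b + p3 * b ^ 3)) <= L * Rabs u).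
    { replace (p1 * a + p3 * a ^ 3 - (p1 * b + p3 * b ^ 3)) with
        ((p1 + p3 * (a * a + a * b + b * b)) * u) by (unfold u; ring).
      rewrite Rabs_mult. apply Rmult_le_compat_r; [apply Rabs_pos|].
      eapply Rle_trans; [apply Rabs_triang|]. unfold L. apply Rplus_le_compat_l.
      rewrite Rabs_mult.
      assert (Hq : Rabs (a * a + a * b + b * b) <= 3 * B ^ 2).
      { assert (HB : 0 <= B) by (eapply Rle_trans; [apply (Rabs_pos a)|exact Ha]).
        apply Rabs_le_between in Ha. apply Rabs_le_between in Hb.
        assert (a * a <= B ^ 2) by nra. assert (b * b <= B ^ 2) by nra.
        assert (- B ^ 2 <= a * b <= B ^ 2) by (split; nra).
        pose proof (Rle_0_sqr a); pose proof (Rle_0_sqr b). unfold Rsqr in *.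
        apply Rabs_le; lra. }
      pose proof (Rabs_pos p3). nra. }
    set (P := p1 * a + p3 * a ^ 3 - (p1 * b + p3 * b ^ 3)) in *.
    assert (Hvp : 2 * v * P <= L * (u ^ 2 + v ^ 2)).
    { apply Rle_trans with (2 * (Rabs v * Rabs P)).
      - rewrite <- Rabs_mult. pose proof (Rle_abs (v * P)). lra.
      - apply Rle_trans with (2 * (Rabs v * (L * Rabs u))).
        + pose proof (Rabs_pos v). apply Rmult_le_compat_l; [lra|]. apply Rmult_le_compat_l; assumption.
        + rewrite <- (pow2_abs u), <- (pow2_abs v).
          assert (HL : 0 <= L).
          { unfold L. pose proof (Rabs_pos p1). pose proof (Rabs_pos p3). pose proof (pow2_ge_0 B). nra. }
          pose proof (pow2_ge_0 (Rabs u - Rabs v)). nra. }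
    pose proof (exp_pos (- (1 + L) * s)). pose proof (pow2_ge_0 (u - v)).
    assert (2 * u * v + 2 * v * P - (1 + L) * (u ^ 2 + v ^ 2) <= 0) by nra. nra. }
  destruct (MVT_gen E 0 t E') as [c [Hc Ec]].
  - intros s Hs. rewrite Rmin_left, Rmax_right in Hs by lra. apply DE; lra.
  - intros s Hs. rewrite Rmin_left, Rmax_right in Hs by lra.
    apply continuity_pt_filterlim, (ex_derive_continuous (V := R_NormedModule)). eexists; apply DE; lra.
  - rewrite Rmin_left, Rmax_right in Hc by lra.
    assert (Hc' := LE c ltac:(lra)).
    assert (Et : E t <= 0).
    { replace (E 0) with 0 in Ec by (unfold E; rewrite E0, E1; ring). nra. }
    unfold E in Et. pose proof (exp_pos (- (1 + L) * t)).
    pose proof (pow2_ge_0 (w1 t - w2 t)). pose proof (pow2_ge_0 (d1 t - d2 t)).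
    assert (Z : (w1 t - w2 t) ^ 2 = 0) by nra.
    assert (w1 t - w2 t = 0) by nra. lra.
Qed.

(** * Special values of the cosine series and the pole of the exponential series *)

Lemma cos_oddz_PI2 (n : Z) : cos (PI / 2 * oddz n) = 0.
Proof. apply cos_eq_0_1. exists n. unfold oddz; field. Qed.

Lemma cos_oddz_PI (n : Z) : cos (PI * oddz n) = - 1.
Proof.
  replace (PI * oddz n) with (2 * (PI / 2 * oddz n)) by field.
  rewrite cos_2a_cos, cos_oddz_PI2; ring.
Qed.

Lemma Cs_PI (y : R) : Cs y 0 PI = - al y.
Proof.
  replace (- al y) with (zsum (fun n => -1 * sechc y n)) by (rewrite zsum_scal; unfold al; ring).
  apply zsum_ext; intros n; rewrite cos_oddz_PI; simpl; ring.
Qed.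

Lemma Cs_PI2 (y : R) : Cs y 0 (PI / 2) = 0.
Proof. apply zsum_0; intros n; rewrite cos_oddz_PI2; ring. Qed.

Lemma Cs_bound (y t : R) : 0 < y -> Rabs (Cs y 0 t) <= al y.
Proof.
  intros Hy. eapply Rle_trans; [apply Rabs_zsum, zsummable_Cs, Hy|].
  apply zsum_le; [apply zsummable_abs, zsummable_Cs, Hy|apply zsummable_sechc_1, Hy|].
  intros n. eapply Rle_trans; [apply Rabs_sechc_mul_le, Rabs_le, COS_bound|]. simpl; lra.
Qed.

(** The sum of [a_j (1 + cos (j t))] vanishes and its terms are nonnegative, so the term with
    [j = 1] is zero. Hence the minimum is not reached before [PI]. *)
Lemma Cs_min (y t : R) : 0 < y -> Cs y 0 t = - al y -> cos t = -1.
Proof.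
  intros Hy H.
  assert (Sf := zsummable_plus _ _ (zsummable_sechc_1 y Hy) (zsummable_Cs y t 0 Hy)).
  assert (Hz := zsum_ge_term _ Sf). cbv beta in Hz.
  rewrite zsum_plus in Hz; [|apply zsummable_sechc_1, Hy|apply zsummable_Cs, Hy].
  fold (al y) (Cs y 0 t) in Hz. rewrite H in Hz.
  assert (Hp : forall n, 0 <= sechc y n + sechc y n * (oddz n ^ 0 * cos (t * oddz n))).
  { intros n. pose proof (sechc_pos y n). pose proof (COS_bound (t * oddz n)). simpl. nra. }
  specialize (Hz Hp). pose proof (Hp (-1)%Z).
  assert (E : oddz 0 = 1) by (unfold oddz; lra). rewrite E in Hz.
  pose proof (sechc_pos y 0). pose proof (COS_bound t). rewrite Rmult_1_r in Hz. simpl in Hz. nra.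
Qed.

Lemma is_derive_Ss_cube (y t : R) : 0 < y ->
  is_derive (fun t => - Ss y 1 t) t (2 * kap y * Cs y 0 t + - 2 * Cs y 0 t ^ 3).
Proof.
  intros Hy. evar_last; [apply (is_derive_opp (V := R_NormedModule)), is_derive_Ss, Hy|].
  rewrite Cs_cube by exact Hy. unfold opp; simpl; ring.
Qed.

(** At [PI / 2] the series vanishes, so the first integral reads [C' ^ 2 = al ^ 2 * bb]. If [bb]
    were not positive, the derivative would vanish there too, and uniqueness, started at [PI / 2],
    would force [C] to be zero up to [PI], where its value is [- al]. *)
Lemma bb_pos (y : R) : 0 < y -> 0 < bb y.
Proof.
  intros Hy. assert (Ha := al_pos y Hy).
  assert (HI := Cs_first_integral y (PI / 2) Hy). rewrite Cs_PI2 in HI.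
  assert (HI' : Ss y 1 (PI / 2) ^ 2 = al y ^ 2 * bb y) by lra. clear HI.
  pose proof (pow2_ge_0 (Ss y 1 (PI / 2))).
  assert (Ha2 : 0 < al y ^ 2) by (apply pow_lt, Ha).
  destruct (Rle_lt_dec (bb y) 0) as [Hb|Hb]; [exfalso|exact Hb].
  assert (Hz : Ss y 1 (PI / 2) ^ 2 = 0) by nra.
  assert (Hz' : Ss y 1 (PI / 2) = 0) by nra.
  assert (HP := PI_RGT_0).
  assert (E : Cs y 0 (PI / 2 + PI / 2) = 0).
  { apply (cubic_ode_unique (2 * kap y) (- 2) (al y) (PI / 2)
      (fun t => Cs y 0 (PI / 2 + t)) (fun t => - Ss y 1 (PI / 2 + t)) (fun _ => 0) (fun _ => 0)); try lra.
    - intros t _. evar_last.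
      + apply (is_derive_comp (V := R_NormedModule) (Cs y 0) (fun t => PI / 2 + t)); [apply is_derive_Cs, Hy|].
        apply (is_derive_plus (V := R_NormedModule)); [apply is_derive_const|apply is_derive_id].
      + unfold scal, plus, zero, one; simpl; unfold mult; simpl; ring.
    - intros t _. evar_last.
      + apply (is_derive_comp (V := R_NormedModule) (fun t => - Ss y 1 t) (fun t => PI / 2 + t)); [apply is_derive_Ss_cube, Hy|].
        apply (is_derive_plus (V := R_NormedModule)); [apply is_derive_const|apply is_derive_id].
      + unfold scal, plus, zero, one; simpl; unfold mult; simpl; ring.
    - intros t _. apply (is_derive_const (V := R_NormedModule)).
    - intros t _. evar_last; [apply (is_derive_const (V := R_NormedModule))|]. unfold zero; simpl; ring.
    - intros t _; apply Cs_bound, Hy.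
    - intros t _; rewrite Rabs_R0; lra.
    - rewrite Rplus_0_r; apply Cs_PI2.
    - rewrite Rplus_0_r; lra. }
  replace (PI / 2 + PI / 2) with PI in E by field. rewrite Cs_PI in E; lra.
Qed.

(** The two terms of frequency [j] and [- j] combine to [2 exp (- j v) + 4 sinh (j v) / (exp (j y) +
    1)]. The first summands form a geometric series with sum [/ sinh v], the polar part. *)
Lemma Hs_lambert (y v : R) : 0 < v < y ->
  is_series (fun n => 4 * (sinh ((2 * INR n + 1) * v) / (exp ((2 * INR n + 1) * y) + 1)))
    (Hs y 0 (y / 2 - v) - / sinh v).
Proof.
  intros Hv. assert (Hy : 0 < y) by lra.
  assert (Hs' : Rabs (y / 2 - v) < y / 2) by (apply Rabs_def1; lra).
  assert (S1 := Series_correct _ (zsummable_ex _ (zsummable_Hs y _ 0 Hy Hs'))).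
  fold (zsum (fun n => sechc y n * (oddz n ^ 0 * exp ((y / 2 - v) * oddz n)))) in S1.
  fold (Hs y 0 (y / 2 - v)) in S1.
  assert (P := exp_pos v).
  assert (S2 : is_series (fun n => 2 * exp (- v) * exp (- (2 * v)) ^ n) (/ sinh v)).
  { evar_last; [apply (is_series_scal (V := R_NormedModule) (2 * exp (- v))), is_series_geom|].
    - rewrite Rabs_pos_eq by (apply Rlt_le, exp_pos). rewrite <- exp_0; apply exp_increasing; lra.
    - unfold scal; simpl; unfold mult; simpl. unfold sinh.
      replace (- (2 * v)) with (- v + - v) by ring. rewrite exp_plus, exp_Ropp.
      assert (exp v > 1) by (rewrite <- exp_0; apply exp_increasing; lra).
      field. repeat split; nra. }
  assert (S3 := is_series_minus (V := R_NormedModule) _ _ _ _ S1 S2).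
  apply is_series_ext with (2 := S3). intros n. req.
  unfold minus, plus, opp; simpl. unfold zpair.
  replace (- Z.of_nat n - 1)%Z with (-1 - Z.of_nat n)%Z by lia.
  rewrite sechc_reflect, oddz_reflect. unfold sechc.
  set (J := oddz (Z.of_nat n)). assert (EJ : 2 * INR n + 1 = J) by (unfold J, oddz; rewrite <- INR_IZR_INZ; reflexivity).
  assert (E : exp (- v) * exp (- (2 * v)) ^ n = exp (- (J * v))).
  { rewrite <- EJ. clear. induction n as [|n IH]; [simpl; rewrite Rmult_1_r; f_equal; ring|].
    rewrite S_INR. simpl. replace (exp (- v) * (exp (- (2 * v)) * exp (- (2 * v)) ^ n)) with
      (exp (- (2 * v)) * (exp (- v) * exp (- (2 * v)) ^ n)) by ring.
    rewrite IH, <- exp_plus; f_equal; ring. }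
  rewrite EJ. unfold sinh, cosh.
  replace (J * y) with (J * (y / 2) + J * (y / 2)) by field.
  replace ((y / 2 - v) * J) with (J * (y / 2) + - (J * v)) by ring.
  replace ((y / 2 - v) * - J) with (- (J * (y / 2)) + J * v) by ring.
  rewrite (Rmult_assoc 2), E.
  rewrite !exp_plus, !exp_Ropp.
  assert (P1 := exp_pos (J * v)). assert (P2 := exp_pos (J * (y / 2))).
  set (A := exp (J * v)) in *. set (B := exp (J * (y / 2))) in *.
  field. repeat split; nra.
Qed.

Lemma Hs_ge_inv_sinh (y v : R) : 0 < v < y -> / sinh v <= Hs y 0 (y / 2 - v).
Proof.
  intros Hv. assert (H := Hs_lambert y v Hv).
  assert (0 <= Hs y 0 (y / 2 - v) - / sinh v); [|lra].
  apply (is_series_le (fun _ => 0)) with (3 := H).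
  - intros n. pose proof (pos_INR n). apply Rmult_le_pos; [lra|]. apply Rmult_le_pos.
    + apply Rlt_le, sinh_pos. nra.
    + apply Rlt_le, Rinv_0_lt_compat. pose proof (exp_pos ((2 * INR n + 1) * y)); lra.
  - apply (filterlim_ext (fun _ => 0)); [intros n; rewrite sum_n_const; ring|apply filterlim_const].
Qed.

(** * Jacobi elliptic functions on the real line *)

Definition dl (M phi : R) : R := sqrt (1 - M * sin phi ^ 2).

Lemma sin2_le_1 (t : R) : 0 <= sin t ^ 2 <= 1.
Proof. pose proof (SIN_bound t). split; nra. Qed.

Lemma dl_arg_pos (M t : R) : 0 < M < 1 -> 0 < 1 - M * sin t ^ 2.
Proof. intros HM; pose proof (sin2_le_1 t); nra. Qed.

Lemma dl_pos (M t : R) : 0 < M < 1 -> 0 < dl M t.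
Proof. intros HM; apply sqrt_lt_R0, dl_arg_pos, HM. Qed.

Lemma dl_sq (M t : R) : 0 < M < 1 -> dl M t ^ 2 = 1 - M * sin t ^ 2.
Proof. intros HM; apply pow2_sqrt, Rlt_le, dl_arg_pos, HM. Qed.

Lemma dl_le_1 (M t : R) : 0 < M < 1 -> dl M t <= 1.
Proof.
  intros HM. rewrite <- sqrt_1. apply sqrt_le_1_alt. pose proof (sin2_le_1 t); nra.
Qed.

Lemma is_derive_dl (M t : R) : 0 < M < 1 ->
  is_derive (dl M) t (- M * sin t * cos t / dl M t).
Proof.
  intros HM. unfold dl. assert (H := dl_arg_pos M t HM). auto_derive; [simpl in *; lra|].
  fold (dl M t).
  replace (sqrt (1 + - (M * (sin t * (sin t * 1))))) with (dl M t) by (unfold dl; f_equal; ring).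
  field. apply Rgt_not_eq, dl_pos, HM.
Qed.

Lemma continuous_of_derive (f : R -> R) (x l : R) : is_derive f x l -> continuous f x.
Proof. intros H; apply (ex_derive_continuous (V := R_NormedModule)); eexists; exact H. Qed.

Lemma is_derive_ellF (M phi : R) : 0 < M < 1 -> is_derive (ellF M) phi (/ dl M phi).
Proof.
  intros HM. unfold ellF.
  assert (Hc : forall t, continuous (fun t => 1 / sqrt (1 - M * sin t ^ 2)) t).
  { intros t. apply (continuous_of_derive (fun t => 1 / dl M t) t (M * sin t * cos t / dl M t ^ 3)).
    evar_last; [apply is_derive_div; [apply (is_derive_const (V := R_NormedModule))|apply is_derive_dl, HM|apply Rgt_not_eq, dl_pos, HM]|].
    unfold zero; simpl; field. apply Rgt_not_eq, dl_pos, HM. }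
  replace (/ dl M phi) with (1 / sqrt (1 - M * sin phi ^ 2)) by (unfold dl; field; apply Rgt_not_eq, dl_pos, HM).
  apply (is_derive_RInt (V := R_CompleteNormedModule) (fun t => 1 / sqrt (1 - M * sin t ^ 2)) _ 0); [|apply Hc].
  exists posreal_one; intros b _. apply (RInt_correct (V := R_CompleteNormedModule)).
  apply (ex_RInt_continuous (V := R_CompleteNormedModule)). intros t _; apply Hc.
Qed.

Lemma ellF_0 (M : R) : ellF M 0 = 0.
Proof. apply (RInt_point (V := R_CompleteNormedModule)). Qed.

(** As [dl] is at most 1, the integral expands distances. Injectivity, surjectivity and the
    Lipschitz bound for its inverse [am] all follow from this form. *)
Lemma ellF_expand (M a b : R) : 0 < M < 1 ->
  exists c, Rmin a b <= c <= Rmax a b /\ ellF M b - ellF M a = / dl M c * (b - a).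
Proof.
  intros HM. apply MVT_gen.
  - intros t _; apply is_derive_ellF, HM.
  - intros t _; apply continuity_pt_filterlim. eapply continuous_of_derive; apply is_derive_ellF, HM.
Qed.

Lemma inv_dl_ge_1 (M c : R) : 0 < M < 1 -> 1 <= / dl M c.
Proof.
  intros HM. rewrite <- Rinv_1. apply Rinv_le_contravar; [apply dl_pos, HM|apply dl_le_1, HM].
Qed.

Lemma ellF_incr (M a b : R) : 0 < M < 1 -> a <= b -> b - a <= ellF M b - ellF M a.
Proof.
  intros HM Hab. destruct (ellF_expand M a b HM) as [c [_ ->]].
  pose proof (inv_dl_ge_1 M c HM). nra.
Qed.

Lemma ellF_le_inv (M a b : R) : 0 < M < 1 -> ellF M a <= ellF M b -> a <= b.
Proof.
  intros HM H. destruct (Rle_lt_dec a b) as [Hab|Hab]; [exact Hab|].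
  pose proof (ellF_incr M b a HM (Rlt_le _ _ Hab)). lra.
Qed.

Lemma ellF_inj (M a b : R) : 0 < M < 1 -> ellF M a = ellF M b -> a = b.
Proof. intros HM H; apply Rle_antisym; apply (ellF_le_inv M _ _ HM); lra. Qed.

Lemma ellF_surj (M u : R) : 0 < M < 1 -> exists phi, ellF M phi = u.
Proof.
  intros HM. pose proof (Rabs_pos u) as Hu. pose proof (Rabs_le_between u (Rabs u)) as [Hb _].
  specialize (Hb (Rle_refl _)).
  assert (H1 := ellF_incr M 0 (Rabs u) HM Hu). assert (H2 := ellF_incr M (- Rabs u) 0 HM ltac:(lra)).
  rewrite ellF_0 in H1, H2.
  destruct (IVT_gen (ellF M) (- Rabs u) (Rabs u) u) as [phi [_ E]].
  - intros t; apply continuity_pt_filterlim. eapply continuous_of_derive; apply is_derive_ellF, HM.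
  - rewrite Rmin_left, Rmax_right by lra. lra.
  - exists phi; exact E.
Qed.

Lemma sqr_01 (k : R) : 0 < k < 1 -> 0 < k ^ 2 < 1.
Proof. intros Hk; nra. Qed.

Lemma ellF_am (u k : R) : 0 < k < 1 -> ellF (k ^ 2) (am u k) = u.
Proof.
  intros Hk. unfold am. apply ClassicalEpsilon.epsilon_spec, ellF_surj, sqr_01, Hk.
Qed.

Lemma am_ellF (phi k : R) : 0 < k < 1 -> am (ellF (k ^ 2) phi) k = phi.
Proof. intros Hk. apply (ellF_inj (k ^ 2)); [apply sqr_01, Hk|apply ellF_am, Hk]. Qed.

Lemma am_0 (k : R) : 0 < k < 1 -> am 0 k = 0.
Proof. intros Hk. rewrite <- (ellF_0 (k ^ 2)) at 1. apply am_ellF, Hk. Qed.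

Lemma am_lipschitz (u v k : R) : 0 < k < 1 -> Rabs (am u k - am v k) <= Rabs (u - v).
Proof.
  intros Hk. destruct (ellF_expand (k ^ 2) (am v k) (am u k) (sqr_01 k Hk)) as [c [_ E]].
  rewrite !ellF_am in E by exact Hk. rewrite E, Rabs_mult.
  pose proof (inv_dl_ge_1 (k ^ 2) c (sqr_01 k Hk)). pose proof (Rabs_pos (am u k - am v k)).
  rewrite (Rabs_pos_eq (/ dl (k ^ 2) c)) by lra. nra.
Qed.

Lemma am_le (u v k : R) : 0 < k < 1 -> u <= v -> am u k <= am v k.
Proof. intros Hk H; apply (ellF_le_inv (k ^ 2)); [apply sqr_01, Hk|rewrite !ellF_am by exact Hk; exact H]. Qed.

Lemma am_lt (u v k : R) : 0 < k < 1 -> u < v -> am u k < am v k.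
Proof.
  intros Hk H. destruct (am_le u v k Hk (Rlt_le _ _ H)) as [E|E]; [exact E|].
  rewrite <- (ellF_am u k Hk), <- (ellF_am v k Hk), E in H; lra.
Qed.

(** The difference quotient equals [dl] at an intermediate angle, and the Lipschitz bound squeezes
    that angle towards [am u k]; continuity of [dl] concludes. *)
Lemma is_derive_am (u k : R) : 0 < k < 1 -> is_derive (fun u => am u k) u (dl (k ^ 2) (am u k)).
Proof.
  intros Hk. assert (HM := sqr_01 k Hk). apply is_derive_Reals. intros eps Heps.
  assert (Hc := continuous_of_derive _ _ _ (is_derive_dl (k ^ 2) (am u k) HM)).
  apply continuity_pt_filterlim in Hc. destruct (Hc eps Heps) as [d [Hd Hcd]].
  exists (mkposreal d Hd). intros h Hh0 Hh. simpl in Hh.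
  destruct (ellF_expand (k ^ 2) (am u k) (am (u + h) k) HM) as [c [Hc1 E]].
  rewrite !ellF_am in E by exact Hk.
  assert (Hdc := dl_pos (k ^ 2) c HM).
  assert (E' : (am (u + h) k - am u k) / h = dl (k ^ 2) c).
  { replace (u + h - u) with h in E by ring.
    apply (f_equal (Rmult (dl (k ^ 2) c))) in E. rewrite <- Rmult_assoc, Rinv_r, Rmult_1_l in E by lra.
    rewrite <- E. field; exact Hh0. }
  rewrite E'.
  assert (Hdist : Rabs (c - am u k) < d).
  { apply Rle_lt_trans with (2 := Hh). replace h with (u + h - u) by ring.
    apply Rle_trans with (2 := am_lipschitz (u + h) u k Hk).
    unfold Rmin, Rmax, Rabs in *; repeat destruct Rle_dec; repeat destruct Rcase_abs; lra. }
  destruct (Req_dec c (am u k)) as [->|Hne].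
  - rewrite Rminus_diag, Rabs_R0; exact Heps.
  - apply (Hcd c). split; [split; [exact I|auto]|exact Hdist].
Qed.

(** The reciprocal of [ds]. It has no pole on the real line and satisfies a cubic second-order
    equation; [sd'] is its derivative [cn / dn ^ 2]. *)
Definition sd (u k : R) : R := sin (am u k) / dl (k ^ 2) (am u k).
Definition sd' (u k : R) : R := cos (am u k) / dl (k ^ 2) (am u k) ^ 2.

Lemma ds_inv_sd (u k : R) : ds u k = / sd u k.
Proof. unfold sd. rewrite Rinv_div. reflexivity. Qed.

Lemma is_derive_am_comp (f : R -> R) (l u k : R) : 0 < k < 1 -> is_derive f (am u k) l ->
  is_derive (fun u => f (am u k)) u (dl (k ^ 2) (am u k) * l).
Proof.
  intros Hk Hf. apply (is_derive_comp (V := R_NormedModule) f (fun u => am u k)); [exact Hf|apply is_derive_am, Hk].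
Qed.

Lemma cos2_sin2 (t : R) : cos t ^ 2 = 1 - sin t ^ 2.
Proof. pose proof (sin2_cos2 t) as H; unfold Rsqr in H; lra. Qed.

Lemma is_derive_cn (u k : R) : 0 < k < 1 ->
  is_derive (fun u => cos (am u k)) u (- (sin (am u k) * dl (k ^ 2) (am u k))).
Proof.
  intros Hk. evar_last; [apply (is_derive_am_comp cos); [exact Hk|apply is_derive_cos]|]. simpl; ring.
Qed.

Lemma is_derive_cn2 (u k : R) : 0 < k < 1 ->
  is_derive (fun u => - (sin (am u k) * dl (k ^ 2) (am u k))) u
    ((2 * k ^ 2 - 1) * cos (am u k) - 2 * k ^ 2 * cos (am u k) ^ 3).
Proof.
  intros Hk. assert (HM := sqr_01 k Hk).
  assert (Hd := dl_pos (k ^ 2) (am u k) HM). assert (Hd2 := dl_sq (k ^ 2) (am u k) HM).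
  evar_last.
  - apply (is_derive_am_comp (fun t => - (sin t * dl (k ^ 2) t))); [exact Hk|].
    apply (is_derive_opp (V := R_NormedModule)).
    apply (is_derive_mult sin (dl (k ^ 2))); [apply is_derive_sin|apply is_derive_dl, HM|].
    intros; apply Rmult_comm.
  - unfold opp, plus, mult; simpl. set (s := sin (am u k)) in *. set (c := cos (am u k)) in *. set (d := dl (k * (k * 1)) (am u k)) in *. change (d ^ 2 = 1 - k ^ 2 * s ^ 2) in Hd2.
    assert (Hc : c ^ 2 = 1 - s ^ 2) by apply cos2_sin2.
    transitivity (- (c * d ^ 2) + k ^ 2 * s ^ 2 * c); [field; apply Rgt_not_eq, Hd|].
    rewrite Hd2. replace (s ^ 2) with (1 - c ^ 2) by lra. ring.
Qed.

Lemma is_derive_sd (u k : R) : 0 < k < 1 -> is_derive (fun u => sd u k) u (sd' u k).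
Proof.
  intros Hk. assert (HM := sqr_01 k Hk).
  assert (Hd := dl_pos (k ^ 2) (am u k) HM). assert (Hd2 := dl_sq (k ^ 2) (am u k) HM).
  evar_last.
  - apply (is_derive_am_comp (fun t => sin t / dl (k ^ 2) t)); [exact Hk|].
    apply is_derive_div; [apply is_derive_sin|apply is_derive_dl, HM|apply Rgt_not_eq, Hd].
  - unfold sd'. set (s := sin (am u k)) in *. set (c := cos (am u k)) in *. set (d := dl (k ^ 2) (am u k)) in *.
    transitivity (c * (d ^ 2 + k ^ 2 * s ^ 2) / d ^ 2); [field; lra|].
    rewrite Hd2 at 1. field. lra.
Qed.

Lemma is_derive_sd' (u k : R) : 0 < k < 1 -> is_derive (fun u => sd' u k) u
    ((2 * k ^ 2 - 1) * sd u k - 2 * k ^ 2 * (1 - k ^ 2) * sd u k ^ 3).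
Proof.
  intros Hk. assert (HM := sqr_01 k Hk).
  assert (Hd := dl_pos (k ^ 2) (am u k) HM). assert (Hd2 := dl_sq (k ^ 2) (am u k) HM).
  evar_last.
  - apply (is_derive_am_comp (fun t => cos t / dl (k ^ 2) t ^ 2)); [exact Hk|].
    apply is_derive_div; [apply is_derive_cos|apply is_derive_pow, is_derive_dl, HM|apply Rgt_not_eq, pow_lt, Hd].
  - unfold sd. cbn [INR pred]. set (s := sin (am u k)) in *. set (c := cos (am u k)) in *. set (d := dl (k ^ 2) (am u k)) in *.
    assert (Hc : c ^ 2 = 1 - s ^ 2) by apply cos2_sin2.
    transitivity (s * (2 * k ^ 2 * c ^ 2 - d ^ 2) / d ^ 3); [field; lra|].
    transitivity (s * ((2 * k ^ 2 - 1) * d ^ 2 - 2 * k ^ 2 * (1 - k ^ 2) * s ^ 2) / d ^ 3); [|field; lra].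
    do 2 f_equal. rewrite Hc, Hd2; ring.
Qed.

Lemma ellF_sym (M phi : R) : 0 < M < 1 -> ellF M (PI - phi) = 2 * ellF M (PI / 2) - ellF M phi.
Proof.
  intros HM. set (f := fun t => ellF M (PI - t) + ellF M t).
  assert (E : f (PI / 2) = f phi).
  { apply eq_of_derive_0; intros t _. unfold f. evar_last.
    - apply (is_derive_plus (V := R_NormedModule)); [|apply is_derive_ellF, HM].
      apply (is_derive_comp (V := R_NormedModule) (ellF M) (fun t => PI - t)); [apply is_derive_ellF, HM|].
      apply (is_derive_minus (V := R_NormedModule)); [apply is_derive_const|apply is_derive_id].
    - unfold dl. replace (sin (PI - t)) with (sin t) by (symmetry; apply sin_PI_x).
      unfold scal, plus, minus, opp, zero, one; simpl; unfold mult; simpl. ring_simplify.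
      unfold plus, opp; simpl. ring. }
  unfold f in E. replace (PI - PI / 2) with (PI / 2) in E by field. lra.
Qed.

Lemma ellF_PI (M : R) : 0 < M < 1 -> ellF M PI = 2 * ellF M (PI / 2).
Proof.
  intros HM. rewrite <- (Rminus_0_r PI) at 1. rewrite ellF_sym, ellF_0 by exact HM; ring.
Qed.

Lemma ellF_opp (M phi : R) : 0 < M < 1 -> ellF M (- phi) = - ellF M phi.
Proof.
  intros HM. set (f := fun t => ellF M (- t) + ellF M t).
  assert (E : f 0 = f phi).
  { apply eq_of_derive_0; intros t _. unfold f. evar_last.
    - apply (is_derive_plus (V := R_NormedModule)); [|apply is_derive_ellF, HM].
      apply (is_derive_comp (V := R_NormedModule) (ellF M) (fun t => - t)); [apply is_derive_ellF, HM|].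
      apply (is_derive_opp (V := R_NormedModule)), is_derive_id.
    - unfold dl. rewrite sin_neg.
      unfold scal, plus, opp, one; simpl; unfold mult; simpl.
      replace (1 - M * (- sin t * (- sin t * 1))) with (1 - M * (sin t * (sin t * 1))) by ring. ring. }
  unfold f in E. rewrite Ropp_0, ellF_0 in E. lra.
Qed.

Lemma am_opp (u k : R) : 0 < k < 1 -> am (- u) k = - am u k.
Proof.
  intros Hk. apply (ellF_inj (k ^ 2)); [apply sqr_01, Hk|].
  rewrite ellF_opp, !ellF_am by (try apply sqr_01; exact Hk). reflexivity.
Qed.

Lemma ds_opp (u k : R) : 0 < k < 1 -> ds (- u) k = - ds u k.
Proof.
  intros Hk. unfold ds, dn, sn. rewrite am_opp, sin_neg by exact Hk.
  replace ((- sin (am u k)) ^ 2) with (sin (am u k) ^ 2) by ring.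
  apply Rdiv_opp_r.
Qed.

Lemma ellK_pos (k : R) : 0 < k < 1 -> PI / 2 <= ellK k.
Proof.
  intros Hk. assert (HP := PI_RGT_0). assert (H := ellF_incr (k ^ 2) 0 (PI / 2) (sqr_01 k Hk) ltac:(lra)).
  rewrite ellF_0 in H. unfold ellK; lra.
Qed.

Lemma am_K (k : R) : 0 < k < 1 -> am (ellK k) k = PI / 2.
Proof. intros Hk; apply am_ellF, Hk. Qed.

Lemma am_2K (k : R) : 0 < k < 1 -> am (2 * ellK k) k = PI.
Proof.
  intros Hk. unfold ellK; rewrite <- ellF_PI by (apply sqr_01, Hk). apply am_ellF, Hk.
Qed.

Lemma sn_pos (u k : R) : 0 < k < 1 -> 0 < u < 2 * ellK k -> 0 < sin (am u k).
Proof.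
  intros Hk Hu. apply sin_gt_0.
  - rewrite <- (am_0 k Hk). apply am_lt; [exact Hk|lra].
  - rewrite <- (am_2K k Hk). apply am_lt; [exact Hk|lra].
Qed.

Lemma is_derive_ds (u k : R) : 0 < k < 1 -> 0 < u < 2 * ellK k ->
  is_derive (fun u => ds u k) u (- (cos (am u k) / sin (am u k) ^ 2)) /\
  (cos (am u k) / sin (am u k) ^ 2) ^ 2 = (ds u k ^ 2 + k ^ 2) * (ds u k ^ 2 - (1 - k ^ 2)).
Proof.
  intros Hk Hu. assert (HM := sqr_01 k Hk).
  assert (Hs := sn_pos u k Hk Hu). assert (Hd := dl_pos (k ^ 2) (am u k) HM).
  assert (Hd2 := dl_sq (k ^ 2) (am u k) HM).
  split.
  - apply is_derive_ext with (fun u => / sd u k); [intros t; symmetry; apply ds_inv_sd|].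
    evar_last; [apply is_derive_inv; [apply is_derive_sd, Hk|]|].
    + unfold sd. apply Rgt_not_eq, Rdiv_lt_0_compat; assumption.
    + unfold sd', sd. field. split; lra.
  - rewrite ds_inv_sd. unfold sd.
    set (s := sin (am u k)) in *. set (c := cos (am u k)) in *. set (d := dl (k ^ 2) (am u k)) in *.
    assert (Hc : c ^ 2 = 1 - s ^ 2) by apply cos2_sin2.
    transitivity (c ^ 2 / s ^ 4); [field; lra|].
    transitivity ((d ^ 2 + k ^ 2 * s ^ 2) * (d ^ 2 - (1 - k ^ 2) * s ^ 2) / s ^ 4); [|field; lra].
    rewrite Hc, Hd2. field. lra.
Qed.

Lemma ellF_PI2_lt (M N : R) : 0 < M -> M < N -> N < 1 -> ellF M (PI / 2) < ellF N (PI / 2).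
Proof.
  intros HM HMN HN. assert (HP := PI_RGT_0).
  assert (Hc : forall M t, 0 < M < 1 -> continuous (fun t => 1 / sqrt (1 - M * sin t ^ 2)) t).
  { intros L t HL. apply (continuous_of_derive (fun t => 1 / dl L t) t (L * sin t * cos t / dl L t ^ 3)).
    evar_last; [apply is_derive_div; [apply (is_derive_const (V := R_NormedModule))|apply is_derive_dl, HL|apply Rgt_not_eq, dl_pos, HL]|].
    unfold zero; simpl; field. apply Rgt_not_eq, dl_pos, HL. }
  apply RInt_lt; [lra| | |].
  - intros t _; apply Hc; lra.
  - intros t _; apply Hc; lra.
  - intros t Ht. assert (Hs : 0 < sin t) by (apply sin_gt_0; lra).
    assert (Hs2 : 0 < sin t ^ 2) by (apply pow_lt, Hs).
    assert (D := dl_pos N t ltac:(lra)).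
    apply Rmult_lt_compat_l; [lra|]. apply Rinv_lt_contravar.
    + apply Rmult_lt_0_compat; [apply D|apply (dl_pos M t); lra].
    + apply sqrt_lt_1_alt. split; [apply Rlt_le, dl_arg_pos; lra|]. nra.
Qed.

Lemma ellK'_conj (k : R) : 0 < k < 1 -> ellK' k = ellK (sqrt (1 - k ^ 2)).
Proof. intros Hk. unfold ellK', ellK. rewrite pow2_sqrt; [reflexivity|nra]. Qed.

Lemma conj_01 (k : R) : 0 < k < 1 -> 0 < sqrt (1 - k ^ 2) < 1.
Proof.
  intros Hk. split; [apply sqrt_lt_R0; nra|]. rewrite <- sqrt_1 at 2. apply sqrt_lt_1_alt; nra.
Qed.

Lemma ratio_lt (k l : R) : 0 < k -> k < l -> l < 1 -> ellK' l / ellK l < ellK' k / ellK k.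
Proof.
  intros Hk Hkl Hl. assert (HP := PI_RGT_0).
  assert (H1 : ellK k < ellK l) by (apply ellF_PI2_lt; nra).
  assert (H2 : ellK' l < ellK' k) by (apply ellF_PI2_lt; nra).
  assert (P1 := ellK_pos k ltac:(lra)).
  assert (P2 := ellK_pos _ (conj_01 l ltac:(lra))). rewrite <- ellK'_conj in P2 by lra.
  apply Rlt_trans with (ellK' l / ellK k).
  - apply Rmult_lt_compat_l; [lra|]. apply Rinv_lt_contravar; nra.
  - apply Rmult_lt_compat_r; [apply Rinv_0_lt_compat; lra|exact H2].
Qed.

Lemma ratio_inj (k l : R) : 0 < k < 1 -> 0 < l < 1 -> ellK' l / ellK l = ellK' k / ellK k -> k = l.
Proof.
  intros Hk Hl E. destruct (Rtotal_order k l) as [H|[H|H]]; [|exact H|].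
  - assert (X := ratio_lt k l ltac:(lra) H ltac:(lra)); lra.
  - assert (X := ratio_lt l k ltac:(lra) H ltac:(lra)); lra.
Qed.

(** * Identification of the modulus and of the periods *)

Definition zz (y : R) : R := sqrt (al y ^ 2 + bb y).
Definition kk (y : R) : R := al y / zz y.

Lemma zz_sq (y : R) : 0 < y -> zz y ^ 2 = al y ^ 2 + bb y.
Proof. intros Hy. apply pow2_sqrt. pose proof (bb_pos y Hy). pose proof (pow2_ge_0 (al y)). lra. Qed.

Lemma zz_pos (y : R) : 0 < y -> 0 < zz y.
Proof. intros Hy. apply sqrt_lt_R0. pose proof (bb_pos y Hy). pose proof (pow2_ge_0 (al y)). lra. Qed.

Lemma kk_zz (y : R) : 0 < y -> kk y * zz y = al y.
Proof. intros Hy. unfold kk. pose proof (zz_pos y Hy). field; lra. Qed.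

Lemma kk_01 (y : R) : 0 < y -> 0 < kk y < 1.
Proof.
  intros Hy. assert (Hz := zz_pos y Hy). assert (Ha := al_pos y Hy). assert (Hb := bb_pos y Hy).
  assert (H2 := zz_sq y Hy). assert (Hk := kk_zz y Hy). split; [apply Rdiv_lt_0_compat; assumption|].
  assert (al y < zz y) by nra. apply Rmult_lt_reg_r with (zz y); [exact Hz|lra].
Qed.

Lemma is_derive_scaled (f : R -> R) (A c e t l : R) : is_derive f (e + c * t) l ->
  is_derive (fun t => A * f (e + c * t)) t (A * c * l).
Proof.
  intros Hf. evar_last.
  - apply (is_derive_scal (fun t => f (e + c * t))), (is_derive_comp (V := R_NormedModule) f (fun t => e + c * t)); [exact Hf|].
    apply (is_derive_plus (V := R_NormedModule)); [apply is_derive_const|].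
    apply (is_derive_scal (fun t => t)), is_derive_id.
  - unfold scal, plus, zero, one; simpl; unfold mult; simpl; ring.
Qed.

Lemma Cs_cn (y t : R) : 0 < y -> 0 <= t -> Cs y 0 t = al y * cos (am (0 + zz y * t) (kk y)).
Proof.
  intros Hy Ht. assert (Hk := kk_01 y Hy). assert (Ha := al_pos y Hy). assert (Hz := zz_pos y Hy).
  assert (Hk2 : kk y ^ 2 * (al y ^ 2 + bb y) = al y ^ 2).
  { rewrite <- zz_sq by exact Hy. rewrite <- Rpow_mult_distr, kk_zz by exact Hy; reflexivity. }
  set (k := kk y) in *. set (z := zz y) in *.
  assert (Hz2 : z ^ 2 = al y ^ 2 + bb y) by (apply zz_sq, Hy).
  apply (cubic_ode_unique (2 * kap y) (- 2) (al y) t (Cs y 0) (fun t => - Ss y 1 t)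
    (fun t => al y * cos (am (0 + z * t) k))
    (fun t => al y * z * (- (sin (am (0 + z * t) k) * dl (k ^ 2) (am (0 + z * t) k))))); try lra.
  - intros s _; apply is_derive_Cs, Hy.
  - intros s _; apply is_derive_Ss_cube, Hy.
  - intros s _. apply (is_derive_scaled (fun u => cos (am u k))), is_derive_cn, Hk.
  - intros s _. evar_last; [apply (is_derive_scaled (fun u => - (sin (am u k) * dl (k ^ 2) (am u k)))), is_derive_cn2, Hk|].
    set (c := cos (am (0 + z * s) k)). unfold bb in *.
    transitivity (al y * (2 * (k ^ 2 * z ^ 2) - z ^ 2) * c - 2 * al y * (k ^ 2 * z ^ 2) * c ^ 3); [ring|].
    rewrite Hz2, Hk2. ring.
  - intros s _; apply Cs_bound, Hy.
  - intros s _. rewrite Rabs_mult, (Rabs_pos_eq (al y)) by lra.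
    rewrite <- (Rmult_1_r (al y)) at 2. apply Rmult_le_compat_l; [lra|]. apply Rabs_le, COS_bound.
  - rewrite Cs_0, Rmult_0_r, Rplus_0_r, am_0, cos_0 by exact Hk; ring.
  - rewrite Ss_0, Rmult_0_r, Rplus_0_r, am_0, sin_0 by exact Hk; ring.
Qed.

Lemma cos_eq_m1_ge_PI (t : R) : 0 < t -> cos t = -1 -> PI <= t.
Proof.
  intros Ht E. destruct (Rle_lt_dec PI t) as [H|H]; [exact H|].
  assert (X := cos_decreasing_1 t PI). rewrite cos_PI, E in X. lra.
Qed.

(** Two inequalities from first minima. At [2 K / z] the series takes the value [- al], so this
    point is at least [PI]; at [PI] the cosine of the amplitude is -1, so the amplitude has reached
    at least [PI]. *)
Lemma zz_K (y : R) : 0 < y -> zz y * PI = 2 * ellK (kk y).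
Proof.
  intros Hy. assert (Hk := kk_01 y Hy). assert (Ha := al_pos y Hy). assert (Hz := zz_pos y Hy).
  assert (HP := PI_RGT_0). assert (HK := ellK_pos _ Hk).
  apply Rle_antisym.
  - assert (Ht : 0 < 2 * ellK (kk y) / zz y) by (apply Rdiv_lt_0_compat; lra).
    assert (E := Cs_cn y _ Hy (Rlt_le _ _ Ht)).
    replace (0 + zz y * (2 * ellK (kk y) / zz y)) with (2 * ellK (kk y)) in E by (field; lra).
    rewrite am_2K, cos_PI in E by exact Hk.
    assert (E1 : Cs y 0 (2 * ellK (kk y) / zz y) = - al y) by lra.
    assert (E2 := cos_eq_m1_ge_PI _ Ht (Cs_min y _ Hy E1)).
    apply (Rmult_le_compat_l (zz y)) in E2; [|lra].
    replace (zz y * (2 * ellK (kk y) / zz y)) with (2 * ellK (kk y)) in E2 by (field; lra). exact E2.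
  - assert (E := Cs_cn y PI Hy ltac:(lra)). rewrite Cs_PI, Rplus_0_l in E.
    assert (E1 : cos (am (zz y * PI) (kk y)) = -1) by (apply Rmult_eq_reg_l with (al y); [rewrite <- E; ring|lra]).
    assert (Hpos : 0 < am (zz y * PI) (kk y)).
    { rewrite <- (am_0 (kk y) Hk). apply am_lt; [exact Hk|apply Rmult_lt_0_compat; lra]. }
    assert (E2 := cos_eq_m1_ge_PI _ Hpos E1).
    rewrite <- (ellF_am (zz y * PI) (kk y) Hk).
    unfold ellK; rewrite <- ellF_PI by (apply sqr_01, Hk).
    assert (X := ellF_incr (kk y ^ 2) _ _ (sqr_01 _ Hk) E2). lra.
Qed.

Lemma dl_ge (M t : R) : 0 < M < 1 -> sqrt (1 - M) <= dl M t.
Proof. intros HM. apply sqrt_le_1_alt. pose proof (sin2_le_1 t); nra. Qed.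

Lemma sd_bound (u k : R) : 0 < k < 1 -> Rabs (sd u k) <= / sqrt (1 - k ^ 2).
Proof.
  intros Hk. assert (HM := sqr_01 k Hk). assert (Hs := conj_01 k Hk).
  unfold sd, Rdiv. rewrite Rabs_mult, Rabs_inv, (Rabs_pos_eq (dl _ _)) by (apply Rlt_le, dl_pos, HM).
  rewrite <- (Rmult_1_l (/ sqrt (1 - k ^ 2))).
  apply Rmult_le_compat; [apply Rabs_pos|apply Rlt_le, Rinv_0_lt_compat, dl_pos, HM|apply Rabs_le, SIN_bound|].
  apply Rinv_le_contravar; [lra|apply dl_ge, HM].
Qed.

Definition kc (y : R) : R := sqrt (1 - kk y ^ 2).

(** Both sides start at a maximum: [Hs] is minimal at 0, and [sd] is maximal at the quarter period
    [K], where it equals the reciprocal of the complementary modulus. Since the modulus here is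
    [kc], that value is [/ kk], and dividing by [zz] gives [/ al], which also serves as the common
    bound. *)
Lemma Hs_sd (y t : R) : 0 < y -> 0 <= t < y / 2 ->
  / Hs y 0 t = / zz y * sd (ellK (kc y) + - zz y * t) (kc y).
Proof.
  intros Hy Ht. assert (Hk := kk_01 y Hy). assert (Ha := al_pos y Hy). assert (Hz := zz_pos y Hy).
  assert (Hb := bb_pos y Hy).
  assert (Hkz := kk_zz y Hy).
  assert (Hk2 : kk y ^ 2 * (al y ^ 2 + bb y) = al y ^ 2).
  { rewrite <- zz_sq by exact Hy. rewrite <- Rpow_mult_distr, kk_zz by exact Hy; reflexivity. }
  assert (Hc := conj_01 _ Hk). assert (Hc2 : kc y ^ 2 = 1 - kk y ^ 2) by (apply pow2_sqrt; nra).
  fold (kc y) in Hc.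
  assert (Hcc : sqrt (1 - kc y ^ 2) = kk y).
  { rewrite Hc2. replace (1 - (1 - kk y ^ 2)) with (kk y ^ 2) by ring. apply sqrt_pow2; lra. }
  set (k := kk y) in *. set (z := zz y) in *. set (c := kc y) in *.
  assert (Hz2 : z ^ 2 = al y ^ 2 + bb y) by (apply zz_sq, Hy).
  assert (Hin : forall s, 0 <= s <= t -> Rabs s < y / 2) by (intros s Hs'; rewrite Rabs_pos_eq; lra).
  assert (HHs : forall s, 0 <= s <= t -> 0 < Hs y 0 s).
  { intros s Hs'. pose proof (Hs_ge y s Hy (Hin s Hs')); lra. }
  apply (cubic_ode_unique (bb y - al y ^ 2) (- 2 * al y ^ 2 * bb y) (/ al y) t (fun t => / Hs y 0 t)
    (fun t => - Hs y 1 t / Hs y 0 t ^ 2)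
    (fun t => / z * sd (ellK c + - z * t) c)
    (fun t => / z * - z * sd' (ellK c + - z * t) c)); try lra.
  - intros s Hs'. apply is_derive_inv; [apply is_derive_Hs; [exact Hy|apply Hin, Hs']|apply Rgt_not_eq, HHs, Hs'].
  - intros s Hs'. assert (P := HHs s Hs').
    assert (FI := Hs_first_integral y s Hy (Hin s Hs')).
    evar_last.
    + apply (is_derive_div (fun t => - Hs y 1 t) (fun t => Hs y 0 t ^ 2)).
      * apply (is_derive_opp (V := R_NormedModule)), is_derive_Hs; [exact Hy|apply Hin, Hs'].
      * apply is_derive_pow, is_derive_Hs; [exact Hy|apply Hin, Hs'].
      * apply Rgt_not_eq, pow_lt, P.
    + unfold opp; simpl opp. cbn [INR pred]. rewrite (Hs_cube y s Hy (Hin s Hs')). unfold bb in *.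
      set (h := Hs y 0 s) in *. set (h1 := Hs y 1 s) in *. simpl.
      transitivity ((2 * h1 ^ 2 - h * (2 * h ^ 3 - 2 * kap y * h)) / h ^ 3); [field; lra|].
      rewrite FI. field. lra.
  - intros s _. apply (is_derive_scaled (fun u => sd u c)), is_derive_sd, Hc.
  - intros s _. evar_last; [apply (is_derive_scaled (fun u => sd' u c)), is_derive_sd', Hc|].
    set (q := sd (ellK c + - z * s) c). rewrite Hc2.
    (* Arranged so that, apart from the solution [/ z * q], only [z ^ 2] and [k ^ 2 * z ^ 2] occur;
       both are known in terms of [al] and [bb]. *)
    transitivity (/ z * q * (z ^ 2 - 2 * (k ^ 2 * z ^ 2)) - 2 * (/ z * q) ^ 3 * ((z ^ 2 - k ^ 2 * z ^ 2) * (k ^ 2 * z ^ 2)));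
      [field; lra|].
    rewrite Hz2, Hk2. ring.
  - intros s Hs'. rewrite Rabs_pos_eq by (apply Rlt_le, Rinv_0_lt_compat, HHs, Hs').
    apply Rinv_le_contravar; [exact Ha|apply Hs_ge; [exact Hy|apply Hin, Hs']].
  - intros s _. rewrite Rabs_mult, (Rabs_pos_eq (/ z)) by (apply Rlt_le, Rinv_0_lt_compat, Hz).
    rewrite <- Hkz, Rinv_mult, (Rmult_comm (/ k)).
    apply Rmult_le_compat_l; [apply Rlt_le, Rinv_0_lt_compat, Hz|]. rewrite <- Hcc. apply sd_bound, Hc.
  - rewrite Hs_0, Rmult_0_r, Rplus_0_r. unfold sd. rewrite am_K, sin_PI2 by exact Hc.
    unfold dl. rewrite sin_PI2, pow1, Rmult_1_r, Hcc, <- Hkz. field; lra.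
  - rewrite Hs_1_0, Rmult_0_r, Rplus_0_r. unfold sd'. rewrite am_K, cos_PI2 by exact Hc.
    unfold Rdiv; ring.
Qed.

(** [e] measures the offset between the zero of [sd] and the pole of [Hs]. If [e < 0], then [sd]
    would vanish at a point where [/ Hs] is still positive. If [e > 0], then [sd] would stay away
    from 0 near [v = 0], whereas the Lambert series bounds it by [z * sinh v]. *)
Lemma zz_K' (y : R) : 0 < y -> zz y * (y / 2) = ellK (kc y).
Proof.
  intros Hy. assert (Hk := kk_01 y Hy). assert (Ha := al_pos y Hy). assert (Hz := zz_pos y Hy).
  assert (Hc := conj_01 _ Hk). fold (kc y) in Hc. assert (HK := ellK_pos _ Hc). assert (HP := PI_RGT_0).
  set (z := zz y) in *. set (c := kc y) in *. set (e := ellK c - z * (y / 2)).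
  assert (H : forall v, 0 < v <= y / 2 -> 0 < sd (e + z * v) c <= z * sinh v).
  { intros v Hv. assert (E := Hs_sd y (y / 2 - v) Hy ltac:(lra)). fold z c in E.
    replace (ellK c + - z * (y / 2 - v)) with (e + z * v) in E by (unfold e; ring).
    assert (P : 0 < Hs y 0 (y / 2 - v)).
    { apply Rlt_le_trans with (1 := Ha), Hs_ge; [exact Hy|apply Rabs_def1; lra]. }
    assert (Q := Hs_ge_inv_sinh y v ltac:(lra)).
    assert (S := sinh_pos v (proj1 Hv)).
    replace (sd (e + z * v) c) with (z * / Hs y 0 (y / 2 - v)) by (rewrite E; field; lra).
    split; [apply Rmult_lt_0_compat; [exact Hz|apply Rinv_0_lt_compat, P]|].
    apply Rmult_le_compat_l; [lra|]. rewrite <- (Rinv_inv (sinh v)).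
    apply Rinv_le_contravar; [apply Rinv_0_lt_compat, S|exact Q]. }
  destruct (Rtotal_order e 0) as [He|[He|He]]; [exfalso| |exfalso].
  - assert (Hv : 0 < - e / z <= y / 2).
    { split; [apply Rdiv_lt_0_compat; lra|]. apply Rmult_le_reg_r with z; [exact Hz|].
      replace (- e / z * z) with (- e) by (field; lra). unfold e; lra. }
    destruct (H _ Hv) as [X _]. replace (e + z * (- e / z)) with 0 in X by (field; lra).
    unfold sd in X. rewrite am_0, sin_0 in X by exact Hc. unfold Rdiv in X; lra.
  - unfold e in He; lra.
  - set (s0 := sin (am e c)).
    assert (Hs0 : 0 < s0) by (apply sn_pos; [exact Hc|unfold e in *; nra]).
    (* Chosen so that [z * sinh v0] is half of [s0], while monotonicity keeps [sd] at least [s0]. *)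
    set (v0 := arcsinh (s0 / (2 * z))). assert (Ev0 : sinh v0 = s0 / (2 * z)) by apply sinh_arcsinh.
    assert (Hq : 0 < s0 / (2 * z)) by (apply Rdiv_lt_0_compat; lra).
    assert (Hv0 : 0 < v0).
    { destruct (Rlt_le_dec 0 v0) as [X|[X|X]]; [exact X| |].
      - assert (Y := sinh_lt _ _ X). rewrite sinh_0 in Y; lra.
      - rewrite X, sinh_0 in Ev0; lra. }
    set (v := Rmin v0 (y / 2)). assert (Hv : 0 < v <= y / 2).
    { split; [apply Rmin_pos; lra|apply Rmin_r]. }
    destruct (H v Hv) as [_ X].
    assert (Y : sinh v <= s0 / (2 * z)).
    { rewrite <- Ev0. destruct (Rmin_l v0 (y / 2)) as [Z|Z]; [left; apply sinh_lt, Z|right; f_equal; exact Z]. }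
    assert (Y2 : z * sinh v <= s0 / 2).
    { apply (Rmult_le_compat_l z) in Y; [|lra]. replace (z * (s0 / (2 * z))) with (s0 / 2) in Y by (field; lra). exact Y. }
    assert (Hle : e + z * v <= ellK c) by (unfold e; nra).
    assert (A1 : am e c <= am (e + z * v) c) by (apply am_le; [exact Hc|nra]).
    assert (A2 : am (e + z * v) c <= PI / 2) by (rewrite <- (am_K c Hc); apply am_le; assumption).
    assert (A0 : 0 <= am e c) by (rewrite <- (am_0 c Hc); apply am_le; [exact Hc|lra]).
    assert (S1 : s0 <= sin (am (e + z * v) c)) by (apply sin_incr_1; lra).
    assert (S2 : s0 <= sd (e + z * v) c).
    { unfold sd. assert (D := inv_dl_ge_1 (c ^ 2) (am (e + z * v) c) (sqr_01 c Hc)). unfold Rdiv. nra. }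
    lra.
Qed.

Lemma Hs_ds (y v : R) : 0 < y -> 0 < v <= y / 2 -> Hs y 0 (y / 2 - v) = zz y * ds (zz y * v) (kc y).
Proof.
  intros Hy Hv. assert (E := Hs_sd y (y / 2 - v) Hy ltac:(lra)).
  rewrite <- zz_K' in E by exact Hy.
  replace (zz y * (y / 2) + - zz y * (y / 2 - v)) with (zz y * v) in E by ring.
  rewrite ds_inv_sd, <- (Rinv_inv (Hs y 0 (y / 2 - v))), E, Rinv_mult, Rinv_inv. reflexivity.
Qed.

Lemma par_y_pos (k : R) : 0 < k < 1 -> 0 < par_y k.
Proof.
  intros Hk. assert (HP := PI_RGT_0). unfold par_y. rewrite ellK'_conj by exact Hk.
  pose proof (ellK_pos k Hk). pose proof (ellK_pos _ (conj_01 k Hk)).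
  apply Rdiv_lt_0_compat; [apply Rmult_lt_0_compat|]; lra.
Qed.

Lemma kk_par_y (k : R) : 0 < k < 1 -> kk (par_y k) = k.
Proof.
  intros Hk. assert (Hy := par_y_pos k Hk). assert (HP := PI_RGT_0).
  assert (Hk' := kk_01 _ Hy). assert (Hz := zz_pos _ Hy).
  assert (E1 := zz_K _ Hy). assert (E2 := zz_K' _ Hy).
  symmetry; apply ratio_inj; [exact Hk|exact Hk'|].
  rewrite (ellK'_conj (kk _)) by exact Hk'. fold (kc (par_y k)). rewrite <- E2.
  replace (ellK (kk (par_y k))) with (zz (par_y k) * PI / 2) by (rewrite E1; field).
  transitivity (par_y k / PI).
  - field. split; lra.
  - unfold par_y. field. split; [|lra]. pose proof (ellK_pos k Hk); lra.
Qed.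

Lemma zz_par_y (k : R) : 0 < k < 1 -> zz (par_y k) = par_z k.
Proof.
  intros Hk. assert (E1 := zz_K _ (par_y_pos k Hk)). rewrite kk_par_y in E1 by exact Hk.
  assert (HP := PI_RGT_0). unfold par_z. apply Rmult_eq_reg_r with PI; [|lra]. rewrite E1. field; lra.
Qed.

Lemma par_z_pos (k : R) : 0 < k < 1 -> 0 < par_z k.
Proof. intros Hk; rewrite <- zz_par_y by exact Hk; apply zz_pos, par_y_pos, Hk. Qed.

Lemma ds_lambert (k v : R) : 0 < k < 1 -> 0 < v <= par_y k / 2 ->
  is_series (fun n => 4 * (sinh ((2 * INR n + 1) * v) / (exp ((2 * INR n + 1) * par_y k) + 1)))
    (par_z k * ds (par_z k * v) (sqrt (1 - k ^ 2)) - / sinh v).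
Proof.
  intros Hk Hv. assert (Hy := par_y_pos k Hk).
  assert (H := Hs_lambert (par_y k) v ltac:(lra)).
  rewrite Hs_ds in H by assumption. unfold kc in H. rewrite kk_par_y, zz_par_y in H by exact Hk. exact H.
Qed.

(** * Power series *)

Lemma CV_radius_ge (a : nat -> R) (x l : R) : is_pseries a x l -> Rbar_le (Rabs x) (CV_radius a).
Proof.
  intros H. apply is_pseries_R in H. apply Rbar_not_lt_le; intros Hlt.
  apply (CV_disk_outside a x Hlt). apply ex_series_lim_0. eexists; exact H.
Qed.

(** Products and derivatives of power series require strict inclusion in the disk of convergence;
    the midpoint of [Rabs x] and [e] provides the margin. *)
Lemma CV_radius_gt (a : nat -> R) (x e : R) (f : R -> R) : Rabs x < e ->
  (forall t, 0 < t < e -> is_pseries a t (f t)) -> Rbar_lt (Rabs x) (CV_radius a).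
Proof.
  intros Hx H. pose proof (Rabs_pos x).
  apply Rbar_lt_le_trans with (Rabs ((Rabs x + e) / 2)); [simpl; rewrite (Rabs_pos_eq ((Rabs x + e) / 2)); lra|].
  apply CV_radius_ge with (f ((Rabs x + e) / 2)), H. lra.
Qed.

(** Uniqueness of coefficients is needed from positive arguments only, because the variable will be
    [t = u ^ 2]. Continuity of the sum at 0 gives the constant coefficient; division by [t] then
    reaches the others. *)
Lemma pseries_zero_right_0 (a : nat -> R) (e : R) : 0 < e ->
  (forall t, 0 < t < e -> is_pseries a t 0) -> a 0%nat = 0.
Proof.
  intros He H.
  assert (HC := PSeries_continuity a 0 (CV_radius_gt a 0 e (fun _ => 0) ltac:(rewrite Rabs_R0; lra) H)).
  destruct (Req_dec (a 0%nat) 0) as [E|E]; [exact E|exfalso].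
  destruct (HC (Rabs (a 0%nat)) (Rabs_pos_lt _ E)) as [d [Hd Hc]].
  set (t := Rmin d e / 2). assert (Hm : 0 < Rmin d e) by (apply Rmin_pos; assumption).
  pose proof (Rmin_l d e). pose proof (Rmin_r d e).
  specialize (Hc t). rewrite PSeries_0, (is_pseries_unique a t 0) in Hc by (apply H; unfold t; lra).
  unfold dist in Hc. simpl in Hc. unfold Rdist in Hc.
  rewrite Rminus_0_l, Rabs_Ropp in Hc. apply (Rlt_irrefl (Rabs (a 0%nat))), Hc.
  split; [split; [exact I|unfold t; lra]|]. rewrite Rminus_0_r, Rabs_pos_eq; unfold t; lra.
Qed.

Lemma pseries_zero_right (n : nat) : forall (a : nat -> R) (e : R), 0 < e ->
  (forall t, 0 < t < e -> is_pseries a t 0) -> a n = 0.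
Proof.
  induction n as [|n IH]; intros a e He H; assert (H0 := pseries_zero_right_0 a e He H); [exact H0|].
  apply (IH (PS_decr_1 a) e He). intros t Ht.
  evar_last; [apply (is_pseries_decr_1 a t (/ t) 0); [apply Rinv_l; lra|apply H, Ht]|].
  rewrite H0. unfold scal, plus, opp; simpl; unfold mult; simpl; ring.
Qed.

Lemma pseries_unique_right (a b : nat -> R) (f : R -> R) (e : R) : 0 < e ->
  (forall t, 0 < t < e -> is_pseries a t (f t)) -> (forall t, 0 < t < e -> is_pseries b t (f t)) ->
  forall n, a n = b n.
Proof.
  intros He Ha Hb n.
  assert (H : PS_minus a b n = 0).
  { apply (pseries_zero_right n (PS_minus a b) e He). intros t Ht.
    evar_last; [apply (is_pseries_minus a b t); [apply Ha, Ht|apply Hb, Ht]|].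
    unfold plus, opp; simpl; ring. }
  unfold PS_minus, PS_plus, PS_opp, plus, opp in H; simpl in H. lra.
Qed.

Lemma is_series_even (f : nat -> R) (l : R) : (forall m, f (2 * m + 1)%nat = 0) ->
  is_series f l -> is_series (fun m => f (2 * m)%nat) l.
Proof.
  intros H0 H.
  apply (is_lim_seq_ext (fun M => sum_n f (2 * M)) (sum_n (fun m => f (2 * m)%nat)) l).
  - intros M; induction M as [|M IH]; [rewrite !sum_O; reflexivity|].
    rewrite sum_Sn, <- IH. replace (2 * S M)%nat with (S (S (2 * M))) by lia.
    rewrite !sum_Sn. replace (S (2 * M)) with (2 * M + 1)%nat by lia. rewrite H0.
    unfold plus; simpl; ring.
  - apply (is_lim_seq_subseq (sum_n f) l (fun M => (2 * M)%nat)); [|exact H].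
    apply eventually_subseq; intros; lia.
Qed.

Lemma is_series_odd (f : nat -> R) (l : R) : (forall m, f (2 * m)%nat = 0) ->
  is_series f l -> is_series (fun m => f (2 * m + 1)%nat) l.
Proof.
  intros H0 H.
  apply (is_lim_seq_ext (fun M => sum_n f (2 * M + 1)) (sum_n (fun m => f (2 * m + 1)%nat)) l).
  - intros M; induction M as [|M IH].
    + change (2 * 0 + 1)%nat with 1%nat. rewrite sum_Sn, !sum_O.
      rewrite (H0 0%nat : f 0%nat = 0). unfold plus; simpl; ring.
    + rewrite sum_Sn, <- IH. replace (2 * S M + 1)%nat with (S (S (2 * M + 1))) by lia.
      rewrite !sum_Sn. replace (S (2 * M + 1)) with (2 * S M)%nat by lia. rewrite H0.
      unfold plus; simpl; ring.
  - apply (is_lim_seq_subseq (sum_n f) l (fun M => (2 * M + 1)%nat)); [|exact H].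
    apply eventually_subseq; intros; lia.
Qed.

Lemma is_series_sinh (w : R) :
  is_series (fun m => w ^ (2 * m + 1) / INR (fact (2 * m + 1))) (sinh w).
Proof.
  assert (H1 := proj1 (is_pseries_R _ _ _) (is_exp_Reals w)).
  assert (H2 := proj1 (is_pseries_R _ _ _) (is_exp_Reals (- w))).
  assert (H3 := is_series_scal_r (/ 2) _ _ (is_series_minus (V := R_NormedModule) _ _ _ _ H1 H2)).
  assert (Hsign : forall n, (- w) ^ n = (- 1) ^ n * w ^ n).
  { intros n; rewrite <- Rpow_mult_distr; f_equal; ring. }
  apply is_series_odd in H3.
  - apply is_series_ext with (2 := H3). intros m. req. unfold minus, plus, opp; simpl plus; simpl opp.
    rewrite Hsign, (pow_add (-1)), (pow_mult (-1)). replace ((-1) ^ 2) with 1 by ring. rewrite pow1.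
    cbn -[INR fact Nat.mul pow]. field. apply INR_fact_neq_0.
  - intros m. unfold minus, plus, opp; cbn -[INR fact Nat.mul pow].
    rewrite Hsign, (pow_mult (-1)). replace ((-1) ^ 2) with 1 by ring. rewrite pow1. ring.
Qed.

Fixpoint rec_iter (F : nat -> (nat -> R) -> R) (m : nat) : nat -> R :=
  match m with
  | O => fun _ => 0
  | S m' => fun n => if Nat.eq_dec n m' then F m' (rec_iter F m') else rec_iter F m' n
  end.

(** Course-of-values recursion: [rec_iter F m] tabulates the first [m] values, and the hypothesis
    says that [F n] only reads entries below [n]. *)
Lemma exists_rec_seq (F : nat -> (nat -> R) -> R) :
  (forall n g h, (forall i, (i < n)%nat -> g i = h i) -> F n g = F n h) ->
  exists b : nat -> R, forall n, b n = F n b.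
Proof.
  intros HF. set (b := fun n => rec_iter F (S n) n).
  assert (Hst : forall m n, (n < m)%nat -> rec_iter F m n = b n).
  { induction m as [|m IH]; intros n Hn; [lia|]. simpl.
    destruct (Nat.eq_dec n m) as [->|Hne].
    - unfold b; simpl. destruct (Nat.eq_dec m m); [reflexivity|lia].
    - apply IH; lia. }
  exists b. intros n. unfold b at 1; simpl. destruct (Nat.eq_dec n n); [|lia].
  apply HF. intros i Hi; apply Hst, Hi.
Qed.

(** Unlike [sum_f_R0], this allows the empty sum, as the recursions need at their first step. *)
Definition sumlt (f : nat -> R) (n : nat) : R :=
  match n with O => 0 | S m => sum_f_R0 f m end.

Lemma sumlt_S (f : nat -> R) (n : nat) : sumlt f (S n) = sumlt f n + f n.
Proof. destruct n; simpl; ring. Qed.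

Lemma sumlt_ext (f g : nat -> R) (n : nat) :
  (forall i, (i < n)%nat -> f i = g i) -> sumlt f n = sumlt g n.
Proof.
  induction n as [|n IH]; intros H; [reflexivity|].
  rewrite !sumlt_S, IH, H; [reflexivity|lia|intros; apply H; lia].
Qed.

Lemma sum_f_R0_ends (f : nat -> R) (n : nat) :
  sum_f_R0 f (S n) = f 0%nat + sumlt (fun i => f (S i)) n + f (S n).
Proof.
  induction n as [|n IH]; [simpl; ring|].
  rewrite sumlt_S, tech5, IH; ring.
Qed.

(** * Bernoulli numbers and the hyperbolic cosecant *)

Lemma fact_ge_pow2 (n : nat) : 2 ^ n <= INR (fact (S n)).
Proof.
  induction n as [|n IH]; [simpl; lra|].
  change (fact (S (S n))) with ((S (S n)) * fact (S n))%nat. rewrite mult_INR.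
  assert (2 <= INR (S (S n))) by (rewrite !S_INR; pose proof (pos_INR n); lra).
  simpl pow. pose proof (pow_lt 2 n ltac:(lra)). nra.
Qed.

(** [b n] will be [B_n / n!]; the recursion says that its series times that of [(exp t - 1) / t] is
    1. The uniform bound, which yields convergence for [|t| < 1], follows by strong induction from
    [(i + 1)! >= 2 ^ i]. *)
Lemma bernoulli_seq : exists b : nat -> R,
  (forall n, b n = (match n with O => 1 | _ => 0 end) - sumlt (fun i => b i / INR (fact (S (n - i)))) n) /\
  (forall n, Rabs (b n) <= 1).
Proof.
  destruct (exists_rec_seq (fun n b => (match n with O => 1 | _ => 0 end)
    - sumlt (fun i => b i / INR (fact (S (n - i)))) n)) as [b Hb].
  { intros n g h H. f_equal. apply sumlt_ext. intros i Hi. rewrite H; [reflexivity|exact Hi]. }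
  exists b. split; [exact Hb|].
  assert (HI : forall m n, (n < m)%nat -> Rabs (b n) <= 1).
  { induction m as [|m IH]; intros n Hn; [lia|].
    rewrite Hb. destruct n as [|n]; [simpl; rewrite Rminus_0_r, Rabs_R1; lra|].
    rewrite Rminus_0_l, Rabs_Ropp.
    (* The right side is the exact value of the dominating geometric sum, so the induction on [j]
       closes; at [j = S n] it is below 1. *)
    assert (G : forall j, (j <= S n)%nat ->
      Rabs (sumlt (fun i => b i / INR (fact (S (S n - i)))) j) <= (/ 2) ^ (S n - j) - (/ 2) ^ (S n)).
    { induction j as [|j IHj]; intros Hj.
      - simpl sumlt. rewrite Rabs_R0, Nat.sub_0_r; lra.
      - rewrite sumlt_S. eapply Rle_trans; [apply Rabs_triang|].
        specialize (IHj ltac:(lia)).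
        assert (X : Rabs (b j / INR (fact (S (S n - j)))) <= (/ 2) ^ (S n - j)).
        { unfold Rdiv; rewrite Rabs_mult, <- (Rmult_1_l ((/ 2) ^ _)).
          apply Rmult_le_compat; [apply Rabs_pos|apply Rabs_pos|apply IH; lia|].
          rewrite Rabs_inv, Rabs_pos_eq by apply pos_INR. rewrite pow_inv.
          apply Rinv_le_contravar; [apply pow_lt; lra|apply fact_ge_pow2]. }
        replace (S n - j)%nat with (S (S n - S j)) in * by lia. simpl pow in *. lra. }
    specialize (G (S n) (le_n _)). rewrite Nat.sub_diag in G. simpl pow in G.
    pose proof (pow_lt (/ 2) n ltac:(lra)). simpl pow. lra. }
  intros n; apply (HI (S n)); lia.
Qed.

Lemma is_pseries_exp_1 (t : R) : t <> 0 ->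
  is_pseries (fun n => / INR (fact (S n))) t ((exp t - 1) / t).
Proof.
  intros Ht. evar_last; [apply (is_pseries_decr_1 (fun n => / INR (fact n)) t (/ t) (exp t)); [apply Rinv_l, Ht|apply is_exp_Reals]|].
  unfold scal, plus, opp; simpl; unfold mult; simpl. field. exact Ht.
Qed.

Lemma is_pseries_bernoulli (b : nat -> R) (t : R) :
  (forall n, b n = (match n with O => 1 | _ => 0 end) - sumlt (fun i => b i / INR (fact (S (n - i)))) n) ->
  (forall n, Rabs (b n) <= 1) -> t <> 0 -> Rabs t < 1 ->
  is_pseries b t (t / (exp t - 1)).
Proof.
  intros Hb Hb1 Ht0 Ht.
  assert (Hex : forall s, Rabs s < 1 -> is_pseries b s (PSeries b s)).
  { intros s Hs. apply PSeries_correct. exists (Series (fun n => b n * s ^ n)). apply is_pseries_R, Series_correct.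
    apply ex_series_dom with (2 := ex_series_geom (Rabs s) ltac:(rewrite Rabs_Rabsolu; exact Hs)).
    intros n. rewrite Rabs_mult, <- RPow_abs. rewrite <- (Rmult_1_l (Rabs s ^ n)) at 2.
    apply Rmult_le_compat_r; [apply pow_le, Rabs_pos|apply Hb1]. }
  assert (Hm : is_pseries (PS_mult b (fun n => / INR (fact (S n)))) t (PSeries b t * ((exp t - 1) / t))).
  { apply is_pseries_mult.
    - apply Hex, Ht.
    - apply is_pseries_exp_1, Ht0.
    - apply (CV_radius_gt b t 1 (PSeries b) Ht). intros s Hs; apply Hex. rewrite Rabs_pos_eq; lra.
    - apply (CV_radius_gt _ t 1 (fun s => (exp s - 1) / s) Ht). intros s Hs; apply is_pseries_exp_1; lra. }
  assert (HP : forall n, PS_mult b (fun n => / INR (fact (S n))) n = match n with O => 1 | _ => 0 end).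
  { intros [|n]; unfold PS_mult.
    - simpl. rewrite Hb. simpl. field.
    - rewrite tech5, Nat.sub_diag, (Hb (S n)).
      change (sum_f_R0 (fun k => b k * / INR (fact (S (S n - k)))) n) with
        (sumlt (fun i => b i / INR (fact (S (S n - i)))) (S n)).
      change (INR (fact 1)) with 1. field. }
  assert (H1 : is_pseries (PS_mult b (fun n => / INR (fact (S n)))) t 1).
  { apply is_pseries_R. apply is_series_ext with (fun n => scal 1 (0 ^ n)).
    - intros n. req. rewrite HP. unfold scal; simpl; unfold mult; simpl. destruct n; simpl; ring.
    - evar_last; [apply (is_series_scal (V := R_NormedModule)), is_series_geom; rewrite Rabs_R0; lra|].
      unfold scal; simpl; unfold mult; simpl. field. }
  assert (E := is_pseries_unique _ _ _ Hm). rewrite (is_pseries_unique _ _ _ H1) in E.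
  assert (He : exp t - 1 <> 0).
  { intros Z. apply Ht0. apply exp_inv. rewrite exp_0; lra. }
  replace (t / (exp t - 1)) with (PSeries b t); [apply Hex, Ht|].
  apply Rmult_eq_reg_r with ((exp t - 1) / t).
  - rewrite <- E. field. split; assumption.
  - apply Rmult_integral_contrapositive; split; [exact He|apply Rinv_neq_0_compat, Ht0].
Qed.

Lemma locally'_right (P : R -> Prop) : locally' 0 P -> exists e, 0 < e /\ forall t, 0 < t < e -> P t.
Proof.
  intros [e He]. exists e. split; [apply cond_pos|]. intros t Ht. apply He; [|lra].
  change (Rabs (t - 0) < e). rewrite Rminus_0_r, Rabs_pos_eq; lra.
Qed.

Lemma bernoulli_spec : exists b : nat -> R,
  (forall n, b n = bernoulli n / INR (fact n)) /\
  (forall n, b n = (match n with O => 1 | _ => 0 end) - sumlt (fun i => b i / INR (fact (S (n - i)))) n) /\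
  (forall t, t <> 0 -> Rabs t < 1 -> is_pseries b t (t / (exp t - 1))).
Proof.
  destruct bernoulli_seq as [b [Hb Hb1]].
  assert (Hp := fun t => is_pseries_bernoulli b t Hb Hb1).
  exists b. split; [|split; [exact Hb|exact Hp]].
  assert (HB : bernoulli_egf bernoulli).
  { unfold bernoulli. apply ClassicalEpsilon.epsilon_spec. exists (fun j => b j * INR (fact j)).
    exists posreal_one. intros t Ht Ht0.
    apply is_pseries_ext with b; [intros n; req; field; apply INR_fact_neq_0|].
    apply Hp; [exact Ht0|]. change (Rabs (t - 0) < 1) in Ht. rewrite Rminus_0_r in Ht; exact Ht. }
  destruct (locally'_right _ HB) as [e [He HBe]].
  apply (pseries_unique_right b (fun j => bernoulli j / INR (fact j)) (fun t => t / (exp t - 1)) (Rmin 1 e)).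
  - apply Rmin_pos; lra.
  - intros t Ht. pose proof (Rmin_l 1 e). apply Hp; [lra|]. rewrite Rabs_pos_eq; lra.
  - intros t Ht. pose proof (Rmin_r 1 e). apply HBe; lra.
Qed.

(** From [t / sinh t = 2 t / (exp t - 1) - 2 t / (exp (2 t) - 1)]; the range [v < 1 / 2] keeps [2 v]
    inside the unit disk. Averaging over [v] and [- v] removes the odd coefficients. *)
Lemma is_series_csch (b : nat -> R) (v : R) :
  (forall t, t <> 0 -> Rabs t < 1 -> is_pseries b t (t / (exp t - 1))) -> 0 < v < 1 / 2 ->
  is_pseries (fun m => (2 - 2 ^ (2 * m)) * b (2 * m)%nat) (v ^ 2) (v / sinh v).
Proof.
  intros Hb Hv.
  assert (H : forall t, t <> 0 -> Rabs t < 1 / 2 -> is_series (fun n => (2 - 2 ^ n) * b n * t ^ n) (t / sinh t)).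
  { intros t Ht0 Ht.
    assert (H1 := proj1 (is_pseries_R _ _ _) (Hb t Ht0 ltac:(lra))).
    assert (Ht2 : Rabs (2 * t) < 1) by (rewrite Rabs_mult, (Rabs_pos_eq 2); lra).
    assert (H2 := proj1 (is_pseries_R _ _ _) (Hb (2 * t) ltac:(lra) Ht2)).
    assert (H3 := is_series_minus (V := R_NormedModule) _ _ _ _ (is_series_scal_r 2 _ _ H1) H2).
    evar_last.
    - apply is_series_ext with (2 := H3). intros n. req. unfold minus, plus, opp; simpl plus; simpl opp.
      rewrite Rpow_mult_distr. cbn -[pow]. ring.
    - unfold minus, plus, opp; simpl plus; simpl opp. cbn.
      assert (He : exp t - 1 <> 0).
      { intros Z. apply Ht0. apply exp_inv. rewrite exp_0; lra. }
      unfold sinh. replace (2 * t) with (t + t) by ring. rewrite exp_plus, exp_Ropp.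
      pose proof (exp_pos t).
      field. repeat split; nra. }
  assert (Habs : Rabs v < 1 / 2) by (rewrite Rabs_pos_eq; lra).
  assert (A1 := H v ltac:(lra) Habs).
  assert (A2 := H (- v) ltac:(lra) ltac:(rewrite Rabs_Ropp; exact Habs)).
  assert (A3 := is_series_scal_r (/ 2) _ _ (is_series_plus (V := R_NormedModule) _ _ _ _ A1 A2)).
  assert (Hsign : forall n, (- v) ^ n = (- 1) ^ n * v ^ n).
  { intros n; rewrite <- Rpow_mult_distr; f_equal; ring. }
  apply is_series_even in A3.
  - apply is_pseries_R. evar_last.
    + apply is_series_ext with (2 := A3). intros m. req. unfold plus; simpl plus.
      rewrite Hsign, !(pow_mult v), !(pow_mult (-1)). replace ((-1) ^ 2) with 1 by ring. rewrite pow1.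
      cbn -[pow Nat.mul]. field.
    + unfold plus; cbn. rewrite sinh_opp. pose proof (sinh_pos v ltac:(lra)). field. lra.
  - intros m. unfold plus; cbn -[pow Nat.mul Nat.add]. rewrite Hsign, (pow_add (-1)), (pow_mult (-1)).
    replace ((-1) ^ 2) with 1 by ring. rewrite pow1. simpl. ring.
Qed.

(** * The Lambert series as a power series *)

Definition lamb (y : R) (m n : nat) : R := (2 * INR n + 1) ^ (2 * m - 1) / (exp ((2 * INR n + 1) * y) + 1).

(** The coefficient of [v ^ (2 m)] in [4 v] times the sum of [sinh (j v) / (exp (j y) + 1)]. The
    case [m = 0] is separate, since [2 * m - 1] would be truncated there. *)
Definition sig (y : R) (m : nat) : R :=
  match m with O => 0 | _ => 4 / INR (fact (2 * m - 1)) * Series (lamb y m) end.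

(** Expand each [sinh] and exchange the sums. For [v > 0] all terms are nonnegative, so Tonelli also
    delivers the convergence of every [lamb y m] with [m >= 1]. *)
Lemma is_series_lambert_T (y v L : R) : 0 < v ->
  is_series (fun n => 4 * (sinh ((2 * INR n + 1) * v) / (exp ((2 * INR n + 1) * y) + 1))) L ->
  (forall m, (1 <= m)%nat -> ex_series (lamb y m)) /\
  is_pseries (sig y) (v ^ 2) (v * L).
Proof.
  intros Hv HL.
  assert (HJ : forall n, 0 < 2 * INR n + 1) by (intros n; pose proof (pos_INR n); lra).
  assert (HE : forall n, 0 < exp ((2 * INR n + 1) * y) + 1) by (intros n; pose proof (exp_pos ((2 * INR n + 1) * y)); lra).
  set (a := fun n m => 4 * v * / (exp ((2 * INR n + 1) * y) + 1) *
    (((2 * INR n + 1) * v) ^ (2 * m + 1) / INR (fact (2 * m + 1)))).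
  assert (Ha : forall n m, a n m = 4 * v ^ (2 * (S m)) / INR (fact (2 * S m - 1)) * lamb y (S m) n).
  { intros n m; unfold a, lamb. replace (2 * S m - 1)%nat with (2 * m + 1)%nat by lia.
    rewrite Rpow_mult_distr. replace (2 * S m)%nat with (S (2 * m + 1)) by lia.
    rewrite <- (tech_pow_Rmult v). field. split; first [apply INR_fact_neq_0|apply Rgt_not_eq, HE]. }
  destruct (is_series_tonelli a (fun n => v * (4 * (sinh ((2 * INR n + 1) * v) / (exp ((2 * INR n + 1) * y) + 1)))) (v * L))
    as [T1 T2].
  - intros n m. unfold a. apply Rmult_le_pos; [apply Rmult_le_pos; [lra|apply Rlt_le, Rinv_0_lt_compat, HE]|].
    apply Rmult_le_pos; [apply pow_le, Rmult_le_pos; [apply Rlt_le, HJ|lra]|].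
    apply Rlt_le, Rinv_0_lt_compat, INR_fact_lt_0.
  - intros n. unfold a. evar_last.
    + apply (is_series_scal (V := R_NormedModule)), is_series_sinh.
    + unfold scal; simpl; unfold mult; simpl. field. apply Rgt_not_eq, HE.
  - apply (is_series_scal (V := R_NormedModule) v _ L HL).
  - assert (Hex : forall m, (1 <= m)%nat -> ex_series (lamb y m)).
    { intros [|m] Hm; [lia|].
      set (c := 4 * v ^ (2 * S m) / INR (fact (2 * S m - 1))).
      assert (Hc : 0 < c).
      { unfold c. apply Rmult_lt_0_compat; [apply Rmult_lt_0_compat; [lra|apply pow_lt, Hv]|apply Rinv_0_lt_compat, INR_fact_lt_0]. }
      apply ex_series_ext with (fun n => scal (/ c) (a n m)); [|apply (ex_series_scal (V := R_NormedModule)), T1].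
      intros n. rewrite Ha. fold c. unfold scal; simpl; unfold mult; simpl. field. lra. }
    split; [exact Hex|].
    apply is_pseries_R. apply is_series_decr_1. evar_last.
    + apply is_series_ext with (2 := T2). intros m. req.
      rewrite (Series_ext _ _ (fun n => Ha n m)), Series_scal_l. unfold sig. rewrite <- pow_mult. field. apply INR_fact_neq_0.
    + unfold plus, opp; simpl. unfold sig. ring.
Qed.

(** * The Maclaurin coefficients of u ds(u) *)

(* Coefficient of [u^(2m)] in [u ds(u, k)], read off the Lambert expansion at the
   complementary modulus. *)
Definition dsc (k : R) (m : nat) : R :=
  let k' := sqrt (1 - k ^ 2) in
  ((2 - 2 ^ (2 * m)) * (bernoulli (2 * m) / INR (fact (2 * m))) + sig (par_y k') m) / par_z k' ^ (2 * m).

Lemma conj_conj (k : R) : 0 < k < 1 -> sqrt (1 - sqrt (1 - k ^ 2) ^ 2) = k.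
Proof.
  intros Hk. rewrite pow2_sqrt by nra. replace (1 - (1 - k ^ 2)) with (k ^ 2) by ring.
  apply sqrt_pow2; lra.
Qed.

Lemma conj_sq (k : R) : 0 < k < 1 -> sqrt (1 - k ^ 2) ^ 2 = 1 - k ^ 2.
Proof. intros Hk; apply pow2_sqrt; nra. Qed.

Lemma ds_lambert_ex (k : R) (m : nat) : 0 < k < 1 -> (1 <= m)%nat -> ex_series (lamb (par_y k) m).
Proof.
  intros Hk Hm. assert (Hy := par_y_pos k Hk).
  assert (H := ds_lambert k (par_y k / 2) Hk ltac:(lra)).
  apply (is_series_lambert_T (par_y k) (par_y k / 2)) in H; [|lra]. apply H, Hm.
Qed.

Lemma dsc_series (k : R) : 0 < k < 1 -> exists e, 0 < e /\
  forall u, 0 < u < e -> is_pseries (dsc k) (u ^ 2) (u * ds u k).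
Proof.
  intros Hk. assert (Hk' := conj_01 k Hk). set (k' := sqrt (1 - k ^ 2)) in *.
  assert (Hy := par_y_pos k' Hk'). assert (Hz := par_z_pos k' Hk').
  set (y := par_y k') in *. set (z := par_z k') in *.
  destruct bernoulli_spec as [b [Hb1 [_ Hb]]].
  (* In the variable [v = u / z], the bound [1 / 2] is the range of the cosecant expansion and
     [y / 2] that of [ds_lambert]. *)
  exists (z * Rmin (1 / 2) (y / 2)). split; [apply Rmult_lt_0_compat; [exact Hz|apply Rmin_pos; lra]|].
  intros u Hu. set (v := u / z).
  assert (Ev : u = z * v) by (unfold v; field; lra).
  assert (Hv : 0 < v < Rmin (1 / 2) (y / 2)).
  { split; [apply Rdiv_lt_0_compat; lra|]. apply Rmult_lt_reg_l with z; [exact Hz|]. rewrite <- Ev; lra. }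
  assert (Hv1 : v < 1 / 2) by (pose proof (Rmin_l (1 / 2) (y / 2)); lra).
  assert (Hv2 : v < y / 2) by (pose proof (Rmin_r (1 / 2) (y / 2)); lra).
  assert (S1 := is_series_csch b v Hb ltac:(lra)).
  assert (S2 := ds_lambert k' v Hk' ltac:(fold y; lra)). fold y z in S2.
  unfold k' in S2 at 1. rewrite conj_conj in S2 by exact Hk. rewrite <- Ev in S2.
  apply (is_series_lambert_T y v) in S2; [|lra]. destruct S2 as [_ S2].
  assert (S3 := is_pseries_plus _ _ _ _ _ S1 S2).
  apply is_pseries_R in S3. apply is_pseries_R. evar_last.
  - apply is_series_ext with (2 := S3). intros m. req. unfold PS_plus, plus; simpl plus.
    unfold dsc; fold k' y z. rewrite <- Hb1, Ev, Rpow_mult_distr, Rpow_mult_distr, <- !pow_mult.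
    cbn -[pow Nat.mul sig]. field. apply pow_nonzero; lra.
  - unfold plus; cbn. replace (u * ds u k) with (z * v * ds u k) by (rewrite <- Ev; reflexivity).
    pose proof (sinh_pos v ltac:(lra)). field. lra.
Qed.

Lemma dsc_0 (k : R) : dsc k 0 = 1.
Proof.
  destruct bernoulli_spec as [b [Hb1 [Hb2 _]]].
  unfold dsc. change (2 * 0)%nat with 0%nat. rewrite <- Hb1, Hb2. simpl. field.
Qed.

Definition mono1 (c : R) (n : nat) : R := match n with 1%nat => c | _ => 0 end.

Lemma is_pseries_mono1 (c t : R) : is_pseries (mono1 c) t (c * t).
Proof.
  apply is_pseries_R. apply is_series_decr_1. 
  apply is_series_ext with (fun n => scal (c * t) (0 ^ n)).
  - intros [|n]; req; unfold mono1, scal; simpl; unfold mult; simpl; ring.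
  - evar_last; [apply (is_series_scal (V := R_NormedModule)), is_series_geom; rewrite Rabs_R0; lra|].
    unfold scal, plus, opp; simpl; unfold mult; simpl. field.
Qed.

Definition eulc (g : nat -> R) (n : nat) : R := (2 * INR n - 1) * g n.
Definition quadc (g : nat -> R) (c : R) (n : nat) : R := PS_mult g g n + mono1 c n.

(* For [g(u^2) = u ds(u)] and [T = u^2] this is the coefficient form of
   [(2 T g' - g)^2 = (g^2 + x T) (g^2 - (1 - x) T)]. *)
Definition ds_rec (g : nat -> R) (x : R) : Prop := forall n,
  PS_mult (eulc g) (eulc g) n = PS_mult (quadc g x) (quadc g (x - 1)) n.

(** With [t = u ^ 2] and [ds = G(u ^ 2) / u], the derivative of [ds] is [2 G' - G / t]. Multiplying
    the first-order equation of [ds] by [t ^ 2] gives an identity of power series in [t], valid for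
    small positive [t]. *)
Lemma dsc_rec (k : R) : 0 < k < 1 -> ds_rec (dsc k) (k ^ 2).
Proof.
  intros Hk. destruct (dsc_series k Hk) as [e0 [He0 Hs0]]. set (g := dsc k) in *.
  assert (HK := ellK_pos k Hk). assert (HP := PI_RGT_0).
  set (e := Rmin e0 (2 * ellK k)). assert (He : 0 < e) by (apply Rmin_pos; lra).
  assert (He1 : e <= e0) by apply Rmin_l. assert (He2 : e <= 2 * ellK k) by apply Rmin_r.
  assert (Hroot : forall t, 0 < t < e ^ 2 -> 0 < sqrt t < e /\ sqrt t ^ 2 = t).
  { intros t Ht. split; [split; [apply sqrt_lt_R0; lra|]|apply pow2_sqrt; lra].
    rewrite <- (sqrt_pow2 e) by lra. apply sqrt_lt_1_alt; lra. }
  assert (Hg : forall t, 0 < t < e ^ 2 -> is_pseries g t (PSeries g t)).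
  { intros t Ht. destruct (Hroot t Ht) as [Hr Er]. rewrite <- Er.
    apply PSeries_correct. eexists; apply Hs0; lra. }
  assert (HCg : forall t, 0 < t < e ^ 2 -> Rbar_lt (Rabs t) (CV_radius g)).
  { intros t Ht. apply (CV_radius_gt g t (e ^ 2) (PSeries g)); [rewrite Rabs_pos_eq; lra|exact Hg]. }
  set (G' := fun t => PSeries (PS_derive g) t).
  assert (Hh : forall t, 0 < t < e ^ 2 -> is_pseries (eulc g) t (2 * t * G' t - PSeries g t)).
  { intros t Ht.
    assert (D : is_pseries (PS_derive g) t (G' t)).
    { unfold G'. apply PSeries_correct. eexists. apply is_pseries_derive, HCg, Ht. }
    assert (D2 := is_pseries_minus _ _ _ _ _
       (is_pseries_scal 2 _ t _ (Rmult_comm _ _) (is_pseries_incr_1 _ _ _ D)) (Hg t Ht)).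
    evar_last.
    - apply is_pseries_ext with (2 := D2). intros n. req.
      unfold eulc, PS_minus, PS_plus, PS_opp, PS_scal, PS_incr_1, PS_derive, plus, opp, scal, zero; simpl; unfold mult; simpl.
      destruct n; simpl; ring.
    - unfold plus, opp, scal; simpl; unfold mult; simpl. ring. }
  assert (Hq : forall c t, 0 < t < e ^ 2 -> is_pseries (quadc g c) t (PSeries g t ^ 2 + c * t)).
  { intros c t Ht. evar_last.
    - apply (is_pseries_plus (PS_mult g g) (mono1 c)); [|apply is_pseries_mono1].
      apply is_pseries_mult; [apply Hg, Ht|apply Hg, Ht|apply HCg, Ht|apply HCg, Ht].
    - unfold plus; simpl; ring. }
  assert (Hval : forall t, 0 < t < e ^ 2 -> (2 * t * G' t - PSeries g t) ^ 2 =
    (PSeries g t ^ 2 + k ^ 2 * t) * (PSeries g t ^ 2 + (k ^ 2 - 1) * t)).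
  { intros t Ht. destruct (Hroot t Ht) as [Hr Er]. set (u := sqrt t) in *.
    destruct (is_derive_ds u k Hk ltac:(lra)) as [D1 D2].
    assert (EG : PSeries g t = u * ds u k).
    { rewrite <- Er. apply is_pseries_unique, Hs0; lra. }
    assert (D3 : is_derive (fun s => ds s k) u (2 * G' t - PSeries g t / t)).
    { apply is_derive_ext_loc with (fun s => PSeries g (s ^ 2) / s).
      - assert (Hd : 0 < Rmin u (e - u)) by (apply Rmin_pos; lra).
        exists (mkposreal _ Hd). intros s Hs. change (Rabs (s - u) < Rmin u (e - u)) in Hs.
        pose proof (Rmin_l u (e - u)). pose proof (Rmin_r u (e - u)). apply Rabs_lt_between in Hs.
        rewrite (is_pseries_unique _ _ _ (Hs0 s ltac:(lra))). req. field. lra.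
      - evar_last.
        + apply is_derive_div; [|apply is_derive_id|lra].
          apply (is_derive_comp (V := R_NormedModule) (PSeries g) (fun s => s ^ 2)).
          * rewrite Er. apply is_derive_PSeries, HCg, Ht.
          * apply is_derive_pow, is_derive_id.
        + cbv beta. rewrite Er. fold (G' t). generalize (G' t) (PSeries g t). intros p q.
          rewrite <- Er. unfold scal, one; simpl; unfold mult; simpl. field. lra. }
    assert (ED : - (cos (am u k) / sin (am u k) ^ 2) = 2 * G' t - PSeries g t / t).
    { rewrite <- (is_derive_unique _ _ _ D1). apply is_derive_unique, D3. }
    replace (2 * t * G' t - PSeries g t) with (t * (2 * G' t - PSeries g t / t)) by (field; lra).
    rewrite <- ED, Rpow_mult_distr. replace ((- (cos (am u k) / sin (am u k) ^ 2)) ^ 2) with ((cos (am u k) / sin (am u k) ^ 2) ^ 2) by ring.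
    rewrite D2, EG. rewrite <- Er. ring. }
  assert (HCV : forall (a : nat -> R) f, (forall t, 0 < t < e ^ 2 -> is_pseries a t (f t)) ->
     forall t, 0 < t < e ^ 2 -> Rbar_lt (Rabs t) (CV_radius a)).
  { intros a f Ha t Ht. apply (CV_radius_gt a t (e ^ 2) f); [rewrite Rabs_pos_eq; lra|exact Ha]. }
  unfold ds_rec. apply (pseries_unique_right (PS_mult (eulc g) (eulc g))
    (PS_mult (quadc g (k ^ 2)) (quadc g (k ^ 2 - 1))) (fun t => (2 * t * G' t - PSeries g t) ^ 2) (e ^ 2)).
  - apply pow_lt, He.
  - intros t Ht. evar_last.
    + apply is_pseries_mult; [apply Hh, Ht|apply Hh, Ht|apply (HCV _ _ Hh t Ht)|apply (HCV _ _ Hh t Ht)].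
    + simpl; ring.
  - intros t Ht. rewrite Hval by exact Ht.
    apply is_pseries_mult; [apply Hq, Ht|apply Hq, Ht|apply (HCV _ _ (Hq _) t Ht)|apply (HCV _ _ (Hq _) t Ht)].
Qed.

(** The recursion solved for its top coefficient [g (S m)]. The left side contains it with factor
    [- (4 m + 2)], the right side with factor 4, whence the divisor [4 m + 6]. It is a nonzero
    integer, so rationality propagates. *)
Definition ds_step (g : nat -> R) (x : R) (m : nat) : R :=
  (sumlt (fun i => eulc g (S i) * eulc g (m - i)) m - 2 * sumlt (fun i => g (S i) * g (m - i)%nat) m
   - sumlt (fun i => quadc g x (S i) * quadc g (x - 1) (m - i)) m - mono1 (2 * x - 1) (S m))
  * / INR (4 * m + 6).

Lemma PS_mult_ends (a b : nat -> R) (m : nat) :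
  PS_mult a b (S m) = a 0%nat * b (S m) + sumlt (fun i => a (S i) * b (m - i)%nat) m + a (S m) * b 0%nat.
Proof. unfold PS_mult. rewrite sum_f_R0_ends, Nat.sub_diag. reflexivity. Qed.

Lemma ds_rec_step (g : nat -> R) (x : R) (m : nat) : g 0%nat = 1 -> ds_rec g x -> g (S m) = ds_step g x m.
Proof.
  intros H0 H. specialize (H (S m)). rewrite !PS_mult_ends in H.
  assert (Q0 : forall c, quadc g c 0 = 1) by (intros c; unfold quadc, PS_mult; simpl; rewrite H0; ring).
  rewrite !Q0 in H. unfold quadc at 1 4 in H. rewrite !PS_mult_ends in H.
  unfold eulc at 1 2 5 6 in H. rewrite !H0 in H.
  unfold ds_step.
  assert (E : mono1 (2 * x - 1) (S m) = mono1 x (S m) + mono1 (x - 1) (S m)) by (destruct m; simpl; ring).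
  rewrite E. replace (INR (4 * m + 6)) with (4 * INR m + 6) by (rewrite plus_INR, mult_INR; simpl; ring).
  pose proof (pos_INR m). simpl (INR 0) in H. rewrite S_INR in H.
  apply Rmult_eq_reg_r with (4 * INR m + 6); [|lra]. rewrite Rmult_assoc, Rinv_l by lra. lra.
Qed.

Lemma PS_mult_ext_le (a b a' b' : nat -> R) (n : nat) :
  (forall i, (i <= n)%nat -> a i = a' i) -> (forall i, (i <= n)%nat -> b i = b' i) ->
  PS_mult a b n = PS_mult a' b' n.
Proof.
  intros Ha Hb. unfold PS_mult. apply sum_eq. intros i Hi. rewrite Ha, Hb by lia. reflexivity.
Qed.

Lemma ds_step_ext (g h : nat -> R) (x : R) (m : nat) :
  (forall i, (i <= m)%nat -> g i = h i) -> ds_step g x m = ds_step h x m.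
Proof.
  intros H. unfold ds_step.
  assert (Q : forall c i, (i <= m)%nat -> quadc g c i = quadc h c i).
  { intros c i Hi. unfold quadc. f_equal. apply PS_mult_ext_le; intros; apply H; lia. }
  f_equal. f_equal. f_equal; [f_equal; [|f_equal]|]; apply sumlt_ext; intros i Hi.
  - unfold eulc; rewrite !H by lia; reflexivity.
  - rewrite !H by lia; reflexivity.
  - rewrite !Q by lia; reflexivity.
Qed.

Lemma ds_rec_unique (g h : nat -> R) (x : R) :
  g 0%nat = 1 -> h 0%nat = 1 -> ds_rec g x -> ds_rec h x -> forall n, g n = h n.
Proof.
  intros Hg0 Hh0 Hg Hh.
  assert (HN : forall N n, (n <= N)%nat -> g n = h n).
  { induction N as [|N IH]; intros n Hn.
    - replace n with 0%nat by lia. congruence.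
    - destruct n as [|n]; [congruence|].
      rewrite (ds_rec_step g x n Hg0 Hg), (ds_rec_step h x n Hh0 Hh).
      apply ds_step_ext. intros i Hi; apply IH; lia. }
  intros n; apply (HN n n); lia.
Qed.

Lemma sum_f_R0_rev (f : nat -> R) (n : nat) : sum_f_R0 f n = sum_f_R0 (fun i => f (n - i)%nat) n.
Proof.
  induction n as [|n IH]; [reflexivity|].
  rewrite (decomp_sum (fun i => f (S n - i)%nat)) by lia. rewrite tech5, IH. simpl. ring.
Qed.

Lemma PS_mult_comm (a b : nat -> R) (n : nat) : PS_mult a b n = PS_mult b a n.
Proof.
  unfold PS_mult. rewrite sum_f_R0_rev. apply sum_eq. intros i Hi.
  replace (n - (n - i))%nat with i by lia. ring.
Qed.

Lemma PS_mult_sign (a b : nat -> R) (n : nat) :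
  PS_mult (fun i => (-1) ^ i * a i) (fun i => (-1) ^ i * b i) n = (-1) ^ n * PS_mult a b n.
Proof.
  unfold PS_mult. rewrite scal_sum. apply sum_eq. intros i Hi.
  replace ((-1) ^ n) with ((-1) ^ i * (-1) ^ (n - i)) by (rewrite <- pow_add; f_equal; lia). ring.
Qed.

(* Jacobi's imaginary transformation [u -> i u, x -> 1 - x], read off the recursion. *)
Lemma dsc_conj (k : R) (n : nat) : 0 < k < 1 -> dsc (sqrt (1 - k ^ 2)) n = (-1) ^ n * dsc k n.
Proof.
  intros Hk. assert (Hk' := conj_01 k Hk). set (g := dsc k). set (h := fun n => (-1) ^ n * g n).
  apply (ds_rec_unique (dsc (sqrt (1 - k ^ 2))) h (1 - k ^ 2)).
  - apply dsc_0.
  - unfold h, g; rewrite dsc_0; simpl; ring.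
  - assert (X := dsc_rec _ Hk'). rewrite (conj_sq k Hk) in X. exact X.
  - intros i. 
    assert (E1 : forall j, eulc h j = (-1) ^ j * eulc g j) by (intros j; unfold eulc, h; ring).
    assert (E2 : forall c j, quadc h (- c) j = (-1) ^ j * quadc g c j).
    { intros c j. unfold quadc, h. rewrite PS_mult_sign, Rmult_plus_distr_l. f_equal.
      destruct j as [|[|j]]; simpl; ring. }
    rewrite (PS_mult_ext_le _ _ _ _ i (fun j _ => E1 j) (fun j _ => E1 j)), PS_mult_sign, (dsc_rec k Hk).
    (* The sign change [T -> - T] flips the constants of the two quadratic factors, and passing to
       [1 - x] exchanges those factors. *)
    replace (1 - k ^ 2) with (- (k ^ 2 - 1)) by ring. replace (- (k ^ 2 - 1) - 1) with (- k ^ 2) by ring.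
    rewrite (PS_mult_ext_le _ _ _ _ i (fun j _ => E2 (k ^ 2 - 1) j) (fun j _ => E2 (k ^ 2) j)), PS_mult_sign, PS_mult_comm.
    reflexivity.
Qed.

(** The expansion in [u ^ 2] is known for [u > 0]; evenness of [u * ds u k] extends it to the whole
    punctured neighbourhood. *)
Lemma ds_full_series (k : R) (a : nat -> R) : 0 < k < 1 ->
  (forall m, a (2 * m)%nat = dsc k m) -> (forall m, a (2 * m + 1)%nat = 0) ->
  locally' 0 (fun u => is_pseries a u (u * ds u k)).
Proof.
  intros Hk Ha0 Ha1. destruct (dsc_series k Hk) as [e [He Hs]].
  assert (H : forall u, 0 < Rabs u < e -> is_pseries (dsc k) (u ^ 2) (u * ds u k)).
  { intros u Hu. rewrite <- pow2_abs. replace (u * ds u k) with (Rabs u * ds (Rabs u) k); [apply Hs, Hu|].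
    unfold Rabs; destruct (Rcase_abs u); [rewrite ds_opp by exact Hk; ring|reflexivity]. }
  exists (mkposreal e He). intros u Hu Hu0. change (Rabs (u - 0) < e) in Hu. rewrite Rminus_0_r in Hu.
  evar_last.
  - apply (is_pseries_odd_even a u (u * ds u k) 0).
    + apply is_pseries_ext with (dsc k); [intros m; symmetry; apply Ha0|].
      apply H. split; [apply Rabs_pos_lt, Hu0|exact Hu].
    + apply is_pseries_ext with (mono1 0); [intros m; rewrite Ha1; destruct m as [|[|m]]; reflexivity|].
      evar_last; [apply is_pseries_mono1|ring].
  - ring.
Qed.

(** * Rationality *)

Notation ratrR := (ratr : {rmorphism rat -> R}).

Lemma Qeval_add (P Q : {poly rat}) (x : R) : Qeval (P + Q)%R x = Qeval P x + Qeval Q x.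
Proof.
  transitivity (map_poly ratrR P + map_poly ratrR Q)%R.[x]%R; [|apply hornerD].
  unfold Qeval; f_equal. exact (GRing.rmorphD (map_poly ratrR) P Q).
Qed.

Lemma Qeval_mul (P Q : {poly rat}) (x : R) : Qeval (P * Q)%R x = Qeval P x * Qeval Q x.
Proof.
  transitivity (map_poly ratrR P * map_poly ratrR Q)%R.[x]%R; [|apply hornerM].
  unfold Qeval; f_equal. exact (GRing.rmorphM (map_poly ratrR) P Q).
Qed.

Lemma Qeval_const (c : rat) (x : R) : Qeval (c%:P)%R x = ratr c.
Proof.
  transitivity ((ratrR c)%:P.[x])%R; [|apply hornerC].
  unfold Qeval; f_equal. exact (map_polyC ratrR c).
Qed.

Lemma Qeval_X (x : R) : Qeval ('X)%R x = x.
Proof.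
  transitivity ('X.[x])%R; [|apply hornerX].
  unfold Qeval; f_equal. exact (map_polyX ratrR).
Qed.

(** The polynomial is chosen before [k], as [ds_maclaurin] requires. Closure under ring operations
    makes rationality an induction along the recursion, and constant functions bring rational
    numbers such as the Bernoulli numbers under the same rules. *)
Definition Qfun (f : R -> R) : Prop :=
  exists P : {poly rat}, forall k, 0 < k < 1 -> f k = Qeval P (k ^ 2).

Lemma Qfun_ext (f g : R -> R) : (forall k, 0 < k < 1 -> f k = g k) -> Qfun f -> Qfun g.
Proof. intros H [P HP]; exists P; intros k Hk; rewrite <- H by exact Hk; apply HP, Hk. Qed.

Lemma Qfun_plus (f g : R -> R) : Qfun f -> Qfun g -> Qfun (fun k => f k + g k).
Proof.
  intros [P HP] [Q HQ]; exists (P + Q)%R; intros k Hk.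
  rewrite HP, HQ, Qeval_add by exact Hk; reflexivity.
Qed.

Lemma Qfun_mult (f g : R -> R) : Qfun f -> Qfun g -> Qfun (fun k => f k * g k).
Proof.
  intros [P HP] [Q HQ]; exists (P * Q)%R; intros k Hk.
  rewrite HP, HQ, Qeval_mul by exact Hk; reflexivity.
Qed.

Lemma Qfun_ratr (c : rat) : Qfun (fun _ => ratr c).
Proof. exists (c%:P)%R; intros k Hk. rewrite Qeval_const; reflexivity. Qed.

Lemma Qfun_INR (n : nat) : Qfun (fun _ => INR n).
Proof.
  apply Qfun_ext with (2 := Qfun_ratr (n%:R)%R). intros k _.
  rewrite INRE. exact (GRing.rmorph_nat ratrR n).
Qed.

Lemma Qfun_inv_INR (n : nat) : Qfun (fun _ => / INR n).
Proof.
  apply Qfun_ext with (2 := Qfun_ratr ((n%:R)^-1)%R). intros k _.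
  rewrite INRE, RinvE. transitivity ((ratrR n%:R)^-1)%R; [exact (GRing.fmorphV ratrR _)|].
  f_equal. exact (GRing.rmorph_nat ratrR n).
Qed.

Lemma Qfun_opp1 : Qfun (fun _ => -1).
Proof.
  apply Qfun_ext with (2 := Qfun_ratr (-1)%R). intros k _.
  exact (GRing.rmorphN1 ratrR).
Qed.

Lemma Qfun_x : Qfun (fun k => k ^ 2).
Proof. exists ('X)%R; intros k Hk. rewrite Qeval_X; reflexivity. Qed.

Lemma Qfun_opp (f : R -> R) : Qfun f -> Qfun (fun k => - f k).
Proof.
  intros H. apply Qfun_ext with (2 := Qfun_mult _ _ Qfun_opp1 H). intros; ring.
Qed.

Lemma Qfun_minus (f g : R -> R) : Qfun f -> Qfun g -> Qfun (fun k => f k - g k).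
Proof. intros Hf Hg. apply (Qfun_plus f (fun k => - g k) Hf), Qfun_opp, Hg. Qed.

Lemma Qfun_pow (f : R -> R) (n : nat) : Qfun f -> Qfun (fun k => f k ^ n).
Proof.
  intros Hf; induction n as [|n IH]; [apply (Qfun_INR 1)|apply (Qfun_mult _ _ Hf IH)].
Qed.

Lemma Qfun_sumlt (F : nat -> R -> R) (n : nat) : (forall i, (i < n)%nat -> Qfun (F i)) ->
  Qfun (fun k => sumlt (fun i => F i k) n).
Proof.
  induction n as [|n IH]; intros H; [apply (Qfun_INR 0)|].
  apply Qfun_ext with (fun k => sumlt (fun i => F i k) n + F n k).
  - intros k _; rewrite sumlt_S; reflexivity.
  - apply Qfun_plus; [apply IH; intros; apply H; lia|apply H; lia].
Qed.

Lemma Qfun_PS_mult (a b : R -> nat -> R) (n : nat) :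
  (forall i, (i <= n)%nat -> Qfun (fun k => a k i)) -> (forall i, (i <= n)%nat -> Qfun (fun k => b k i)) ->
  Qfun (fun k => PS_mult (a k) (b k) n).
Proof.
  intros Ha Hb. apply (Qfun_sumlt (fun i k => a k i * b k (n - i)%nat) (S n)).
  intros i Hi; apply Qfun_mult; [apply Ha; lia|apply Hb; lia].
Qed.

Lemma Qfun_ds_step (g : R -> nat -> R) (m : nat) :
  (forall i, (i <= m)%nat -> Qfun (fun k => g k i)) -> Qfun (fun k => ds_step (g k) (k ^ 2) m).
Proof.
  intros Hg.
  assert (H1 : Qfun (fun _ => 1)) by apply (Qfun_INR 1).
  assert (H2 : Qfun (fun _ => 2)) by apply (Qfun_INR 2).
  assert (Hmono : forall (c : R -> R) j, Qfun c -> Qfun (fun k => mono1 (c k) j)).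
  { intros c [|[|j]] Hc; [apply (Qfun_INR 0)|exact Hc|apply (Qfun_INR 0)]. }
  assert (Heul : forall i, (i <= m)%nat -> Qfun (fun k => eulc (g k) i)).
  { intros i Hi. apply Qfun_mult; [|apply Hg, Hi].
    apply (Qfun_minus (fun _ => 2 * INR i)); [apply (Qfun_mult _ _ H2), Qfun_INR|exact H1]. }
  assert (Hquad : forall c i, Qfun c -> (i <= m)%nat -> Qfun (fun k => quadc (g k) (c k) i)).
  { intros c i Hc Hi. apply Qfun_plus; [|apply Hmono, Hc].
    apply Qfun_PS_mult; intros; apply Hg; lia. }
  unfold ds_step. apply Qfun_mult; [|apply Qfun_inv_INR].
  apply Qfun_minus; [apply Qfun_minus; [apply Qfun_minus|]|].
  - apply (Qfun_sumlt (fun i k => eulc (g k) (S i) * eulc (g k) (m - i))).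
    intros i Hi; apply Qfun_mult; apply Heul; lia.
  - apply (Qfun_mult _ _ H2), (Qfun_sumlt (fun i k => g k (S i) * g k (m - i)%nat)).
    intros i Hi; apply Qfun_mult; apply Hg; lia.
  - apply (Qfun_sumlt (fun i k => quadc (g k) (k ^ 2) (S i) * quadc (g k) (k ^ 2 - 1) (m - i))).
    intros i Hi; apply Qfun_mult.
    + apply (Hquad (fun k => k ^ 2)); [apply Qfun_x|lia].
    + apply (Hquad (fun k => k ^ 2 - 1)); [apply (Qfun_minus _ _ Qfun_x H1)|lia].
  - apply (Hmono (fun k => 2 * k ^ 2 - 1)). apply (Qfun_minus (fun k => 2 * k ^ 2)); [apply (Qfun_mult _ _ H2 Qfun_x)|exact H1].
Qed.

Lemma Qfun_dsc (n : nat) : Qfun (fun k => dsc k n).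
Proof.
  assert (HN : forall N n, (n <= N)%nat -> Qfun (fun k => dsc k n)).
  { induction N as [|N IH]; intros p Hp.
    - apply Qfun_ext with (2 := Qfun_INR 1). intros k _. replace p with 0%nat by lia. rewrite dsc_0; reflexivity.
    - destruct p as [|p].
      + apply Qfun_ext with (2 := Qfun_INR 1). intros k _. rewrite dsc_0; reflexivity.
      + apply Qfun_ext with (fun k => ds_step (dsc k) (k ^ 2) p).
        * intros k Hk. symmetry; apply ds_rec_step; [apply dsc_0|apply dsc_rec, Hk].
        * apply Qfun_ds_step. intros i Hi; apply IH; lia. }
  apply (HN n n); lia.
Qed.

Lemma Qfun_bernoulli (n : nat) : Qfun (fun _ => bernoulli n).
Proof.
  destruct bernoulli_spec as [b [Hb1 [Hb2 _]]].
  assert (HN : forall N p, (p <= N)%nat -> Qfun (fun _ => b p)).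
  { induction N as [|N IH]; intros p Hp.
    - apply Qfun_ext with (2 := Qfun_INR 1). intros k _. replace p with 0%nat by lia. rewrite Hb2. simpl; ring.
    - apply Qfun_ext with (fun _ => (match p with O => 1 | _ => 0 end) - sumlt (fun i => b i / INR (fact (S (p - i)))) p).
      + intros k _; symmetry; apply Hb2.
      + apply Qfun_minus; [destruct p; [apply (Qfun_INR 1)|apply (Qfun_INR 0)]|].
        apply (Qfun_sumlt (fun i _ => b i / INR (fact (S (p - i))))).
        intros i Hi. apply Qfun_mult; [apply IH; lia|apply Qfun_inv_INR]. }
  apply Qfun_ext with (2 := Qfun_mult _ _ (HN n n (le_n _)) (Qfun_INR (fact n))).
  intros k _. rewrite Hb1. field. apply INR_fact_neq_0.
Qed.

(** * The polynomials [q_] and the closed form of the sums *)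

Definition dsc_full (k : R) (n : nat) : R := if Nat.even n then dsc k (Nat.div2 n) else 0.

Lemma dsc_full_even (k : R) (m : nat) : dsc_full k (2 * m) = dsc k m.
Proof. unfold dsc_full. rewrite Nat.even_even, Nat.div2_double. reflexivity. Qed.

Lemma dsc_full_odd (k : R) (m : nat) : dsc_full k (2 * m + 1) = 0.
Proof. unfold dsc_full. rewrite Nat.even_odd. reflexivity. Qed.

Lemma dsc_full_series (k : R) : 0 < k < 1 ->
  locally' 0 (fun u => is_pseries (dsc_full k) u (u * ds u k)).
Proof. intros Hk; apply ds_full_series; [exact Hk|apply dsc_full_even|apply dsc_full_odd]. Qed.

Lemma ds_maclaurin_q : ds_maclaurin q_.
Proof.
  unfold q_. apply ClassicalEpsilon.epsilon_spec.
  assert (HQ : forall n, Qfun (fun k => dsc_full k n * INR (fact n))).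
  { intros n. apply Qfun_mult; [|apply Qfun_INR]. unfold dsc_full.
    destruct (Nat.even n); [apply Qfun_dsc|apply (Qfun_INR 0)]. }
  (* A polynomial is selected for each [n] separately; the selection does not involve [k]. *)
  exists (fun n => proj1_sig (ClassicalEpsilon.constructive_indefinite_description _ (HQ n))).
  intros k Hk. apply filter_imp with (2 := dsc_full_series k Hk). intros u Hu.
  apply is_pseries_ext with (2 := Hu). intros n. req.
  destruct (ClassicalEpsilon.constructive_indefinite_description _ (HQ n)) as [P HP]. simpl proj1_sig.
  rewrite <- HP by exact Hk. field. apply INR_fact_neq_0.
Qed.

Lemma q_coef (k : R) (m : nat) : 0 < k < 1 ->
  Qeval (q_ (2 * m)) (k ^ 2) / INR (fact (2 * m)) = dsc k m.
Proof.
  intros Hk. rewrite <- dsc_full_even.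
  destruct (locally'_right _ (ds_maclaurin_q k Hk)) as [e1 [He1 H1]].
  destruct (locally'_right _ (dsc_full_series k Hk)) as [e2 [He2 H2]].
  apply (pseries_unique_right (fun n => Qeval (q_ n) (k ^ 2) / INR (fact n)) (dsc_full k)
    (fun u => u * ds u k) (Rmin e1 e2)).
  - apply Rmin_pos; assumption.
  - intros t Ht. pose proof (Rmin_l e1 e2). apply H1; lra.
  - intros t Ht. pose proof (Rmin_r e1 e2). apply H2; lra.
Qed.

(** By definition, [dsc] at the complementary modulus contains [par_y k] and [par_z k]. Moving it to
    modulus [k] with [dsc_conj] produces the sign [(-1) ^ m] and the value of [q_] at [par_x k], and
    the resulting linear equation is solved for the series. *)
Lemma Series_lamb (k : R) (m : nat) : 0 < k < 1 -> (1 <= m)%nat ->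
  Series (lamb (par_y k) m) = 1 / (8 * INR m) *
    ((-1) ^ m * Qeval (q_ (2 * m)) (par_x k) * par_z k ^ (2 * m)
     + 2 * (2 ^ (2 * m - 1) - 1) * bernoulli (2 * m)).
Proof.
  intros Hk Hm. assert (Hz := par_z_pos k Hk).
  assert (E := dsc_conj k m Hk). rewrite <- (q_coef k m Hk) in E.
  unfold dsc in E. rewrite conj_conj in E by exact Hk. unfold par_x.
  destruct m as [|m]; [lia|]. unfold sig in E.
  assert (EF : INR (fact (2 * S m)) = 2 * INR (S m) * INR (fact (2 * S m - 1))).
  { replace (2 * S m)%nat with (S (2 * S m - 1)) at 1 by lia. rewrite fact_simpl, mult_INR.
    replace (S (2 * S m - 1)) with (2 * S m)%nat by lia. rewrite mult_INR; reflexivity. }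
  assert (EP : 2 ^ (2 * S m) = 2 * 2 ^ (2 * S m - 1)).
  { replace (2 * S m)%nat with (S (2 * S m - 1)) at 1 by lia. reflexivity. }
  rewrite EF, EP in E.
  set (Q := Qeval _ _) in *. set (B := bernoulli _) in *. set (L := Series _) in *.
  set (F := INR (fact (2 * S m - 1))) in *. set (Z := par_z k ^ (2 * S m)) in *.
  set (N := INR (S m)) in *. set (p := 2 ^ (2 * S m - 1)) in *. set (s := (-1) ^ S m) in *.
  assert (HF : 0 < F) by apply INR_fact_lt_0. assert (HZ : 0 < Z) by apply pow_lt, Hz.
  assert (HN : 0 < N) by (apply lt_0_INR; lia).
  (* The equation cleared of [(2 m)! z ^ (2 m)]; the factor [8 m] arises from
     [4 (2 m)! / (2 m - 1)!]. *)
  assert (E2 : (2 - 2 * p) * B + 8 * N * L = s * Q * Z).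
  { transitivity (((2 - 2 * p) * (B / (2 * N * F)) + 4 / F * L) / Z * (2 * N * F * Z)); [field; lra|].
    rewrite E. field. lra. }
  replace (s * Q * Z) with ((2 - 2 * p) * B + 8 * N * L). field. lra.
Qed.

Lemma Qeval2_CXn_C (A B : {poly rat}) (n : nat) (x z : R) :
  Qeval2 (A%:P * 'X^n + B%:P)%R x z = Qeval A x * z ^ n + Qeval B x.
Proof.
  unfold Qeval2. set (f := map_poly ratrR).
  transitivity ((((f A)%:P * 'X^n + (f B)%:P).[z%:P]).[x])%R.
  - do 2 f_equal. 
    transitivity (map_poly f (A%:P * 'X^n) + map_poly f (B%:P))%R; [exact (GRing.rmorphD (map_poly f) _ _)|].
    f_equal; [|exact (map_polyC f B)].
    transitivity (map_poly f (A%:P) * map_poly f ('X^n))%R; [exact (GRing.rmorphM (map_poly f) _ _)|].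
    f_equal; [exact (map_polyC f A)|exact (map_polyXn f n)].
  - transitivity ((f A * (z%:P) ^+ n + f B).[x])%R.
    + f_equal. transitivity (((f A)%:P * 'X^n).[z%:P] + ((f B)%:P).[z%:P])%R; [apply hornerD|].
      f_equal; [|apply hornerC].
      transitivity (((f A)%:P).[z%:P] * ('X^n).[z%:P])%R; [apply hornerM|].
      f_equal; [apply hornerC|apply hornerXn].
    + transitivity ((f A * (z%:P) ^+ n).[x] + (f B).[x])%R; [apply hornerD|].
      apply (f_equal (fun t => t + Qeval B x)).
      transitivity ((f A).[x] * ((z%:P) ^+ n).[x])%R; [apply hornerM|].
      apply (f_equal (fun t => Qeval A x * t)). rewrite RpowE.
      transitivity ((z%:P).[x] ^+ n)%R; [apply horner_exp|]. f_equal. apply hornerC.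
Qed.

Theorem theorem8p8 (m : nat) (hm : (1 <= m)%nat) :
  exists P : {poly {poly rat}},
    forall k : R, 0 < k < 1 ->
      let x := par_x k in
      let y := par_y k in
      let z := par_z k in
      let S := 1 / (8 * INR m) *
        ((-1) ^ m * Qeval (q_ (2 * m)) x * z ^ (2 * m)
         + 2 * (2 ^ (2 * m - 1) - 1) * bernoulli (2 * m)) in
      is_series
        (fun n : nat =>
           (2 * INR n + 1) ^ (2 * m - 1) / (exp ((2 * INR n + 1) * y) + 1)) S
      /\ S = Qeval2 P x z.
Proof.
  assert (HA : Qfun (fun k => 1 / (8 * INR m) * ((-1) ^ m * Qeval (q_ (2 * m)) (k ^ 2)))).
  { apply Qfun_mult.
    - apply Qfun_ext with (2 := Qfun_inv_INR (8 * m)). intros k _. rewrite mult_INR. simpl (INR 8).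
      replace (1 + 1 + 1 + 1 + 1 + 1 + 1 + 1) with 8 by ring. unfold Rdiv; ring.
    - apply Qfun_mult; [apply Qfun_pow, Qfun_opp1|]. exists (q_ (2 * m)); reflexivity. }
  assert (HB : Qfun (fun k => 1 / (8 * INR m) * (2 * (2 ^ (2 * m - 1) - 1) * bernoulli (2 * m)))).
  { apply Qfun_mult.
    - apply Qfun_ext with (2 := Qfun_inv_INR (8 * m)). intros k _. rewrite mult_INR. simpl (INR 8).
      replace (1 + 1 + 1 + 1 + 1 + 1 + 1 + 1) with 8 by ring. unfold Rdiv; ring.
    - apply Qfun_mult; [|apply Qfun_bernoulli]. apply Qfun_mult; [apply (Qfun_INR 2)|].
      apply Qfun_minus; [apply Qfun_pow, (Qfun_INR 2)|apply (Qfun_INR 1)]. }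
  destruct HA as [A HA], HB as [B HB].
  exists (A%:P * 'X^(2 * m) + B%:P)%R. intros k Hk x y z S. split.
  - unfold S, x, z. rewrite <- Series_lamb by assumption.
    apply Series_correct, ds_lambert_ex; assumption.
  - rewrite Qeval2_CXn_C. unfold x, par_x. rewrite <- HA, <- HB by exact Hk.
    unfold S, x, par_x. ring.
Qed.
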